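(* Consider $\min_{x\in\mathbb{R}^d} f(x)$ with $f=\frac1n\sum_{i=1}^n f_i$ and $f_i(x)=\mathbb{E}_{\xi_i\sim\mathcal{D}_i}[f_i(x;\xi_i)]$. Assume: (i) every compressor $\mathcal{C}_i^t$ is $\alpha$-contractive with a common $\alpha\in(0,1]$; (ii) $f^{\inf}:=\inf_{x\in\mathbb{R}^d} f(x)>-\infty$; (iii) for each $i$ there is $L_i>0$ with $\|\nabla f_i(x)-\nabla f_i(y)\|\le L_i\|x-y\|$ for all $x,y\in\mathbb{R}^d$; (iv) there is $L>0$ with $\|\nabla f(x)-\nabla f(y)\|\le L\|x-y\|$ for all $x,y\in\mathbb{R}^d$; (v) for all $i$ and all $x\in\mathbb{R}^d$: $\mathbb{E}[\nabla f_i(x;\xi_i)]=\nabla f_i(x)$ and $\mathbb{E}\|\nabla f_i(x;\xi_i)-\nabla f_i(x)\|^2\le\sigma_g^2$, and also $\mathbb{E}[\nabla^2 f_i(x;\xi_i)]=\nabla^2 f_i(x)$ and $\mathbb{E}\|\nabla^2 f_i(x;\xi_i)-\nabla^2 f_i(x)\|^2\le\sigma_h^2$. Let $\gamma_0>0$ and $$\eta_t=\left(\frac{2}{t+2}\right)^{2/3},\qquad \gamma_t=\gamma_0\left(\frac{2}{t+2}\right)^{2/3}.$$ Then for every $T\ge1$ the iterates $\{x^t\}$ of the algorithm $\|\text{EF21-RHM}\|$ satisfy $$\mathbb{E}\big[\|\nabla f(\tilde x^T)\|\big]=\widetilde{\mathcal{O}}\left(\frac{V_0/\gamma_0+(\sigma_g+\gamma_0\sigma_h)\left(1/\sqrt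 n+1/\alpha^2\right)+\gamma_0\left(L+\bar L/\alpha^2\right)}{T^{1/3}}\right),$$ where $\tilde x^T$ is chosen at random from $\{x^0,\dots,x^{T-1}\}$, equal to $x^t$ with probability $\gamma_t/\sum_{s=0}^{T-1}\gamma_s$, and $\bar L=\frac1n\sum_{i=1}^nL_i$.
   Context: $\|\cdot\|$ is the Euclidean norm for vectors and the spectral norm for matrices. A possibly randomized map $\mathcal{C}:\mathbb{R}^d\to\mathbb{R}^d$ is $\alpha$-contractive if $\mathbb{E}\|\mathcal{C}(v)-v\|^2\le(1-\alpha)\|v\|^2$ for all $v\in\mathbb{R}^d$. Algorithm $\|\text{EF21-RHM}\|$. Inputs: $x^0\in\mathbb{R}^d$ and $g_i^0,v_i^0\in\mathbb{R}^d$ for $i=1,\dots,n$ (deterministic), stepsizes $\gamma_t>0$, momentum parameters $\eta_t\in(0,1]$, compressors $\mathcal{C}_i^t$. For $t=0,1,2,\dots$, with $g^t=\frac1n\sum_{i=1}^n g_i^t$: $$x^{t+1}=x^t-\gamma_t\frac{g^t}{\|g^t\|},\qquad \hat x^{t+1}=q_tx^{t+1}+(1-q_t)x^t,\quad q_t\sim\mathrm{Uniform}(0,1),$$ $$v_i^{t+1}=(1-\eta_t)\left(v_i^t+\nabla^2f_i(\hat x^{t+1};\xi_i^{t+1})(x^{t+1}-x^t)\right)+\eta_t\nabla f_i(x^{t+1};\xi_i^{t+1}),\qquad g_i^{t+1}=g_i^t+\mathcal{C}_i^{t+1}(v_i^{t+1}-g_i^t).$$ If $g^t=0$, the quotient $g^t/\|g^t\|$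 is read as $0$. The samples $\xi_i^{t+1}\sim\mathcal{D}_i$ are independent across clients $i$ and iterations $t$ and independent of everything generated earlier; $q_t$ is independent of the samples and of everything generated earlier; the randomness of the compressor $\mathcal{C}_i^{t+1}$ is fresh, i.e. independent of its input and of the past. $\displaystyle V_0=f(x^0)-f^{\inf}+\frac{2\gamma_0}{1-\sqrt{1-\alpha}}\cdot\frac1n\sum_{i=1}^n\|g_i^0-v_i^0\|+\frac{2\gamma_0\sqrt{1-\alpha}}{1-\sqrt{1-\alpha}}\cdot\frac1n\sum_{i=1}^n\|v_i^0-\nabla f_i(x^0)\|.$ $A_T=\widetilde{\mathcal{O}}(B_T)$ means that there are universal numerical constants $C>0$, $p\ge0$ (independent of the problem, of the algorithm's inputs, and of $T$) such that $A_T\le C(1+\log(T+1))^pB_T$ for all $T\ge1$. The functions $f_i$ and $f_i(\cdot;\xi_i)$ are twice differentiable. *)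

(* Defs.v *)
(* MathComp / MathComp-Analysis *)
From HB Require Import structures.
From mathcomp Require Import all_boot all_order all_algebra.
From mathcomp Require Import all_classical all_reals all_analysis.
Set Implicit Arguments.
Unset Strict Implicit.
Unset Printing Implicit Defensive.
Import Order.TTheory GRing.Theory Num.Theory.
Import numFieldNormedType.Exports.
Local Open Scope classical_set_scope.
Local Open Scope ring_scope.

(* Points of R^d are row vectors.  The library norm of a matrix is the maximum
   of the absolute values of its entries, hence the two norms below. *)

Definition enorm (R : realType) (d : nat) (x : 'rV[R]_d) : R :=
  Num.sqrt (\sum_(j < d) x 0 j ^+ 2).

(* A matrix acts on row vectors from the right; A and A^T have the same
   spectral norm. *)
Definition specnorm (R : realType) (d : nat) (A : 'M[R]_d) : R :=
  sup [set enorm (v *m A) | v in [set v : 'rV[R]_d | enorm v <= 1]].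

Definition grad (R : realType) (d : nat) (f : 'rV[R]_d -> R) (x : 'rV[R]_d) :
    'rV[R]_d :=
  \row_(j < d) 'D_(delta_mx 0 j) f x.

(* With the row convention of [jacobian], [h *m hess f x] is the derivative of
   the gradient in the direction h, i.e. the Hessian applied to h. *)
Definition hess (R : realType) (d : nat) (f : 'rV[R]_d -> R) (x : 'rV[R]_d) :
    'M[R]_d :=
  jacobian (grad f) x.

Definition twice_differentiable (R : realType) (d : nat)
    (f : 'rV[R]_d -> R) : Prop :=
  (forall x, differentiable f x) /\ (forall x, differentiable (grad f) x).

Definition grad_lipschitz (R : realType) (d : nat) (L : R)
    (f : 'rV[R]_d -> R) : Prop :=
  forall x y, enorm (grad f x - grad f y) <= L * enorm (x - y).

Definition average_fun (R : realType) (d n : nat)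
    (f : 'I_n -> 'rV[R]_d -> R) (x : 'rV[R]_d) : R :=
  n%:R^-1 * \sum_(i < n) f i x.

(* R^d as a measurable space: the sigma-algebra generated by the coordinates,
   which is the Borel one. *)
Definition coord_sets (R : realType) (d : nat) : set (set 'rV[R]_d) :=
  \bigcup_(j in [set: 'I_d])
    preimage_set_system setT (fun x : 'rV[R]_d => x 0 j) measurable.

Definition borelV (R : realType) (d : nat) :=
  g_sigma_algebraType (@coord_sets R d).

Definition has_mean (R : realType) (dX : measure_display)
    (X : measurableType dX) (D : probability X R) (m n : nat)
    (Y : X -> 'M[R]_(m, n)) (M : 'M[R]_(m, n)) : Prop :=
  forall i j, (fun s => Y s i j) \in Lfun D 1 /\
    ('E_D[fun s => Y s i j] = (M i j)%:E)%E.

(* A randomized map is a jointly measurable function of a seed, drawn from Q,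
   and of its input. *)
Definition compressor (R : realType) (dZ : measure_display)
    (Z : measurableType dZ) (d : nat) (C : Z -> 'rV[R]_d -> 'rV[R]_d) : Prop :=
  measurable_fun [set: Z * borelV R d]
    (fun p : Z * borelV R d => (C p.1 p.2 : borelV R d)).

Definition contractive (R : realType) (dZ : measure_display)
    (Z : measurableType dZ) (Q : probability Z R) (d : nat) (alpha : R)
    (C : Z -> 'rV[R]_d -> 'rV[R]_d) : Prop :=
  forall v, ('E_Q[fun z => (enorm (C z v - v) ^+ 2)%R] <=
             ((1 - alpha) * enorm v ^+ 2)%:E)%E.

Section probability_notions.
Context (R : realType) (dO : measure_display) (Omega : measurableType dO).
Variable P : probability Omega R.

Definition has_law (dX : measure_display) (X : measurableType dX)
    (Y : {RV P >-> X}) (D : set X -> \bar R) : Prop :=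
  forall B, measurable B -> distribution P Y B = D B.

Definition sigma_of (dX : measure_display) (X : measurableType dX)
    (Y : Omega -> X) : set (set Omega) :=
  preimage_set_system setT Y measurable.

Definition independent2 (A B : set (set Omega)) : Prop :=
  forall E F, A E -> B F -> (P (E `&` F) = P E * P F)%E.

Definition independent (I : finType) (A : I -> set (set Omega)) : Prop :=
  forall (J : {set I}) (E : I -> set Omega),
    (forall i, i \in J -> A i (E i)) ->
    (P (\bigcap_(i in [set` J]) E i) = \prod_(i in J) P (E i))%E.

End probability_notions.

(* Indexing: [xi t i], [zeta t i] and [C t i] are the sample, the compressor
   seed and the compressor used by client i to go from iterate t to iterate
   t + 1, i.e. those carrying the superscript t + 1. *)

Section randomness.
Context (R : realType) (dO dX dZ : measure_display)
  (Omega : measurableType dO) (n : nat)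
  (X : 'I_n -> measurableType dX) (Z : nat -> 'I_n -> measurableType dZ).
Variable P : probability Omega R.
Variables (q : nat -> {RV P >-> R})
  (xi : forall (t : nat) (i : 'I_n), {RV P >-> X i})
  (zeta : forall (t : nat) (i : 'I_n), {RV P >-> Z t i}).

(* everything drawn before iteration t *)
Definition history (t : nat) : set (set Omega) :=
  <<s \bigcup_(s in `I_t)
        (sigma_of (q s) `|`
         \bigcup_(i in [set: 'I_n])
           (sigma_of (xi s i) `|` sigma_of (zeta s i))) >>.

(* Seeds of distinct clients at the same iteration are not required to be
   independent of each other. *)
Definition fresh_randomness : Prop :=
  forall t,
  [/\ independent2 P (history t) (sigma_of (q t)),
      independent P (fun o : option 'I_n =>
        if o is Some i then sigma_of (xi t i)
        else <<s history t `|` sigma_of (q t) >>) &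
      forall i, independent2 P
        <<s history t `|` sigma_of (q t) `|` sigma_of (xi t i) >>
        (sigma_of (zeta t i))].

End randomness.

Section algorithm.
Context (R : realType) (d n : nat) (dO dX dZ : measure_display)
  (Omega : measurableType dO)
  (X : 'I_n -> measurableType dX) (Z : nat -> 'I_n -> measurableType dZ).

Definition normalize (u : 'rV[R]_d) : 'rV[R]_d :=
  if u == 0 then 0 else (enorm u)^-1 *: u.

Definition EF21_RHM (gamma eta : nat -> R)
    (F : forall i : 'I_n, 'rV[R]_d -> X i -> R)
    (C : forall (t : nat) (i : 'I_n), Z t i -> 'rV[R]_d -> 'rV[R]_d)
    (q : nat -> Omega -> R)
    (xi : forall (t : nat) (i : 'I_n), Omega -> X i)
    (zeta : forall (t : nat) (i : 'I_n), Omega -> Z t i)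
    (x0 : 'rV[R]_d) (g0 v0 : 'I_n -> 'rV[R]_d)
    (x : nat -> Omega -> 'rV[R]_d)
    (g v : nat -> 'I_n -> Omega -> 'rV[R]_d) : Prop :=
  forall w : Omega,
  [/\ x 0%N w = x0, (forall i, g 0%N i w = g0 i), (forall i, v 0%N i w = v0 i) &
   forall t : nat,
    let gbar := n%:R^-1 *: \sum_(i < n) g t i w in
    let xhat := q t w *: x t.+1 w + (1 - q t w) *: x t w in
    [/\ x t.+1 w = x t w - gamma t *: normalize gbar,
        (forall i, v t.+1 i w =
           (1 - eta t) *:
             (v t i w + (x t.+1 w - x t w) *m hess (F i ^~ (xi t i w)) xhat)
           + eta t *: grad (F i ^~ (xi t i w)) (x t.+1 w)) &
        (forall i, g t.+1 i w =
           g t i w + C t i (zeta t i w) (v t.+1 i w - g t i w))]].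

End algorithm.

Definition V_zero (R : realType) (d n : nat) (f : 'I_n -> 'rV[R]_d -> R)
    (alpha gamma0 : R) (x0 : 'rV[R]_d) (g0 v0 : 'I_n -> 'rV[R]_d) : R :=
  let s := Num.sqrt (1 - alpha) in
  average_fun f x0 - inf (range (average_fun f))
  + 2 * gamma0 / (1 - s) * (n%:R^-1 * \sum_(i < n) enorm (g0 i - v0 i))
  + 2 * gamma0 * s / (1 - s)
    * (n%:R^-1 * \sum_(i < n) enorm (v0 i - grad (f i) x0)).

(* Main.v *)
Require Import Defs.
From HB Require Import structures.
From mathcomp Require Import all_boot all_order all_algebra.
From mathcomp Require Import all_classical all_reals all_analysis.
From mathcomp Require Import measurable_realfun ring lra.
Set Implicit Arguments.
Unset Strict Implicit.
Unset Printing Implicit Defensive.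
Import Order.TTheory GRing.Theory Num.Theory.
Import numFieldNormedType.Exports.
Local Open Scope classical_set_scope.
Local Open Scope ring_scope.

(* Let e^t be the momentum error v^t - grad f(x^t), averaged over the clients
   with fixed weights (1/n each, or a single client).  Given the past, the
   Hessian at the uniform point of the segment [x^t, x^{t+1}] averages exactly
   to the gradient difference, so that e^{t+1} is (1 - eta_t) e^t plus centred,
   pairwise uncorrelated noises of variance O(eta_t^2).  As
   eta_t - eta_{t+1} <= eta_t^2 / 2, this gives E|e^t|^2 = O(eta_t), where
   averaging over n independent clients gains the factor 1/n.  The compression
   error of a client contracts by sqrt(1 - alpha) up to the increments of its
   own momentum error and gradient.  Pathwise, a normalized step decreases f by
   at least gamma_t |grad f(x^t)|, up to L gamma_t^2 and gamma_t times these
   errors; in the weighted sum every error term is a multiple of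
   sum_{t<T} 2/(t+2) <= 2 ln(T+1), and sum_{t<T} gamma_t >= gamma_0 T^{1/3}. *)

(** * Independence *)

(** For [alpha = 1] the initial momentum error has weight 0 in [V_zero], so the direction error of
    the very first step cannot be charged to the bound. Telescoping therefore starts at x^1: the
    gradient at x^0 is controlled by a fictitious step along the true gradient, which cannot go
    below the infimum, and the actual first step is treated as an arbitrary move of length at most
    gamma_0. The initial momentum error enters only through compression, with the factor sqrt(1 -
    alpha) that [V_zero] allows; as eta_0 = 1, momentum itself forgets it at time 1. The other
    difficulty is measure-theoretic. Freshness speaks of events, and the oracles are known to be
    measurable in the sample only at fixed points. Differentiability in the point yields joint
    measurability, after which each draw is integrated against a product law. Within an iteration
    q_t comes first, then the samples one client at a time, so that every noise is centred given all
    draws before it. *)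

Section freezing.
Context (R : realType) (dO dS dX : measure_display) (Omega : measurableType dO)
  (S : measurableType dS) (X : measurableType dX) (P : probability Omega R)
  (D : probability X R).
Local Open Scope ereal_scope.

(* The joint law of [Y] and [xi] is the product of their laws; only
   nonnegative integrands occur, so no conditional expectation is needed. *)
Lemma ge0_integral_freeze (Y : Omega -> S) (xi : Omega -> X)
    (h : S * X -> \bar R) :
  measurable_fun setT Y -> measurable_fun setT xi ->
  (forall B, measurable B -> P (xi @^-1` B) = D B) ->
  (forall A B, measurable A -> measurable B ->
    P (Y @^-1` A `&` xi @^-1` B) = P (Y @^-1` A) * P (xi @^-1` B)) ->
  measurable_fun [set: S * X] h -> (forall z, 0 <= h z) ->
  \int[P]_w h (Y w, xi w) = \int[P]_w \int[D]_s h (Y w, s).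
Proof.
move=> mY mxi lxi ind mh h0.
pose Ym := HB.pack_for {mfun Omega >-> S} Y
  (isMeasurableFun.Build _ _ _ _ _ mY).
have mYx : measurable_fun setT (fun w => (Y w, xi w)).
  exact: measurable_fun_pair.
pose Zm := HB.pack_for {mfun Omega >-> (S * X)%type} (fun w => (Y w, xi w))
  (isMeasurableFun.Build _ _ _ _ _ mYx).
have prodE : forall E, measurable E ->
    (distribution P Ym \x D) E = distribution P Zm E.
  apply: product_measure_unique => A B mA mB.
  transitivity (P (Y @^-1` A `&` xi @^-1` B)); first by [].
  by rewrite ind// lxi.
have -> : \int[P]_w h (Y w, xi w) = \int[distribution P Zm]_z h z.
  by rewrite ge0_integral_distribution.
transitivity (\int[distribution P Ym \x D]_z h z).
  by apply: eq_measure_integral => A mA _; exact/esym/prodE.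
rewrite fubini_tonelli1//= ge0_integral_distribution//.
- exact: measurable_fun_fubini_tonelli_F.
- by move=> y; apply: integral_ge0.
Qed.

End freezing.

Section mean_square.
Context (R : realType) (dO : measure_display) (Omega : measurableType dO)
  (P : probability Omega R).
Local Open Scope ereal_scope.

(** Cauchy-Schwarz against the constant 1, by integrating a pointwise AM-GM bound. The slack [e]
    keeps the divisor [a = b + e] positive when [b = 0]. *)
Lemma integral_le_sqr (Y : Omega -> R) (b : R) : measurable_fun setT Y ->
  (forall w, 0 <= Y w)%R -> (0 <= b)%R ->
  \int[P]_w (Y w ^+ 2)%:E <= (b ^+ 2)%:E -> \int[P]_w (Y w)%:E <= b%:E.
Proof.
move=> mY Y0 b0 hb; apply/lee_addgt0Pr => e e0.
pose a := (b + e)%R; have a0 : (0 < a)%R by rewrite /a; lra.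
apply: (@le_trans _ _ (\int[P]_w (a / 2 + (2 * a)^-1 * Y w ^+ 2)%R%:E)).
  apply: ge0_le_integral => //.
  - by move=> w _; rewrite lee_fin.
  - exact/measurable_EFinP.
  - apply/measurable_EFinP; apply: measurable_funD => //.
    by apply: measurable_funM => //; exact: measurable_funX.
  - move=> w _; rewrite lee_fin.
    (* AM-GM: [2 a Y <= a^2 + Y^2] *)
    have -> : (a / 2 + (2 * a)^-1 * Y w ^+ 2)%R =
              (Y w + (2 * a)^-1 * (a - Y w) ^+ 2)%R by field; rewrite gt_eqF.
    by rewrite lerDl mulr_ge0 ?sqr_ge0// invr_ge0; lra.
under eq_integral do rewrite EFinD (EFinM (2 * a)^-1).
rewrite ge0_integralD//; last 3 first.
- by move=> w _; rewrite lee_fin; lra.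
- by move=> w _; rewrite -EFinM lee_fin mulr_ge0 ?sqr_ge0// invr_ge0; lra.
- apply: emeasurable_funM => //; apply/measurable_EFinP; exact: measurable_funX.
rewrite integral_cst//= probability_setT mule1.
rewrite ge0_integralZl//; last 3 first.
- apply/measurable_EFinP; exact: measurable_funX.
- by move=> w _; rewrite lee_fin sqr_ge0.
- by rewrite lee_fin invr_ge0; lra.
apply: (@le_trans _ _ ((a / 2)%:E + ((2 * a)^-1)%:E * (b ^+ 2)%:E)).
  by apply: leeD => //; apply: lee_wpmul2l => //; rewrite lee_fin invr_ge0; lra.
rewrite -EFinM -EFinD -EFinD lee_fin.
have : ((2 * a)^-1 * b ^+ 2 <= a / 2)%R.
  rewrite mulrC ler_pdivrMr; last lra.
  have -> : (a / 2 * (2 * a) = a ^+ 2)%R by field.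
  by rewrite ler_sqr ?nnegrE; rewrite /a; lra.
by rewrite /a; lra.
Qed.

End mean_square.

Section independence.
Context (R : realType) (dO : measure_display) (Omega : measurableType dO)
  (P : probability Omega R).
Local Open Scope ereal_scope.

(** Dynkin's argument: for a fixed [F], the events independent of [F] form a lambda-system, and it
    contains the pi-system [G]. *)
Lemma independent2_sigma (G B : set (set Omega)) :
  setI_closed G -> G setT -> G `<=` measurable -> B `<=` measurable ->
  independent2 P G B -> independent2 P <<s G >> B.
Proof.
move=> GI GT mG mB ind E F sE BF.
have mF := mB _ BF.
have msE : forall E, <<s G >> E -> measurable E.
  by move=> E'; apply: smallest_sub => //; exact: sigma_algebra_measurable.
pose H := [set E | measurable E /\ P (E `&` F) = P E * P F].
suff : <<s G >> `<=` H by move=> /(_ _ sE) [].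
apply: lambda_system_subset => //; last first.
- by move=> A GA; split; [exact: mG|exact: ind].
- split => //.
  + by split=> //; rewrite setTI probability_setT mul1e.
  + move=> A C CA [mA hA] [mC hC]; split; first exact: measurableD.
    have -> : (A `\` C) `&` F = (A `&` F) `\` (C `&` F).
      by apply/seteqP; split => w /=; tauto.
    have Pfin U : measurable U -> P U < +oo.
      by move=> mU; exact: le_lt_trans (probability_le1 _ mU) (ltry _).
    rewrite !measureD//; last 4 first.
    * exact: Pfin.
    * exact: measurableI.
    * exact: measurableI.
    * by apply: Pfin; exact: measurableI.
    have -> : A `&` F `&` (C `&` F) = C `&` F.
      by apply/seteqP; split => w /= => [[[? ?] [? ?]]//|[/[dup] /CA ? ? ?]].
    have -> : A `&` C = C by rewrite setIC; exact/setIidPl.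
    rewrite [X in X - _]hA [X in _ - X]hC muleBl// ?fin_num_measure//.
    by rewrite fin_num_adde_defl// fin_numN fin_num_measure.
  + move=> A ndA hA; have mA i : measurable (A i) by have [] := hA i.
    split; first exact: bigcup_measurable.
    rewrite setI_bigcupl.
    have c1 : P (A i `&` F) @[i --> \oo] --> P (\bigcup_i (A i `&` F)).
      apply: nondecreasing_cvg_mu => //.
      * by move=> i; exact: measurableI.
      * by apply: bigcup_measurable => i _; exact: measurableI.
      * move=> i j ij; apply/subsetPset; apply: setSI.
        by apply/subsetPset; exact: ndA.
    have c2 : P (A i) * P F @[i --> \oo] --> P (\bigcup_i (A i)) * P F.
      apply: cvgeZr; first by rewrite fin_num_measure.
      by apply: nondecreasing_cvg_mu => //; exact: bigcup_measurable.
    move: c1; rewrite (_ : (fun i => P (A i `&` F)) = (fun i => P (A i) * P F)).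
      by move=> c1; apply: cvg_unique c1 c2.
    by apply/funext => i; have [] := hA i.
Qed.

End independence.

Section independent_families.
Context (R : realType) (dO : measure_display) (Omega : measurableType dO)
  (P : probability Omega R).
Local Open Scope ereal_scope.

(** Intersections of one event from each [A i], [i \in J], form a pi-system that generates the
    joined sigma-algebra; on it the claim is mutual independence. *)
Lemma independent_join (I : finType) (A : I -> set (set Omega)) (J : {set I})
    (k : I) :
  (forall i, setI_closed (A i)) -> (forall i, A i setT) ->
  (forall i, A i `<=` measurable) -> independent P A -> k \notin J ->
  independent2 P <<s \bigcup_(i in [set` J]) A i >> (A k).
Proof.
move=> AI AT mA ind kJ.
pose Pi := [set B | exists2 E : I -> set Omega, (forall i, A i (E i)) &
  B = \bigcap_(i in [set` J]) E i].
have sub : <<s \bigcup_(i in [set` J]) A i >> `<=` <<s Pi >>.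
  apply: smallest_sub; first exact: smallest_sigma_algebra.
  move=> B [i /= iJ AB]; apply: sub_sigma_algebra.
  exists (fun j => if j == i then B else setT).
    by move=> j; case: eqP => [->|].
  apply/seteqP; split => [w Bw j _ /=|w /(_ i iJ)]; first by case: eqP.
  by rewrite eqxx.
suff : independent2 P <<s Pi >> (A k).
  by move=> h E F /sub EP AF; exact: h.
apply: independent2_sigma => //.
- move=> _ _ [E AE ->] [E' AE' ->].
  exists (fun i => E i `&` E' i); first by move=> i; exact: AI.
  by rewrite bigcapI.
- exists (fun=> setT) => //.
  by apply/seteqP; split.
- move=> _ [E AE ->]; apply: fin_bigcap_measurable => //.
  by move=> i _; exact: mA.
- move=> _ F [E AE ->] AF.
  (* [F] is inserted at the index [k], which lies outside [J]. Mutual independence is then applied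
     twice, over [k |: J] and over [J]. *)
  pose E' i := if i == k then F else E i.
  have AE' i : A i (E' i) by rewrite /E'; case: eqP => [->|].
  have E'J i : i \in J -> E' i = E i.
    by rewrite /E'; case: eqP => // ->; rewrite (negbTE kJ).
  have -> : \bigcap_(i in [set` J]) E i `&` F =
      \bigcap_(i in [set` k |: J]%SET) E' i.
    apply/seteqP; split => [w [wE wF] i /= | w h].
      rewrite in_setU1; case: eqP => [->|ik /= iJ]; first by rewrite /E' eqxx.
      by rewrite E'J//; exact: wE.
    split => [i /= iJ|].
      by rewrite -E'J//; apply: h => /=; rewrite in_setU1 iJ orbT.
    by have := h k; rewrite /= in_setU1 eqxx /E' eqxx; apply.
  rewrite ind//.
  rewrite big_setU1//= muleC {2}/E' eqxx; congr (_ * _).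
  rewrite (eq_bigr (fun i => P (E i))); last by move=> i iJ; rewrite E'J.
  by rewrite ind.
Qed.

Lemma sigma_of_setI_closed (dX : measure_display) (X : measurableType dX)
  (Y : Omega -> X) : setI_closed (sigma_of Y).
Proof.
move=> _ _ [A mA <-] [B mB <-]; exists (A `&` B); first exact: measurableI.
by rewrite !setTI preimage_setI.
Qed.

Lemma sigma_of_setT (dX : measure_display) (X : measurableType dX)
  (Y : Omega -> X) : sigma_of Y setT.
Proof. by exists setT => //; rewrite preimage_setT setTI. Qed.

Lemma sigma_of_measurable (dX : measure_display) (X : measurableType dX)
  (Y : Omega -> X) : measurable_fun setT Y -> sigma_of Y `<=` measurable.
Proof. by move=> mY _ [A mA <-]; exact: mY. Qed.

Lemma sigma_algebra_setI_closed (G : set (set Omega)) : setI_closed <<s G >>.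
Proof.
move=> A B GA GB.
exact: (@measurableI _ (g_sigma_algebraType G) A B GA GB).
Qed.

End independent_families.

(** * Borel vectors *)

Section vector_measurability.
Context (R : realType) (d : nat) (dT : measure_display) (T : measurableType dT).

(** Coordinatewise, so that the closure properties of real measurable functions apply directly;
    [measurable_fun_borelV] identifies it with Borel measurability. *)
Definition vmeasurable (f : T -> 'rV[R]_d) : Prop :=
  forall j, measurable_fun setT (fun w => f w 0 j).

Lemma measurable_coord (j : 'I_d) :
  measurable_fun [set: borelV R d] (fun x : borelV R d => (x : 'rV[R]_d) 0 j).
Proof.
move=> _ B mB; apply: sub_sigma_algebra; exists j => //.
by exists B.
Qed.

Lemma measurable_fun_borelV (f : T -> 'rV[R]_d) :
  vmeasurable f <-> measurable_fun setT (f : T -> borelV R d).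
Proof.
split=> [mf|mf j]; last exact: measurableT_comp (measurable_coord j) mf.
apply: (@measurability _ _ T (borelV R d) setT f (@coord_sets R d)) => //.
move=> _ [_ [j _ [B mB <-]] <-].
by rewrite !setTI; have := mf j measurableT _ mB; rewrite setTI.
Qed.

Lemma vmeasurable_cst (u : 'rV[R]_d) : vmeasurable (fun=> u).
Proof. by move=> j. Qed.

Lemma vmeasurableD (f g : T -> 'rV[R]_d) :
  vmeasurable f -> vmeasurable g -> vmeasurable (fun w => f w + g w).
Proof.
move=> mf mg j; under eq_fun do rewrite mxE.
exact: measurable_funD (mf j) (mg j).
Qed.

Lemma vmeasurableZ (a : T -> R) (f : T -> 'rV[R]_d) :
  measurable_fun setT a -> vmeasurable f -> vmeasurable (fun w => a w *: f w).
Proof.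
move=> ma mf j; under eq_fun do rewrite mxE.
exact: measurable_funM ma (mf j).
Qed.

Lemma vmeasurableB (f g : T -> 'rV[R]_d) :
  vmeasurable f -> vmeasurable g -> vmeasurable (fun w => f w - g w).
Proof.
move=> mf mg j; under eq_fun do rewrite !mxE.
exact: measurable_funB (mf j) (mg j).
Qed.

Lemma vmeasurable_sum (I : Type) (r : seq I) (Q : pred I)
    (f : I -> T -> 'rV[R]_d) :
  (forall i, vmeasurable (f i)) ->
  vmeasurable (fun w => \sum_(i <- r | Q i) f i w).
Proof.
move=> mf j; under eq_fun do rewrite summxE -big_filter.
by apply: measurable_sum => i; exact: mf.
Qed.

Lemma vmeasurable_mulmx (f : T -> 'rV[R]_d) (A : T -> 'M[R]_d) :
  vmeasurable f -> (forall i j, measurable_fun setT (fun w => A w i j)) ->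
  vmeasurable (fun w => f w *m A w).
Proof.
move=> mf mA j; under eq_fun do rewrite mxE.
by apply: measurable_sum => k; exact: measurable_funM (mf k) (mA k j).
Qed.

Lemma measurable_enorm (f : T -> 'rV[R]_d) :
  vmeasurable f -> measurable_fun setT (fun w => enorm (f w)).
Proof.
move=> mf; apply: (@measurableT_comp _ _ _ _ _ _ (@Num.sqrt R)).
  apply: continuous_measurable_fun; exact: sqrt_continuous.
by apply: measurable_sum => j; exact: measurable_funX (mf j).
Qed.

(** For [u = 0] the scaled vector is 0 whatever the inverse is, so the case distinction disappears
    and measurability follows from that of a product. *)
Lemma normalizeE (u : 'rV[R]_d) : normalize u = (enorm u)^-1 *: u.
Proof. by rewrite /normalize; case: eqP => // ->; rewrite scaler0. Qed.

Lemma vmeasurable_normalize (f : T -> 'rV[R]_d) :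
  vmeasurable f -> vmeasurable (fun w => normalize (f w)).
Proof.
move=> mf; under eq_fun do rewrite normalizeE.
apply: vmeasurableZ => //.
(* The inverse is measurable as the power -1; both take the value 0 at 0. *)
rewrite (_ : (fun w => _) = (fun x : R => x `^ (-1)) \o (fun w => enorm (f w))).
  apply: measurableT_comp; first exact: measurable_powR.
  exact: measurable_enorm.
by apply/funext => w /=; rewrite powR_inv1// sqrtr_ge0.
Qed.

End vector_measurability.

(** * Functions continuous in a vector and measurable in a sample *)

Section caratheodory.
Context (R : realType) (d : nat) (dX : measure_display) (X : measurableType dX).

Definition grid (k : nat) (y : 'rV[R]_d) : 'rV[int]_d :=
  \row_j Num.floor (k.+1%:R * y 0 j).

Definition grid_point (k : nat) (c : 'rV[int]_d) : 'rV[R]_d :=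
  \row_j ((c 0 j)%:~R / k.+1%:R).

Lemma grid_point_cvg (y : 'rV[R]_d) :
  grid_point k (grid k y) @[k --> \oo] --> y.
Proof.
apply/cvg_ballP => e e0.
near=> k; split=> // i j; rewrite ord1 /ball /= !mxE.
have k0 : (0 : R) < k.+1%:R by [].
have /andP[h1 h2] := floor_itv (k.+1%:R * y 0 j).
set c := Num.floor _ in h1 h2 *.
rewrite intrD in h2.
have -> : y 0 j - c%:~R / k.+1%:R = (k.+1%:R * y 0 j - c%:~R) / k.+1%:R.
  by field; rewrite gt_eqF.
rewrite ger0_norm ?divr_ge0 ?subr_ge0// ltr_pdivrMr//.
apply: (@lt_trans _ _ 1); first by rewrite ltrBlDl.
rewrite -ltr_pdivrMr// div1r.
near: k; exact: (near_infty_natSinv_lt (PosNum e0)).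
Unshelve. all: by end_near. Qed.

Lemma measurable_grid (k : nat) (c : 'rV[int]_d) :
  measurable [set y : borelV R d | grid k y = c].
Proof.
rewrite (_ : [set _ | _] = \bigcap_(j in [set: 'I_d])
   ((fun y : borelV R d => (y : 'rV[R]_d) 0 j) @^-1`
     [set r : R | (c 0 j)%:~R / k.+1%:R <= r < ((c 0 j)%:~R + 1) / k.+1%:R])).
  apply: fin_bigcap_measurable => // j _.
  rewrite -[X in measurable X]setTI; apply: (measurable_coord j) => //.
  rewrite (_ : [set _ | _] =
    `[(c 0 j)%:~R / k.+1%:R, ((c 0 j)%:~R + 1) / k.+1%:R[%classic).
    exact: measurable_itv.
  by apply/seteqP; split=> r /=; rewrite in_itv.
have k0 : (0 : R) < k.+1%:R by [].
apply/seteqP; split=> [y /= <- j _ /=|y h /=].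
  rewrite !mxE; have /andP[h1 h2] := floor_itv (k.+1%:R * y 0 j).
  rewrite intrD in h2.
  by rewrite ler_pdivrMr// ltr_pdivlMr// ![y 0 j * _]mulrC h1 h2.
apply/rowP => j; have /= /andP[h1 h2] := h j I.
rewrite mxE; apply: floor_def.
by rewrite intrD [k.+1%:R * _]mulrC -ler_pdivrMr// h1 -ltr_pdivlMr.
Qed.

(** Rounding the vector down to the grid of mesh [1 / (k + 1)] leaves countably many cells, on each
    of which the function depends measurably on the sample alone. Continuity recovers [phi] as the
    limit. *)
Lemma measurable_caratheodory (phi : 'rV[R]_d -> X -> R) :
  (forall s, continuous (phi ^~ s)) ->
  (forall y, measurable_fun setT (phi y)) ->
  measurable_fun [set: borelV R d * X]
    (fun p : borelV R d * X => phi p.1 p.2).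
Proof.
move=> cphi mphi.
apply: (@measurable_fun_cvg _ _ _ _
  (fun k (p : borelV R d * X) => phi (grid_point k (grid k p.1)) p.2)).
  move=> k _ B mB; rewrite setTI.
  rewrite (_ : _ @^-1` B = \bigcup_(c in [set: 'rV[int]_d])
    ([set y : borelV R d | grid k y = c] `*` (phi (grid_point k c) @^-1` B))).
    apply: countable_bigcupT_measurable => // c.
    apply: measurableX; first exact: measurable_grid.
    by rewrite -[X in measurable X]setTI; exact: mphi.
  apply/seteqP; split=> [[y s] /= h|[y s] [c _ [/= <- //]]].
  by exists (grid k y).
move=> [y s] _ /=.
exact: (cvg_comp _ _ (@grid_point_cvg y) (@cphi s y)).
Qed.

End caratheodory.

(** The previous lemma with a dummy sample, fixed at 0. *)
Lemma continuous_measurable_borelV (R : realType) (d : nat)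
    (phi : 'rV[R]_d -> R) : continuous phi ->
  measurable_fun [set: borelV R d] (phi : borelV R d -> R).
Proof.
move=> cphi.
have /(@measurable_caratheodory R d _ R (fun y _ => phi y)) h :
  forall s : R, continuous phi by [].
have {}h : measurable_fun [set: borelV R d * R] (fun p : borelV R d * R => phi p.1).
  by apply: h => y; exact: measurable_cst.
have mp : measurable_fun [set: borelV R d] (fun y : borelV R d => (y, 0 : R)).
  exact: measurable_fun_pair.
exact: (measurableT_comp h mp).
Qed.

(** * Euclidean geometry and derivatives *)

Section euclid.
Context (R : realType) (d : nat).
Implicit Types (x y h : 'rV[R]_d) (A : 'M[R]_d).

Definition dotv x y : R := \sum_(j < d) x 0 j * y 0 j.

Lemma enorm_ge0 x : 0 <= enorm x. Proof. exact: sqrtr_ge0. Qed.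

Lemma enorm_sqr x : enorm x ^+ 2 = dotv x x.
Proof.
by rewrite sqr_sqrtr ?sumr_ge0// => j _; rewrite sqr_ge0.
Qed.

Lemma enorm0 : enorm (0 : 'rV[R]_d) = 0.
Proof.
by rewrite /enorm big1 ?sqrtr0// => j _; rewrite mxE expr0n.
Qed.

Lemma enorm0_eq0 x : enorm x = 0 -> x = 0.
Proof.
move=> x0; apply/rowP => j; rewrite mxE.
have /eqP : \sum_(j < d) x 0 j ^+ 2 = 0 
  by have := enorm_sqr x; rewrite x0 expr0n => /esym.
rewrite psumr_eq0 => [/allP/(_ j)|i _]; last exact: sqr_ge0.
by rewrite mem_index_enum sqrf_eq0 => /(_ isT)/eqP.
Qed.

Lemma enormZ (a : R) x : enorm (a *: x) = `|a| * enorm x.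
Proof.
rewrite /enorm -sqrtr_sqr -sqrtrM ?sqr_ge0//; congr Num.sqrt.
by rewrite mulr_sumr; apply: eq_bigr => j _; rewrite mxE exprMn.
Qed.

Lemma enormN x : enorm (- x) = enorm x.
Proof. by rewrite -scaleN1r enormZ normrN1 mul1r. Qed.

Lemma dotvDl x y h : dotv (x + y) h = dotv x h + dotv y h.
Proof.
by rewrite /dotv -big_split/=; apply: eq_bigr => j _; rewrite mxE mulrDl.
Qed.

Lemma dotvC x y : dotv x y = dotv y x.
Proof. by apply: eq_bigr => j _; rewrite mulrC. Qed.

Lemma dotvDr x y h : dotv h (x + y) = dotv h x + dotv h y.
Proof. by rewrite ![dotv h _]dotvC dotvDl. Qed.

Lemma dotvZl a x y : dotv (a *: x) y = a * dotv x y.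
Proof. by rewrite mulr_sumr; apply: eq_bigr => j _; rewrite mxE mulrA. Qed.

Lemma enorm_sqrD x y :
  enorm (x + y) ^+ 2 = enorm x ^+ 2 + 2 * dotv x y + enorm y ^+ 2.
Proof. by rewrite !enorm_sqr dotvDl !dotvDr (dotvC y x); ring. Qed.

Lemma dotv0l x : dotv 0 x = 0.
Proof. by rewrite /dotv big1// => j _; rewrite mxE mul0r. Qed.

Lemma dotv_le x y : dotv x y <= enorm x * enorm y.
Proof.
have [x0|x0] := eqVneq (enorm x) 0.
  by rewrite (enorm0_eq0 x0) dotv0l enorm0 mul0r.
have [y0|y0] := eqVneq (enorm y) 0.
  by rewrite dotvC (enorm0_eq0 y0) dotv0l enorm0 mulr0.
have p : 0 < enorm x * enorm y.
  by rewrite lt0r mulf_neq0//= mulr_ge0 ?enorm_ge0.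
(* With a = |x|, b = |y| and c = <x, y>, this square expands to 2ab(ab - c), and ab > 0. *)
have : 0 <= enorm (enorm y *: x + (- enorm x) *: y) ^+ 2 by rewrite sqr_ge0.
rewrite enorm_sqrD !enormZ normrN !ger0_norm ?enorm_ge0// dotvZl dotvC dotvZl.
rewrite (dotvC y) => h.
rewrite -subr_ge0 -(pmulr_rge0 _ p).
by move: h; set a := enorm x; set b := enorm y; set c := dotv x y; nra.
Qed.

Lemma enormD x y : enorm (x + y) <= enorm x + enorm y.
Proof.
rewrite -ler_sqr ?nnegrE ?addr_ge0 ?enorm_ge0// enorm_sqrD.
by have := dotv_le x y; nra.
Qed.

Lemma enormB x y : enorm (x - y) <= enorm x + enorm y.
Proof. by rewrite -(enormN y) enormD. Qed.

Lemma enorm_sum (I : Type) (r : seq I) (Q : pred I) (u : I -> 'rV[R]_d) :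
  enorm (\sum_(i <- r | Q i) u i) <= \sum_(i <- r | Q i) enorm (u i).
Proof.
elim/big_ind2 : _ => [|x a y b xa yb|//]; first by rewrite enorm0.
exact: le_trans (enormD _ _) (lerD xa yb).
Qed.

Lemma enorm_sqrD_le x y :
  enorm (x + y) ^+ 2 <= 2 * enorm x ^+ 2 + 2 * enorm y ^+ 2.
Proof.
rewrite enorm_sqrD; have := dotv_le x y.
have : 0 <= (enorm x - enorm y) ^+ 2 by rewrite sqr_ge0.
nra.
Qed.

(** The Frobenius norm of [A] shows that the set defining [specnorm] is bounded, so that its [sup]
    really is an upper bound. *)
Lemma enorm_mulmx_le A h :
  enorm (h *m A) <= Num.sqrt (\sum_j enorm (col j A)^T ^+ 2) * enorm h.
Proof.
rewrite -(ger0_norm (enorm_ge0 h)) -sqrtr_sqr -sqrtrM; last first.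
  by rewrite sumr_ge0// => j _; rewrite sqr_ge0.
rewrite ler_sqrt; last first.
  by rewrite mulr_ge0 ?sqr_ge0// sumr_ge0// => j _; rewrite sqr_ge0.
rewrite mulr_suml; apply: ler_sum => j _.
have hE : (h *m A) 0 j = dotv h (col j A)^T.
  by rewrite mxE; apply: eq_bigr => k _; rewrite !mxE.
have h1 := dotv_le h (col j A)^T.
have h2 := dotv_le (- h) (col j A)^T.
rewrite -scaleN1r dotvZl mulN1r enormZ normrN1 mul1r in h2.
rewrite hE -exprMn -[leLHS]real_normK ?num_real// ler_sqr ?nnegrE//.
  by rewrite mulrC ler_norml h1 andbT -subr_ge0 opprK addrC; lra.
by rewrite mulr_ge0 ?enorm_ge0.
Qed.

Lemma enorm_specnorm A h : enorm (h *m A) <= specnorm A * enorm h.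
Proof.
have [h0|h0] := eqVneq (enorm h) 0.
  by rewrite (enorm0_eq0 h0) mul0mx enorm0 mulr0.
have hp : 0 < enorm h by rewrite lt0r h0 enorm_ge0.
rewrite -ler_pdivrMr// mulrC -(gtr0_norm (_ : 0 < (enorm h)^-1)) ?invr_gt0//.
rewrite -enormZ scalemxAl; apply: ub_le_sup.
  exists (Num.sqrt (\sum_j enorm (col j A)^T ^+ 2)) => _ [v /= v1 <-].
  apply: (le_trans (enorm_mulmx_le _ _)).
  by rewrite ler_piMr ?sqrtr_ge0.
exists ((enorm h)^-1 *: h) => //=.
by rewrite enormZ ger0_norm ?invr_ge0 ?enorm_ge0// mulVf.
Qed.

Lemma specnorm_ge0 A : 0 <= specnorm A.
Proof.
apply: (@le_trans _ _ (enorm (0 *m A))); first exact: enorm_ge0.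
apply: ub_le_sup; last by exists 0 => //=; rewrite enorm0.
exists (Num.sqrt (\sum_j enorm (col j A)^T ^+ 2)) => _ [v /= v1 <-].
apply: (le_trans (enorm_mulmx_le _ _)).
by rewrite ler_piMr ?sqrtr_ge0.
Qed.

Lemma enorm_normalize_le1 h : enorm (normalize h) <= 1.
Proof.
rewrite normalizeE enormZ ger0_norm ?invr_ge0 ?enorm_ge0//.
have [->|h0] := eqVneq (enorm h) 0; first by rewrite mulr0.
by rewrite mulVf.
Qed.

Lemma dotv_normalize h : dotv (normalize h) h = enorm h.
Proof.
rewrite normalizeE dotvZl -enorm_sqr expr2 mulrA.
have [->|h0] := eqVneq (enorm h) 0; first by rewrite mulr0.
by rewrite mulVf// mul1r.
Qed.

(** Split a = g + (a - g): the first part contributes |g| >= |a| - |a - g|, the second at least -|a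
    - g|. *)
Lemma dotv_normalize_ge (a g : 'rV[R]_d) :
  enorm a - 2 * enorm (a - g) <= dotv (normalize g) a.
Proof.
have h1 : dotv (normalize g) a = enorm g + dotv (normalize g) (a - g).
  by rewrite -{1}(dotv_normalize g) -dotvDr addrC subrK.
have h2 : enorm a <= enorm (a - g) + enorm g.
  by have := enormD (a - g) g; rewrite subrK.
have h3 := dotv_le (- normalize g) (a - g).
rewrite -scaleN1r dotvZl enormZ normrN1 mul1r in h3.
have h4 : enorm (normalize g) * enorm (a - g) <= enorm (a - g).
  by rewrite ler_piMl ?enorm_ge0 ?enorm_normalize_le1.
lra.
Qed.

End euclid.

(** The derivative as a limit along the sequence [1 / (k + 1)]: measurability of limits and
    dominated convergence are statements about sequences. *)
Lemma harmonic_scale_cvg (R : realType) (V W : normedModType R) (F : V -> W)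
    (x h : V) :
  derivable F x h ->
  k.+1%:R *: (F (k.+1%:R^-1 *: h + x) - F x) @[k --> \oo] --> 'D_h F x.
Proof.
move=> dF.
have cv : (k.+1%:R^-1 : R) @[k --> \oo] --> 0^'.
  move=> A hA; have [N _ hN] := @cvg_harmonic R _ hA.
  exists N => // k /hN /=; apply.
  by rewrite /harmonic /= invr_eq0.
rewrite (_ : (fun k => _) = (fun s : R => s^-1 *: (F (s *: h + x) - F x)) \o
  (fun k => k.+1%:R^-1)); first exact: cvg_comp cv dF.
by apply/funext => k /=; rewrite invrK.
Qed.

Lemma harmonic_slope_cvg (R : realType) (f : R -> R) (x : R) :
  derivable f x 1 ->
  k.+1%:R * (f (k.+1%:R^-1 + x) - f x) @[k --> \oo] --> 'D_1 f x.
Proof.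
move=> /harmonic_scale_cvg; rewrite (_ : (fun k => _) = fun k : nat =>
  k.+1%:R * (f (k.+1%:R^-1 + x) - f x))//.
by apply/funext => k; rewrite [_ *: 1]mulr1.
Qed.

(** * Derivatives along lines, descent, and the Hessian of a function with Lipschitz gradient *)

Section derivatives.
Context (R : realType) (d : nat).
Implicit Types (f : 'rV[R]_d -> R) (x h : 'rV[R]_d).

Lemma derive_grad f x h : differentiable f x -> 'D_h f x = dotv h (grad f x).
Proof.
move=> df; rewrite deriveE// {1}(row_sum_delta h) linear_sum/=.
by apply: eq_bigr => j _; rewrite linearZ/= mxE deriveE.
Qed.

(* The difference quotients on both sides are the same function. *)
Lemma derive_line (W : normedModType R) (f : 'rV[R]_d -> W) x h (t : R) :
  derivable f (x + t *: h) h ->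
  derivable (fun s : R => f (x + s *: h)) t 1 /\
  'D_1 (fun s : R => f (x + s *: h)) t = 'D_h f (x + t *: h).
Proof.
have E : (fun s : R => s^-1 *: (f (x + (s *: 1 + t) *: h) - f (x + t *: h))) =
    (fun s : R => s^-1 *: (f (s *: h + (x + t *: h)) - f (x + t *: h))).
  apply/funext => s; congr (_ *: (f _ - _)).
  by rewrite scalerDl [s *: 1]mulr1 addrCA.
by rewrite /derivable /derive /= E.
Qed.

Lemma mean_value_line f x h : (forall y, differentiable f y) ->
  exists2 c : R, 0 <= c <= 1 & f (x + h) - f x = dotv h (grad f (x + c *: h)).
Proof.
move=> df.
have dl t : derivable (fun s : R => f (x + s *: h)) t 1 /\
    'D_1 (fun s : R => f (x + s *: h)) t = dotv h (grad f (x + t *: h)).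
  have [d1 d2] := derive_line (diff_derivable (v := h) (df (x + t *: h))).
  by rewrite d2 derive_grad.
have [||c] := @MVT R (fun s => f (x + s *: h))
  (fun t => dotv h (grad f (x + t *: h))) 0 1 ltr01.
- by move=> t _; have [d1 d2] := dl t; apply: DeriveDef.
- by apply: derivable_within_continuous => t _; have [] := dl t.
rewrite in_itv/= => /andP[c0 c1]; rewrite scale1r scale0r addr0 subr0 mulr1.
by exists c => //; rewrite !ltW.
Qed.

(** The mean value theorem gives [L] where integration along the segment would give [L / 2]; the
    difference only affects the numerical constant of the rate. *)
Lemma descent f x h (L : R) : (forall y, differentiable f y) ->
  grad_lipschitz L f ->
  f (x + h) <= f x + dotv h (grad f x) + L * enorm h ^+ 2.
Proof.
move=> df lf; have [c /andP[c0 c1] E] := mean_value_line x h df.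
have -> : f (x + h) = f x + dotv h (grad f (x + c *: h)).
  by rewrite -E; ring.
have -> : dotv h (grad f (x + c *: h)) =
    dotv h (grad f x) + dotv h (grad f (x + c *: h) - grad f x).
  by rewrite -dotvDr subrKC.
rewrite addrA lerD2l.
apply: (le_trans (dotv_le _ _)).
rewrite expr2 mulrA [L * _]mulrC -mulrA ler_wpM2l ?enorm_ge0//.
apply: (le_trans (lf _ _)); rewrite [x + _]addrC addrK enormZ (ger0_norm c0).
have L0 : 0 <= L * enorm h.
  have := lf (x + h) x; rewrite [x + _]addrC addrK.
  exact/le_trans/enorm_ge0.
by rewrite mulrCA ler_piMl.
Qed.

Lemma hess_derive f x h : differentiable (grad f) x ->
  h *m hess f x = 'D_h (grad f) x.
Proof. by move=> df; rewrite deriveEjacobian. Qed.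

Lemma derive_grad_coord f x h j : differentiable (grad f) x ->
  derivable (fun y => grad f y 0 j) x h /\
  'D_h (fun y => grad f y 0 j) x = (h *m hess f x) 0 j.
Proof.
move=> df; have dv : derivable (grad f) x h by exact: diff_derivable.
split; first by move/derivable_mxP : dv => /(_ 0 j).
by rewrite hess_derive// derive_mx// mxE.
Qed.

Lemma enorm_hess_le f x h (L : R) : differentiable (grad f) x ->
  grad_lipschitz L f -> enorm (h *m hess f x) <= L * enorm h.
Proof.
move=> df lf.
pose u k := k.+1%:R *: (grad f (k.+1%:R^-1 *: h + x) - grad f x).
have cu : u k @[k --> \oo] --> h *m hess f x.
  by rewrite hess_derive//; apply: harmonic_scale_cvg; exact: diff_derivable.
have ul k : enorm (u k) <= L * enorm h.
  rewrite /u enormZ ger0_norm// mulrC -ler_pdivlMr//.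
  apply: (le_trans (lf _ _)).
  by rewrite addrK enormZ ger0_norm ?invr_ge0// mulrCA mulrC.
have L0 : 0 <= L * enorm h by apply: le_trans (ul 0%N); exact: enorm_ge0.
rewrite -ler_sqr ?nnegrE ?enorm_ge0// enorm_sqr.
(* The limit is taken in the squared norm, which is a polynomial in the coordinates. *)
have cuu : dotv (u k) (u k) @[k --> \oo] --> dotv (h *m hess f x) (h *m hess f x).
  apply: cvg_big => [|j _]; first exact: add_continuous.
  have cj := cvg_comp _ _ cu (@coord_continuous _ _ _ 0 j (h *m hess f x)).
  exact: (cvgM cj cj).
apply: (ler_cvg_to cuu (cvg_cst _)).
apply: nearW => k.
by rewrite -enorm_sqr ler_sqr ?nnegrE ?enorm_ge0.
Qed.

End derivatives.

Section joint_measurability.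
Context (R : realType) (d : nat) (dX : measure_display) (X : measurableType dX).
Variable F : 'rV[R]_d -> X -> R.
Hypothesis dF : forall s, twice_differentiable (F ^~ s).
Hypothesis mF : forall y j, measurable_fun setT (fun s => grad (F ^~ s) y 0 j).

Lemma measurable_grad_joint j : measurable_fun [set: borelV R d * X]
  (fun p : borelV R d * X => grad (F ^~ p.2) p.1 0 j).
Proof.
apply: (@measurable_caratheodory _ _ _ _ (fun y s => grad (F ^~ s) y 0 j)).
  move=> s y; have /differentiable_continuous := (dF s).2 y.
  move=> cg; apply: (cvg_comp _ _ cg (@coord_continuous _ _ _ 0 j _)).
by move=> y; exact: mF.
Qed.

(** The Hessian may be discontinuous in the point, so the grid argument stops at the gradient; the
    Hessian is a pointwise limit of difference quotients of the jointly measurable gradient. *)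
Lemma measurable_hess_joint k j : measurable_fun [set: borelV R d * X]
  (fun p : borelV R d * X => hess (F ^~ p.2) p.1 k j).
Proof.
pose G (y : 'rV[R]_d) s := grad (F ^~ s) y 0 j.
pose e : 'rV[R]_d := delta_mx 0 k.
apply: (@measurable_fun_cvg _ _ _ _ (fun m (p : borelV R d * X) =>
  m.+1%:R * (G (m.+1%:R^-1 *: e + p.1) p.2 - G p.1 p.2))).
  move=> m; apply: measurable_funM => //; apply: measurable_funB.
    pose sh (p : borelV R d * X) : borelV R d * X :=
      ((m.+1%:R^-1 *: e + p.1 : 'rV[R]_d) : borelV R d, p.2).
    have msh : measurable_fun setT sh.
      apply: measurable_fun_pair => //.
      apply/(@measurable_fun_borelV _ _ _ _
        (fun p : borelV R d * X => m.+1%:R^-1 *: e + p.1)).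
      apply: vmeasurableD; first exact: vmeasurable_cst.
      by apply/measurable_fun_borelV.
    exact: (measurableT_comp (measurable_grad_joint j) msh).
  exact: measurable_grad_joint.
move=> [y s] _ /=.
have [d1 d2] := derive_grad_coord e j ((dF s).2 y).
have := harmonic_scale_cvg d1.
rewrite d2 (_ : (e *m hess (F ^~ s) y) 0 j = hess (F ^~ s) y k j)//.
by rewrite -rowE mxE.
Qed.

End joint_measurability.

(** * The fundamental theorem of calculus for a Lipschitz function with a possibly discontinuous
    derivative *)

Section mean_derivative.
Context (R : realType).
Variables (phi dphi : R -> R) (K : R).
Hypothesis dphiE : forall t : R, is_derive t 1 phi (dphi t).
Hypothesis lip : forall a b, `|phi a - phi b| <= K * `|a - b|.
Notation mu := (@lebesgue_measure R).

Let cphi : continuous phi.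
Proof.
by move=> t; apply/differentiable_continuous/derivable1_diffP; have [] := dphiE t.
Qed.

Let quot k (s : R) : R := k.+1%:R * (phi (k.+1%:R^-1 + s) - phi s).

Let cquot k : continuous (quot k).
Proof.
move=> s; apply: cvgM; first exact: cvg_cst.
apply: cvgB; last exact: cphi.
apply: (@cvg_comp _ _ _ (fun s => k.+1%:R^-1 + s) phi); last exact: cphi.
by apply: cvgD; [exact: cvg_cst|exact: cvg_id].
Qed.

Let quot_cvg s : quot k s @[k --> \oo] --> dphi s.
Proof.
by have [dv <-] := dphiE s; exact: harmonic_slope_cvg.
Qed.

Let quot_le k s : `|quot k s| <= K.
Proof.
rewrite normrM normr_nat -ler_pdivlMl//.
by apply: (le_trans (lip _ _)); rewrite addrK ger0_norm ?invr_ge0// mulrC.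
Qed.

Lemma derive_lipschitz_le t : `|dphi t| <= K.
Proof.
have h : `|quot k t| @[k --> \oo] --> `|dphi t|.
  by apply: cvg_norm; exact: quot_cvg.
apply: (ler_cvg_to h (cvg_cst K)).
by apply: nearW => k; exact: quot_le.
Qed.

Lemma measurable_derive : measurable_fun setT dphi.
Proof.
apply: (@measurable_fun_cvg _ _ _ _ quot) => [k|s _]; last exact: quot_cvg.
by apply: continuous_measurable_fun; exact: cquot.
Qed.

(** An antiderivative of [phi] based at -1. The points [s] and [s + 1 / (k + 1)] with s in [0, 1]
    stay in [0, 2], hence in the open interval (-1, 3) where [dPhi] holds. *)
Let Phi (y : R) : R := (\int[mu]_(t in `[(-1)%R, y]) phi t)%R.

Let dPhi (x : R) : -1 < x -> x < 3 -> is_derive x 1 Phi (phi x).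
Proof.
move=> x1 x3; have [||h1 h2] := @continuous_FTC1_closed R phi (-1) x 3 x3 _ x1.
- apply: continuous_compact_integrable; first exact: segment_compact.
  exact: continuous_subspaceT.
- exact: cphi.
by apply: (DeriveDef h1); rewrite -derive1E h2.
Qed.

Let integral_quot k :
  (\int[mu]_(s in `[0%R, 1%R]) (quot k s)%:E)%E =
  (k.+1%:R * (Phi (k.+1%:R^-1 + 1) - Phi 1)
    - k.+1%:R * (Phi (k.+1%:R^-1 + 0) - Phi 0))%:E.
Proof.
pose a : R := k.+1%:R^-1.
have a0 : 0 < a by rewrite invr_gt0.
have a1 : a <= 1 by rewrite invf_le1 ?ler1n.
pose G (s : R) := k.+1%:R * (Phi (a + s) - Phi s).
have dG (s : R) : -1 < s -> s < 2 -> is_derive s 1 G (quot k s).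
  move=> s1 s2.
  have h1 : is_derive s 1 Phi (phi s) by apply: dPhi => //; lra.
  have h2 : is_derive (a + s) 1 Phi (phi (a + s)) by apply: dPhi; lra.
  have h3 : is_derive s 1 (fun s => Phi (a + s)) (phi (a + s)).
    have h4 : is_derive s 1 (fun s => a + s) 1.
      rewrite (_ : (fun s => a + s) = shift a); first exact: is_derive_shift.
      by apply/funext => u /=; rewrite addrC.
    have := is_derive1_comp h2 h4.
    by rewrite mulr1.
  have h5 := is_deriveB h3 h1.
  have := is_deriveZ k.+1%:R h5.
  done.
rewrite (@continuous_FTC2 R (quot k) G 0 1 ltr01).
- by rewrite /G -EFinB.
- exact: continuous_subspaceT.
- have cG (s : R) : -1 < s -> s < 2 -> {for s, continuous G}.
    move=> s1 s2; apply/differentiable_continuous/derivable1_diffP.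
    by have := dG s s1 s2.
  split.
  + move=> s; rewrite in_itv/= => /andP[s0 s1].
    by have [] : is_derive s 1 G (quot k s) by apply: dG; lra.
  + by apply: cvg_at_right_filter; apply: cG; lra.
  + by apply: cvg_at_left_filter; apply: cG; lra.
- move=> s; rewrite in_itv/= => /andP[s0 s1].
  rewrite derive1E.
  by have [] : is_derive s 1 G (quot k s) by apply: dG; lra.
Qed.

(** The difference quotients of [phi] are continuous, bounded by [K] and converge to [dphi], so
    dominated convergence applies. Their integrals are differences of the difference quotients of
    [Phi] at 1 and at 0, which tend to [phi 1] and [phi 0]. *)
Lemma integral_derive_lipschitz :
  (\int[mu]_(s in `[0%R, 1%R]) (dphi s)%:E)%E = (phi 1 - phi 0)%:E.
Proof.
have m01 : measurable (`[0%R, 1%R] : set R) by exact: measurable_itv.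
have [|||||_ _ cv] := @dominated_convergence _ _ _ mu `[0%R, 1%R]%classic m01
  (fun k s => (quot k s)%:E) (fun s => (dphi s)%:E) (fun=> K%:E).
- move=> k; apply: measurable_funTS; apply/measurable_EFinP.
  exact: continuous_measurable_fun.
- by apply: measurable_funTS; apply/measurable_EFinP; exact: measurable_derive.
- by apply: aeW => s _; apply: cvg_EFin; [exact: nearW|exact: quot_cvg].
- apply: (@continuous_compact_integrable R (cst K)); first exact: segment_compact.
  by apply: continuous_subspaceT => x; exact: cvg_cst.
- by apply: aeW => s k _; rewrite lee_fin quot_le.
apply: cvg_unique cv _ => //.
rewrite (_ : (fun k => _) = fun k => (k.+1%:R * (Phi (k.+1%:R^-1 + 1) - Phi 1)
    - k.+1%:R * (Phi (k.+1%:R^-1 + 0) - Phi 0))%:E); last first.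
  by apply/funext => k; rewrite integral_quot.
apply: cvg_EFin; first exact: nearW.
have cP x : -1 < x -> x < 3 ->
    k.+1%:R * (Phi (k.+1%:R^-1 + x) - Phi x) @[k --> \oo] --> phi x.
  by move=> x1 x3; have [dv <-] := dPhi x1 x3; exact: harmonic_slope_cvg.
by apply: cvgB; apply: cP; lra.
Qed.

End mean_derivative.

Section uniform_mean.
Context (R : realType).
Notation U := (uniform_prob (@ltr01 R)).
Local Open Scope ereal_scope.

Lemma bounded_integrable (dT : measure_display) (T : measurableType dT)
    (P : probability T R) (f : T -> R) (K : R) :
  measurable_fun setT f -> (forall t, `|f t| <= K)%R ->
  P.-integrable setT (EFin \o f).
Proof.
move=> mf fK; apply/integrableP; split; first exact/measurable_EFinP.
apply: (@le_lt_trans _ _ (\int[P]_t (cst K%:E) t)).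
  apply: ge0_le_integral => //=.
  - by apply/measurable_EFinP; exact: measurableT_comp.
  - by move=> t _; rewrite lee_fin.
by rewrite integral_cst//= probability_setT mule1 ltry.
Qed.

Lemma uniform_mean_derive (phi dphi : R -> R) (K : R) :
  (forall t : R, is_derive t 1%R phi (dphi t)) ->
  (forall a b, `|phi a - phi b| <= K * `|a - b|)%R ->
  U.-integrable setT (EFin \o dphi) /\
  \int[U]_t (dphi t)%:E = (phi 1%R - phi 0%R)%:E.
Proof.
move=> dphiE lip.
have K_ t : (`|dphi t| <= K)%R by exact (derive_lipschitz_le dphiE lip t).
have K0 : (0 <= K)%R by exact: le_trans (normr_ge0 _) (K_ 0%R).
have md := measurable_derive dphiE.
have iU := bounded_integrable U md K_.
split=> //.
(* Adding [K] makes the integrand nonnegative, as [integral_uniform] requires. It is then the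
   derivative of [phi t + K * t], with Lipschitz constant [2 K]. *)
have h : \int[U]_t (dphi t + K)%:E = (phi 1%R + K - phi 0%R)%:E.
  rewrite integral_uniform; first last.
  - by move=> t; rewrite lee_fin; have := K_ t; rewrite ler_norml; lra.
  - by apply/measurable_EFinP; exact: measurable_funD.
  rewrite subr0 invr1 mul1e.
  have hd (t : R) : is_derive t 1%R (fun t => phi t + K * t)%R (dphi t + K)%R.
    have h1 : is_derive t 1%R (fun t : R => K *: t)%R (K *: 1)%R.
      by apply: is_deriveZ.
    have := is_deriveD (dphiE t) h1.
    by rewrite [K *: 1]mulr1.
  have hl a b : (`|(phi a + K * a) - (phi b + K * b)| <= (K + K) * `|a - b|)%R.
    rewrite (_ : _ - _ = (phi a - phi b) + K * (a - b))%R; last by ring.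
    apply: (le_trans (ler_normD _ _)); rewrite mulrDl lerD ?lip//.
    by rewrite normrM (ger0_norm K0).
  by rewrite (@integral_derive_lipschitz R _ _ _ hd hl) mulr1 mulr0 addr0.
have : \int[U]_t (dphi t + K)%:E = \int[U]_t (dphi t)%:E + K%:E.
  under eq_integral do rewrite EFinD.
  rewrite integralD//; last exact: finite_measure_integrable_cst.
  by rewrite integral_cst//= probability_setT mule1.
rewrite h => /(congr1 (fun x => x - K%:E)).
by rewrite addeK// => <-; rewrite -EFinB; congr (_%:E); ring.
Qed.

End uniform_mean.

Lemma coord_le_enorm (R : realType) (d : nat) (x : 'rV[R]_d) j :
  `|x 0 j| <= enorm x.
Proof.
rewrite -sqrtr_sqr ler_sqrt; last by rewrite sumr_ge0// => k _; rewrite sqr_ge0.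
by rewrite (bigD1 j)//= lerDl sumr_ge0// => k _; rewrite sqr_ge0.
Qed.

Lemma coordB (R : realType) (d : nat) (x y : 'rV[R]_d) j :
  (x - y) 0 j = x 0 j - y 0 j.
Proof. by rewrite !mxE. Qed.

(* The gradient is Lipschitz but the Hessian need not be continuous, so this is
   the fundamental theorem of calculus for a bounded derivative. *)
Lemma uniform_mean_hess (R : realType) (d : nat) (f : 'rV[R]_d -> R) (L : R)
    (x y : 'rV[R]_d) (j : 'I_d) :
  twice_differentiable f -> grad_lipschitz L f ->
  (uniform_prob (@ltr01 R)).-integrable setT
    (fun t => (((y - x) *m hess f (t *: y + (1 - t) *: x)) 0 j)%:E) /\
  (\int[uniform_prob (@ltr01 R)]_t
    (((y - x) *m hess f (t *: y + (1 - t) *: x)) 0 j)%:E =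
    ((grad f y - grad f x) 0 j)%:E)%E.
Proof.
move=> [df dg] lf.
have linE (t : R) : t *: y + (1 - t) *: x = x + t *: (y - x).
  by rewrite scalerBl scale1r scalerBr addrC -addrA [- _ + _]addrC.
have [] := @uniform_mean_derive R (fun t => grad f (x + t *: (y - x)) 0 j)
  (fun t => ((y - x) *m hess f (t *: y + (1 - t) *: x)) 0 j)
  (L * enorm (y - x)).
- move=> t; rewrite linE.
  have [d1 d2] := derive_grad_coord (y - x) j (dg (x + t *: (y - x))).
  have [d3 d4] := @derive_line R d R (fun z => grad f z 0 j) x (y - x) t d1.
  exact: (DeriveDef d3 (etrans d4 d2)).
- move=> a b.
  rewrite -coordB.
  apply: (le_trans (coord_le_enorm _ _)); apply: (le_trans (lf _ _)).
  by rewrite opprD addrACA subrr add0r -scalerBl enormZ mulrCA mulrC.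
- move=> i1 i2; split => //.
  by rewrite i2 scale1r scale0r addr0 subrKC coordB.
Qed.

(** * Centred noise and stochastic oracles *)

Section centered.
Context (R : realType) (dX : measure_display) (X : measurableType dX)
  (D : probability X R).
Local Open Scope ereal_scope.

Definition mean0 (f : X -> R) : Prop :=
  D.-integrable setT (EFin \o f) /\ \int[D]_s (f s)%:E = 0.

Lemma mean0_measurable f : mean0 f -> measurable_fun setT f.
Proof. by move=> [/measurable_int/measurable_EFinP]. Qed.

Lemma mean0D f g : mean0 f -> mean0 g -> mean0 (f \+ g)%R.
Proof.
move=> [f1 f2] [g1 g2]; split; first exact: integrableD f1 g1.
by rewrite integralD_EFin//= f2 g2 adde0.
Qed.

Lemma mean0Z (a : R) f : mean0 f -> mean0 (fun s => a * f s)%R.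
Proof.
move=> [f1 f2]; split; first exact: (integrableZl measurableT a f1).
by under eq_integral do rewrite EFinM; rewrite integralZl// f2 mule0.
Qed.

Lemma mean0_0 : mean0 (fun=> 0%R).
Proof. by split; [exact: integrable0|rewrite integral0]. Qed.

Lemma mean0_sum (I : Type) (r : seq I) (f : I -> X -> R) :
  (forall i, mean0 (f i)) -> mean0 (fun s => \sum_(i <- r) f i s)%R.
Proof.
move=> f0; elim: r => [|i r ih].
  by under eq_fun do rewrite big_nil; exact: mean0_0.
by under eq_fun do rewrite big_cons; exact: mean0D (f0 i) ih.
Qed.

Lemma mean0_sub f (m : R) : D.-integrable setT (EFin \o f) ->
  \int[D]_s (f s)%:E = m%:E -> mean0 (fun s => f s - m)%R.
Proof.
move=> f1 f2; have icst := finite_measure_integrable_cst D m measurableT.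
split; first exact: (integrableB measurableT f1 icst).
under eq_integral do rewrite EFinB.
by rewrite integralB//= f2 integral_cst//= probability_setT mule1 subee.
Qed.

Lemma mean0_has_mean (m n : nat) (Y : X -> 'M[R]_(m, n)) M i j :
  has_mean D Y M -> mean0 (fun s => (Y s - M)%R i j).
Proof.
move=> /(_ i j)[/Lfun1_integrable iY EY].
rewrite (_ : (fun s => _) = fun s => Y s i j - M i j)%R; last first.
  by apply/funext => s; rewrite !mxE.
by apply: mean0_sub => //; move: EY; rewrite unlock.
Qed.

Import HBNNSimple.

(** The integral of a nonnegative function is a supremum over the simple functions below it, hence
    monotone whether or not the functions are measurable. The spectral norm of the Hessian noise, a
    supremum over uncountably many vectors, is handled this way. *)
Lemma ge0_le_integral_nonmeas (f g : X -> \bar R) :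
  (forall s, 0 <= f s) -> (forall s, f s <= g s) ->
  \int[D]_s f s <= \int[D]_s g s.
Proof.
move=> f0 fg; have g0 s : 0 <= g s by exact: le_trans (f0 s) (fg s).
rewrite !ge0_integralTE//; apply: ereal_sup_le => _ [h /= hf <-].
by exists h => // s; exact: le_trans (hf s) (fg s).
Qed.

Context (d : nat).
Implicit Type N : X -> 'rV[R]_d.

Lemma sqr_mean_add (N : X -> 'rV[R]_d) (u : 'rV[R]_d) (b : R) :
  (forall j, mean0 (fun s => N s 0%R j)) ->
  \int[D]_s (enorm (N s) ^+ 2)%:E <= b%:E ->
  \int[D]_s (enorm (u + N s)%R ^+ 2)%:E <= (enorm u ^+ 2 + b)%:E.
Proof.
move=> N0 Nb.
have mN : measurable_fun setT (fun s => enorm (N s) ^+ 2)%R.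
  by apply: measurable_funX; apply: measurable_enorm => j; exact: mean0_measurable.
have iN : D.-integrable setT (EFin \o (fun s => enorm (N s) ^+ 2)%R).
  apply/integrableP; split; first exact/measurable_EFinP.
  apply: le_lt_trans (ltry b); apply: le_trans Nb.
  by under eq_integral do rewrite /= ger0_norm ?sqr_ge0//.
have d0 : mean0 (fun s => dotv u (N s)).
  by apply: mean0_sum => j; exact: mean0Z.
have [d1 d2] := mean0Z 2 d0.
have icst := finite_measure_integrable_cst D (enorm u ^+ 2)%R measurableT.
under eq_integral do rewrite enorm_sqrD EFinD EFinD.
rewrite integralD//=; last exact: integrableD icst d1.
rewrite integralD//= d2 adde0 integral_cst//= probability_setT mule1 EFinD.
exact: leeD.
Qed.

End centered.

Section noise.
Context (R : realType) (dO dS dX : measure_display) (Omega : measurableType dO)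
  (S : measurableType dS) (X : measurableType dX) (P : probability Omega R)
  (D : probability X R) (d : nat).
Variable G : set (set Omega).
Hypothesis mG : <<s G >> `<=` measurable.
Notation OmegaG := (g_sigma_algebraType G).
Local Open Scope ereal_scope.

Lemma measurable_fun_sub (dT : measure_display) (T : measurableType dT)
    (Y : Omega -> T) :
  measurable_fun setT (Y : OmegaG -> T) -> measurable_fun setT Y.
Proof. by move=> mY _ B mB; apply: mG; exact: mY. Qed.

Lemma independent2_freeze (dS' : measure_display) (S' : measurableType dS')
    (Y : Omega -> S') (xi : Omega -> X) (h : S' * X -> \bar R) :
  measurable_fun setT (Y : OmegaG -> S') -> measurable_fun setT xi ->
  (forall B, measurable B -> P (xi @^-1` B) = D B) ->
  independent2 P <<s G >> (sigma_of xi) ->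
  measurable_fun [set: S' * X] h -> (forall z, 0 <= h z) ->
  \int[P]_w h (Y w, xi w) = \int[P]_w \int[D]_s h (Y w, s).
Proof.
move=> mY mxi lxi ind mh h0; apply: ge0_integral_freeze => //.
  exact: measurable_fun_sub.
move=> A B mA mB; apply: ind.
  by have := mY measurableT _ mA; rewrite setTI.
by exists B => //; rewrite setTI.
Qed.

(** One fresh draw: [W] and [Y] are frozen together, and for each frozen value the cross term has
    mean 0, so the noise adds at most [b]. The second moment of [W] is an extended real and may be
    infinite here. *)
Lemma noise_step (W : Omega -> 'rV[R]_d) (Y : Omega -> S) (xi : Omega -> X)
    (N : S -> X -> 'rV[R]_d) (b : R) :
  vmeasurable (W : OmegaG -> 'rV[R]_d) ->
  measurable_fun setT (Y : OmegaG -> S) -> measurable_fun setT xi ->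
  (forall B, measurable B -> P (xi @^-1` B) = D B) ->
  independent2 P <<s G >> (sigma_of xi) ->
  (forall j, measurable_fun [set: S * X] (fun p : S * X => N p.1 p.2 0%R j)) ->
  (forall y j, mean0 D (fun s => N y s 0%R j)) ->
  (forall w, \int[D]_s (enorm (N (Y w) s) ^+ 2)%:E <= b%:E) ->
  \int[P]_w (enorm (W w + N (Y w) (xi w))%R ^+ 2)%:E <=
  \int[P]_w (enorm (W w) ^+ 2)%:E + b%:E.
Proof.
move=> mW mY mxi lxi ind mN N0 Nb.
have b0 : (0 <= b)%R.
  have w : Omega := point.
  rewrite -lee_fin; apply: le_trans (Nb w).
  by apply: integral_ge0 => s _; rewrite lee_fin sqr_ge0.
pose WY (w : OmegaG) : borelV R d * S := (W w : borelV R d, Y w).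
have mWY : measurable_fun setT WY.
  by apply: measurable_fun_pair => //; apply/measurable_fun_borelV.
pose h (p : (borelV R d * S) * X) :=
  (enorm ((p.1.1 : 'rV[R]_d) + N p.1.2 p.2)%R ^+ 2)%:E.
have mh : measurable_fun [set: (borelV R d * S) * X] h.
  apply/measurable_EFinP; apply: measurable_funX; apply: measurable_enorm.
  apply: vmeasurableD.
    apply/measurable_fun_borelV.
    exact: (measurableT_comp measurable_fst measurable_fst).
  move=> j.
  have m1 : measurable_fun [set: (borelV R d * S) * X]
      (fun p : (borelV R d * S) * X => (p.1.2, p.2)).
    apply: measurable_fun_pair => //.
    exact: (measurableT_comp measurable_snd measurable_fst).
  exact: (measurableT_comp (mN j) m1).
have -> : \int[P]_w (enorm (W w + N (Y w) (xi w))%R ^+ 2)%:E =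
    \int[P]_w h (WY w, xi w) by [].
rewrite (independent2_freeze mWY)//; last first.
  by move=> z; rewrite /h lee_fin sqr_ge0.
have mW' : measurable_fun setT (fun w => (enorm (W w) ^+ 2)%:E).
  apply/measurable_EFinP; apply: measurable_funX; apply: measurable_enorm => j.
  exact: measurable_fun_sub (mW j).
apply: (@le_trans _ _ (\int[P]_w ((enorm (W w) ^+ 2)%:E + b%:E))).
  apply: ge0_le_integral_nonmeas => w; last first.
    by rewrite -EFinD; exact: sqr_mean_add (N0 _) (Nb w).
  by apply: integral_ge0 => s _; rewrite /h lee_fin sqr_ge0.
rewrite ge0_integralD//.
- by rewrite integral_cst//= probability_setT mule1.
- by move=> w _; rewrite lee_fin sqr_ge0.
Qed.

End noise.

(** * Weighted sums of the client functions *)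

Section weighted_sums.
Context (R : realType) (d n : nat).
Implicit Types (c : 'I_n -> R) (f : 'I_n -> 'rV[R]_d -> R).

Lemma differentiable_wsum (V W : normedModType R) (c : 'I_n -> R)
    (F : 'I_n -> V -> W) x : (forall i, differentiable (F i) x) ->
  differentiable (fun y => \sum_i c i *: F i y) x.
Proof.
move=> dF; rewrite (_ : (fun y => _) = \sum_i (c i \*: F i)).
  by apply: differentiable_sum => i; exact: differentiableZ.
by apply/funext => y; rewrite fct_sumE.
Qed.

Lemma derive_wsum (V W : normedModType R) (c : 'I_n -> R)
    (F : 'I_n -> V -> W) x h : (forall i, derivable (F i) x h) ->
  'D_h (fun y => \sum_i c i *: F i y) x = \sum_i c i *: 'D_h (F i) x.
Proof.
move=> dF; rewrite (_ : (fun y => _) = \sum_i (c i \*: F i)); last first.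
  by apply/funext => y; rewrite fct_sumE.
rewrite derive_sum => [|i]; last exact: derivableZ.
by apply: eq_bigr => i _; rewrite deriveZ.
Qed.

Definition wsum c f (y : 'rV[R]_d) : R := \sum_i c i * f i y.

Lemma average_wsum f : average_fun f = wsum (fun=> n%:R^-1) f.
Proof. by apply/funext => y; rewrite /average_fun mulr_sumr. Qed.

Lemma grad_wsum c f x : (forall i, differentiable (f i) x) ->
  grad (wsum c f) x = \sum_i c i *: grad (f i) x.
Proof.
move=> df; apply/rowP => j; rewrite summxE mxE.
rewrite (@derive_wsum _ R c f); last by move=> i; exact: diff_derivable.
by apply: eq_bigr => i _; rewrite !mxE.
Qed.

Lemma grad_wsumE c f : (forall i, twice_differentiable (f i)) ->
  grad (wsum c f) = (fun y => \sum_i c i *: grad (f i) y).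
Proof. by move=> df; apply/funext => y; rewrite grad_wsum// => i; exact: (df i).1. Qed.

Lemma twice_differentiable_wsum c f :
  (forall i, twice_differentiable (f i)) -> twice_differentiable (wsum c f).
Proof.
move=> df; split => x.
  by apply: (@differentiable_wsum _ R) => i; exact: (df i).1.
rewrite grad_wsumE//.
by apply: (@differentiable_wsum _ 'rV[R]_d c (fun i => grad (f i))) => i; exact: (df i).2.
Qed.

Lemma hess_wsum c f x (h : 'rV[R]_d) : (forall i, twice_differentiable (f i)) ->
  h *m hess (wsum c f) x = \sum_i c i *: (h *m hess (f i) x).
Proof.
move=> df; have [_ dg] := twice_differentiable_wsum c df.
transitivity ('D_h (grad (wsum c f)) x); first exact: hess_derive.
rewrite (grad_wsumE c df).
rewrite (@derive_wsum _ 'rV[R]_d c (fun i => grad (f i))); last first.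
  by move=> i; apply: diff_derivable; exact: (df i).2.
apply: eq_bigr => i _; congr (_ *: _).
by symmetry; apply: hess_derive; exact: (df i).2.
Qed.

End weighted_sums.

Section deterministic_measurability.
Context (R : realType) (d : nat) (f : 'rV[R]_d -> R).
Hypothesis df : twice_differentiable f.

Lemma measurable_grad j :
  measurable_fun [set: borelV R d] (fun y : borelV R d => grad f y 0 j).
Proof.
apply: (@continuous_measurable_borelV R d (fun y => grad f y 0 j)) => y.
have /differentiable_continuous cg := df.2 y.
exact: (cvg_comp _ _ cg (@coord_continuous _ _ _ 0 j _)).
Qed.

Lemma measurable_hess k j :
  measurable_fun [set: borelV R d] (fun y : borelV R d => hess f y k j).
Proof.
have h := @measurable_hess_joint R d _ R (fun y _ => f y) (fun=> df)
  (fun y j => measurable_cst _) k j.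
have mp : measurable_fun [set: borelV R d] (fun y : borelV R d => (y, 0 : R)).
  exact: measurable_fun_pair.
exact: (measurableT_comp h mp).
Qed.

Lemma vmeasurable_grad (dT : measure_display) (T : measurableType dT)
    (y : T -> 'rV[R]_d) : vmeasurable y -> vmeasurable (fun w => grad f (y w)).
Proof.
move=> /measurable_fun_borelV my j.
exact: (measurableT_comp (measurable_grad j) my).
Qed.

Lemma vmeasurable_hess (dT : measure_display) (T : measurableType dT)
    (h y : T -> 'rV[R]_d) : vmeasurable h -> vmeasurable y ->
  vmeasurable (fun w => h w *m hess f (y w)).
Proof.
move=> mh /measurable_fun_borelV my; apply: vmeasurable_mulmx => // k j.
exact: (measurableT_comp (measurable_hess k j) my).
Qed.

End deterministic_measurability.

Section oracle.
Context (R : realType) (d : nat) (dX : measure_display) (X : measurableType dX)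
  (D : probability X R) (f : 'rV[R]_d -> R) (F : 'rV[R]_d -> X -> R)
  (sigma_g sigma_h : R).
Hypothesis dF : forall s, twice_differentiable (F ^~ s).
Hypothesis gmean : forall y, has_mean D (fun s => grad (F ^~ s) y) (grad f y).
Hypothesis hmean : forall y, has_mean D (fun s => hess (F ^~ s) y) (hess f y).
Hypothesis gvar : forall y,
  ('E_D[fun s => (enorm (grad (F ^~ s) y - grad f y) ^+ 2)%R] <=
   (sigma_g ^+ 2)%:E)%E.
Hypothesis hvar : forall y,
  ('E_D[fun s => (specnorm (hess (F ^~ s) y - hess f y) ^+ 2)%R] <=
   (sigma_h ^+ 2)%:E)%E.

Definition gnoise (y : 'rV[R]_d) (s : X) : 'rV[R]_d :=
  grad (F ^~ s) y - grad f y.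

Definition hnoise (h y : 'rV[R]_d) (s : X) : 'rV[R]_d :=
  h *m (hess (F ^~ s) y - hess f y).

Lemma gnoise_mean0 y j : mean0 D (fun s => gnoise y s 0 j).
Proof. exact: mean0_has_mean. Qed.

Lemma hnoise_mean0 h y j : mean0 D (fun s => hnoise h y s 0 j).
Proof.
rewrite (_ : (fun s => _) = fun s =>
    \sum_k h 0 k * (hess (F ^~ s) y - hess f y) k j).
  by apply: mean0_sum => k; apply: mean0Z; exact: mean0_has_mean.
by apply/funext => s; rewrite /hnoise mxE.
Qed.

Let mF y j : measurable_fun setT (fun s => grad (F ^~ s) y 0 j).
Proof. by have [/Lfun1_integrable/measurable_int/measurable_EFinP] := gmean y 0 j. Qed.

Lemma vmeasurable_oracle_grad (dT : measure_display) (T : measurableType dT)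
    (y : T -> 'rV[R]_d) (s : T -> X) : vmeasurable y -> measurable_fun setT s ->
  vmeasurable (fun w => grad (F ^~ (s w)) (y w)).
Proof.
move=> /measurable_fun_borelV my ms j.
exact: (measurableT_comp (measurable_grad_joint dF mF j)
  (measurable_fun_pair my ms)).
Qed.

Lemma vmeasurable_oracle_hess (dT : measure_display) (T : measurableType dT)
    (h y : T -> 'rV[R]_d) (s : T -> X) :
  vmeasurable h -> vmeasurable y -> measurable_fun setT s ->
  vmeasurable (fun w => h w *m hess (F ^~ (s w)) (y w)).
Proof.
move=> mh /measurable_fun_borelV my ms; apply: vmeasurable_mulmx => // k j.
exact: (measurableT_comp (measurable_hess_joint dF mF k j)
  (measurable_fun_pair my ms)).
Qed.

Local Open Scope ereal_scope.

Lemma hnoise_var h y :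
  \int[D]_s (enorm (hnoise h y s) ^+ 2)%:E <= ((enorm h * sigma_h) ^+ 2)%:E.
Proof.
(* The factor [enorm h ^+ 2] is divided out on the side of the noise, which is measurable; pulling
   it out of the integral of the spectral norm would ask for measurability there. The division needs
   [h] nonzero. *)
have [h0|h0] := eqVneq (enorm h) 0%R.
  rewrite integral0_eq ?lee_fin ?sqr_ge0// => s _.
  by rewrite /hnoise (enorm0_eq0 h0) mul0mx enorm0 expr0n.
have hp : (0 < enorm h ^+ 2)%R by rewrite exprn_gt0// lt0r h0 enorm_ge0.
have mN : measurable_fun setT (fun s => (enorm (hnoise h y s) ^+ 2)%:E).
  apply/measurable_EFinP; apply: measurable_funX; apply: measurable_enorm => j.
  exact: mean0_measurable (hnoise_mean0 h y j).
rewrite exprMn EFinM -lee_pdivrMl//.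
rewrite -ge0_integralZl//; last first.
- by rewrite lee_fin invr_ge0 ltW.
- by move=> s _; rewrite lee_fin sqr_ge0.
have := hvar y; rewrite unlock; apply: le_trans.
apply: ge0_le_integral_nonmeas => s.
  by rewrite -EFinM lee_fin mulr_ge0 ?sqr_ge0// invr_ge0 ltW.
rewrite -EFinM lee_fin ler_pdivrMl// -exprMn ler_sqr ?nnegrE ?enorm_ge0//.
  by rewrite mulrC; exact: enorm_specnorm.
by rewrite mulr_ge0 ?enorm_ge0 ?specnorm_ge0.
Qed.

(** Used with [c] the weight of a client, [a = 1 - eta t], [b = eta t] and [h] the step. *)
Definition noise (c a b : R) (h y y' : 'rV[R]_d) (s : X) : 'rV[R]_d :=
  (c *: (a *: hnoise h y s + b *: gnoise y' s))%R.

Lemma noise_mean0 c a b h y y' j : mean0 D (fun s => noise c a b h y y' s 0%R j).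
Proof.
rewrite (_ : (fun s => _) = fun s =>
    (c * (a * hnoise h y s 0 j + b * gnoise y' s 0 j))%R).
  apply: mean0Z; apply: mean0D; apply: mean0Z.
    exact: hnoise_mean0.
  exact: gnoise_mean0.
by apply/funext => s; rewrite /noise; move: (hnoise _ _ _) (gnoise _ _) => u u';
  rewrite !mxE.
Qed.

(** The Hessian and the gradient are evaluated at the same sample, so their noises may be
    correlated; hence the two factors 2. *)
Lemma noise_var c a b h y y' :
  \int[D]_s (enorm (noise c a b h y y' s) ^+ 2)%:E <=
  (c ^+ 2 * (2 * (a * enorm h * sigma_h) ^+ 2 + 2 * (b * sigma_g) ^+ 2))%:E.
Proof.
have mh : measurable_fun setT (fun s => (enorm (hnoise h y s) ^+ 2)%:E).
  apply/measurable_EFinP; apply: measurable_funX; apply: measurable_enorm => j.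
  exact: mean0_measurable (hnoise_mean0 h y j).
have mg : measurable_fun setT (fun s => (enorm (gnoise y' s) ^+ 2)%:E).
  apply/measurable_EFinP; apply: measurable_funX; apply: measurable_enorm => j.
  exact: mean0_measurable (gnoise_mean0 y' j).
pose k1 := (c ^+ 2 * (2 * a ^+ 2))%R; pose k2 := (c ^+ 2 * (2 * b ^+ 2))%R.
have k10 : (0 <= k1)%R by rewrite mulr_ge0 ?sqr_ge0// mulr_ge0 ?sqr_ge0.
have k20 : (0 <= k2)%R by rewrite mulr_ge0 ?sqr_ge0// mulr_ge0 ?sqr_ge0.
apply: (@le_trans _ _ (\int[D]_s (k1%:E * (enorm (hnoise h y s) ^+ 2)%:E
                                + k2%:E * (enorm (gnoise y' s) ^+ 2)%:E))).
  apply: ge0_le_integral_nonmeas => s; first by rewrite lee_fin sqr_ge0.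
  rewrite -!EFinM -EFinD lee_fin /noise enormZ exprMn real_normK ?num_real//.
  have h1 := enorm_sqrD_le (a *: hnoise h y s) (b *: gnoise y' s).
  rewrite !enormZ !exprMn !real_normK ?num_real// in h1.
  have -> : (k1 * enorm (hnoise h y s) ^+ 2 + k2 * enorm (gnoise y' s) ^+ 2 =
    c ^+ 2 * (2 * (a ^+ 2 * enorm (hnoise h y s) ^+ 2) +
              2 * (b ^+ 2 * enorm (gnoise y' s) ^+ 2)))%R.
    by rewrite /k1 /k2; ring.
  exact: ler_wpM2l (sqr_ge0 c) _ _ h1.
rewrite ge0_integralD//; first last.
- exact: measurable_funeM.
- by move=> s _; rewrite -EFinM lee_fin mulr_ge0 ?sqr_ge0.
- exact: measurable_funeM.
- by move=> s _; rewrite -EFinM lee_fin mulr_ge0 ?sqr_ge0.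
rewrite !ge0_integralZl//; try by move=> s _; rewrite lee_fin sqr_ge0.
have -> : (c ^+ 2 * (2 * (a * enorm h * sigma_h) ^+ 2 + 2 * (b * sigma_g) ^+ 2))%R
  = (k1 * (enorm h * sigma_h) ^+ 2 + k2 * sigma_g ^+ 2)%R by rewrite /k1 /k2; ring.
rewrite EFinD (EFinM k1) (EFinM k2).
apply: leeD; apply: lee_wpmul2l; rewrite ?lee_fin//; first exact: hnoise_var.
by have := gvar y'; rewrite unlock.
Qed.

End oracle.

(** * Step sizes and the random index *)

Section rates.
Context (R : realType) (r : nat -> R).
Hypothesis r0 : forall t, 0 < r t.
Hypothesis r3 : forall t, r t ^+ 3 = 2 / (t%:R + 2).

Lemma rate_ler t u : (t <= u)%N -> r u <= r t.
Proof.
move=> tu; rewrite -(@ler_pXn2r _ 3)// ?nnegrE ?(ltW (r0 _))// !r3.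
by rewrite ler_pM2l// lef_pV2 ?posrE ?ltr_wpDl// lerD2r ler_nat.
Qed.

Lemma rate00 : r 0 = 1.
Proof.
apply/eqP; rewrite -(@eqrXn2 _ 3)//; last exact: ltW.
by rewrite r3 expr1n add0r divff.
Qed.

Lemma rate_le1 t : r t <= 1.
Proof. by rewrite -rate00 rate_ler. Qed.

(* [b^2 >= b^3 / a] turns the claim into [a^3 - b^3 <= a^6 / 2]. *)
Lemma rate_gap t : r t ^+ 2 - r t.+1 ^+ 2 <= r t ^+ 4 / 2.
Proof.
have a0 := r0 t; have b0 := r0 t.+1; have a1 := rate_le1 t.
have ba : r t.+1 <= r t by exact: rate_ler.
have k0 : (0 : R) <= t%:R by [].
have gap3 : r t ^+ 3 - r t.+1 ^+ 3 <= (r t ^+ 3) ^+ 2 / 2.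
  rewrite !r3 -[t.+1%:R]natr1 -subr_ge0.
  set k := t%:R in k0 *.
  have -> : (2 / (k + 2)) ^+ 2 / 2 - (2 / (k + 2) - 2 / (k + 1 + 2)) =
      2 / ((k + 2) ^+ 2 * (k + 3)) by field; rewrite !gt_eqF//; lra.
  by rewrite divr_ge0// mulr_ge0 ?sqr_ge0//; lra.
set a := r t in a0 a1 ba gap3 *; set b := r t.+1 in b0 ba gap3 *.
rewrite -(ler_pM2l a0).
apply: (@le_trans _ _ (a ^+ 3 - b ^+ 3)).
  have : 0 <= (a - b) * b ^+ 2 by rewrite mulr_ge0 ?sqr_ge0// subr_ge0.
  by rewrite !exprS expr0; lra.
apply: (le_trans gap3).
have : 0 <= (1 - a) * a ^+ 5 by rewrite mulr_ge0 ?subr_ge0// exprn_ge0// ltW.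
by rewrite !exprS expr0; lra.
Qed.

Lemma sum_rate3 T : \sum_(t < T) r t ^+ 3 <= 2 * ln (T%:R + 1).
Proof.
elim: T => [|T ih]; first by rewrite big_ord0 add0r ln1 mulr0.
rewrite big_ord_recr/= -[T.+1%:R]natr1.
have k0 : (0 : R) <= T%:R by [].
set k := T%:R in k0 ih *.
(* The logarithms telescope. The inequality is [1 + y <= exp y] at y = ln((k + 1) / (k + 2)). *)
suff : 1 / (k + 2) <= ln (k + 1 + 1) - ln (k + 1).
  rewrite r3 -/k => h.
  have -> : 2 / (k + 2) = 2 * (1 / (k + 2)) by rewrite mulrA mulr1.
  by lra.
rewrite -ln_div ?posrE; [|lra|lra].
have -> : (k + 1 + 1) / (k + 1) = ((k + 1) / (k + 2))^-1.
  by rewrite invf_div -addrA.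
rewrite lnV ?posrE; last by rewrite divr_gt0//; lra.
have -> : 1 / (k + 2) = - ((k + 1) / (k + 2) - 1).
  by field; rewrite gt_eqF//; lra.
rewrite lerN2 lerBrDr addrC.
have p : 0 < (k + 1) / (k + 2) by rewrite divr_gt0//; lra.
by have := expR_ge1Dx (ln ((k + 1) / (k + 2))); rewrite lnK ?posrE.
Qed.

Lemma sum_rate2_ge T : (0 < T)%N -> T%:R `^ 3^-1 <= \sum_(t < T) r t ^+ 2.
Proof.
case: T => // T _; set p := _ `^ _.
have p0 : 0 < p by rewrite powR_gt0.
have p3 : p ^+ 3 = T.+1%:R.
  by rewrite -powR_mulrn ?powR_ge0// -powRrM mulVf// powRr1.
(* There are T + 1 terms, each at least the last one. The cube of this inequality is
   [2 / (T + 2) >= 1 / (T + 1)]. *)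
have pr : 1 <= p * r T.
  rewrite -(@ler_pXn2r _ 3)// ?nnegrE ?mulr_ge0 ?(ltW p0) ?(ltW (r0 _))//.
  rewrite expr1n exprMn p3 r3 -[T.+1%:R]natr1; have k0 : (0 : R) <= T%:R by [].
  by rewrite mulrA ler_pdivlMr; lra.
apply: (@le_trans _ _ (\sum_(t < T.+1) r T ^+ 2)); last first.
  apply: ler_sum => t _; rewrite ler_sqr ?nnegrE ?(ltW (r0 _))//.
  by apply: rate_ler; rewrite -ltnS.
rewrite sumr_const card_ord -[leRHS]mulr_natl -p3.
have -> : p ^+ 3 * r T ^+ 2 = p * (p * r T) ^+ 2 by ring.
by rewrite ler_pMr// -[leLHS](expr1n _ 2) ler_sqr ?nnegrE// ltW// mulr_gt0.
Qed.

(* [ub] bounds the compression error of a client and [eps] its momentum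
   error; the latter is not small at time [0]. *)
Lemma compression_sum (ub eps : nat -> R) (s a L M : R) :
  0 <= s < 1 -> 0 < a -> 0 <= L -> L * a <= M ->
  (forall t, 0 <= ub t) ->
  (forall t, eps t.+1 <= 3 * M * r t.+1) -> (forall t, 0 <= eps t) ->
  (forall t, ub t.+1 <= s * (ub t + eps t.+1 + eps t + L * (a * r t ^+ 2))) ->
  forall T, (1 - s) * (\sum_(t < T) a * r t ^+ 2 * ub t) <=
    a * ub 0 + s * (a * eps 0 + 7 * M * a * \sum_(t < T) r t ^+ 3).
Proof.
move=> /andP[s0 s1] a0 L0 LM ub0 epsM eps0 step T.
have M0 : 0 <= M by apply: le_trans LM; rewrite mulr_ge0// ltW.
pose S T := \sum_(t < T) a * r t ^+ 2 * ub t.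
pose V T := \sum_(t < T) r t ^+ 3.
(* The coefficient 7 is 3 for [eps t.+1], 3 for [eps t] when [t > 0], and 1 for the Lipschitz term.
   The boolean charges [eps 0] once, at [t = 0]. *)
have dterm t : a * r t.+1 ^+ 2 * ub t.+1 <= s * (a * r t ^+ 2 * ub t)
    + s * ((t == 0)%N%:R * (a * eps 0) + 7 * M * a * r t ^+ 3).
  have rt := r0 t; have rl := rate_ler (leqnSn t).
  have u1 := step t.
  have w0 : 0 <= a * r t ^+ 2 by rewrite mulr_ge0 ?sqr_ge0// ltW.
  have h1 : a * r t.+1 ^+ 2 * ub t.+1 <= a * r t ^+ 2 * ub t.+1.
    by rewrite ler_wpM2r// ler_wpM2l ?(ltW a0)// ler_sqr ?nnegrE ?(ltW (r0 _)).
  apply: (le_trans h1); apply: (le_trans (ler_wpM2l w0 u1)).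
  rewrite [leLHS]mulrCA -[leRHS]mulrDr ler_wpM2l//.
  rewrite !mulrDr -!addrA lerD2l.
  have h2 : a * r t ^+ 2 * eps t.+1 <= 3 * M * a * r t ^+ 3.
    have h : eps t.+1 <= 3 * M * r t.
      by apply: (le_trans (epsM t)); rewrite ler_wpM2l// mulr_ge0.
    by apply: (le_trans (ler_wpM2l w0 h)); rewrite !exprS expr0; lra.
  have h3 : a * r t ^+ 2 * eps t <=
      (t == 0)%N%:R * (a * eps 0) + 3 * M * a * r t ^+ 3.
    case: t {u1 h1 h2 rl} rt w0 => [|t] rt w0.
      by rewrite eqxx mul1r rate00 !expr1n !mulr1 lerDl !mulr_ge0// ltW.
    rewrite mul0r add0r.
    by apply: (le_trans (ler_wpM2l w0 (epsM t))); rewrite !exprS expr0; lra.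
  have h4 : a * r t ^+ 2 * (L * (a * r t ^+ 2)) <= M * a * r t ^+ 3.
    have -> : a * r t ^+ 2 * (L * (a * r t ^+ 2)) =
      (a * r t ^+ 3) * ((L * a) * r t) by ring.
    have -> : M * a * r t ^+ 3 = (a * r t ^+ 3) * M by ring.
    rewrite ler_wpM2l//; first by rewrite mulr_ge0 ?exprn_ge0// ltW.
    by apply: (le_trans _ LM); rewrite ler_piMr ?rate_le1// mulr_ge0// ltW.
  lra.
have X0 : 0 <= a * eps 0 by rewrite mulr_ge0// ltW.
have main : S T.+1 <= a * ub 0 + s * S T + s * (a * eps 0 + 7 * M * a * V T).
  rewrite /S big_ord_recl/= rate00 expr1n mulr1 -addrA lerD2l.
  apply: (le_trans (ler_sum _ (fun (t : 'I_T) _ => dterm t))).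
  rewrite big_split/= -!mulr_sumr lerD2l ler_wpM2l// big_split/= -!mulr_sumr lerD2r.
  case: (T) => [|T']; first by rewrite big_ord0.
  by rewrite big_ord_recl/= mul1r big1 ?addr0// => t _; rewrite mul0r.
(* Monotonicity of the partial sums closes the recursion: replacing [S T.+1] by [S T] on the left of
   [main] yields the factor [1 - s]. *)
have SS : S T <= S T.+1.
  by rewrite /S big_ord_recr/= lerDl !mulr_ge0 ?sqr_ge0// ltW.
rewrite -/(S T) -/(V T).
by move: main; rewrite mulrBl mul1r; lra.
Qed.

End rates.

Section random_index.
Context (R : realType) (d : nat) (dO : measure_display)
  (Omega : measurableType dO) (P : probability Omega R)
  (x : nat -> Omega -> 'rV[R]_d) (tau : {RV P >-> nat}) (T : nat) (p : nat -> R)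
  (h : 'rV[R]_d -> R).
Hypothesis mx : forall t, vmeasurable (x t).
Hypothesis mh : measurable_fun [set: borelV R d] (h : borelV R d -> R).
Hypothesis h0 : forall y, 0 <= h y.
Hypothesis ptau : forall t, (t < T)%N -> P (tau @^-1` [set t]) = (p t)%:E.
Hypothesis p1 : \sum_(t < T) p t = 1.
Hypothesis ind :
  independent2 P <<s \bigcup_(s in `I_T) sigma_of (x s : Omega -> borelV R d) >>
    (sigma_of tau).
Local Open Scope ereal_scope.

Let A t := tau @^-1` [set t].

Let mA t : measurable (A t). Proof. exact: measurable_funPTI. Qed.

Let N := ~` (\big[setU/set0]_(t < T) A t).

Let mU : measurable (\big[setU/set0]_(t < T) A t).
Proof. exact: bigsetU_measurable. Qed.

Let mN : measurable N. Proof. exact: measurableC. Qed.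

Let PN : P N = 0.
Proof.
rewrite probability_setC// measure_bigsetU//; last first.
  apply/trivIsetP => i j _ _ ij; rewrite /A -preimage_setI.
  by apply/seteqP; split => // w [/= -> /eqP]; rewrite (negbTE ij).
rewrite (eq_bigr (fun t : 'I_T => (p t)%:E)) => [|t _]; last exact: ptau.
by rewrite sumEFin p1 subee.
Qed.

(** Independence of [tau] from [x t] lets the point be frozen while the indicator is integrated. *)
Lemma integral_index t : (t < T)%N ->
  \int[P]_w (\1_(A t) w * h (x t w))%:E =
  (p t)%:E * \int[P]_w (h (x t w))%:E.
Proof.
move=> tT.
pose k (z : borelV R d * nat) : \bar R := (\1_([set t] : set nat) z.2 * h z.1)%:E.
have mhx : measurable_fun setT (fun w => (h (x t w))%:E).
  apply/measurable_EFinP; have /measurable_fun_borelV m := mx t.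
  exact: (measurableT_comp mh m).
have -> : \int[P]_w (\1_(A t) w * h (x t w))%:E =
    \int[P]_w k (x t w : borelV R d, tau w) by [].
rewrite (@ge0_integral_freeze _ _ _ _ _ _ _ P (distribution P tau)
  (x t : Omega -> borelV R d) tau k) //.
- rewrite /k /= -ge0_integralZl//.
  + apply: eq_integral => w _.
    under eq_integral do rewrite mulrC EFinM.
    rewrite ge0_integralZl ?lee_fin//.
    rewrite integral_indic// setIT muleC; congr (_ * _); exact: ptau.
  + by move=> w _; rewrite lee_fin.
  + by rewrite -(ptau tT).
- by apply/measurable_fun_borelV.
- move=> B C mB mC; apply: ind; last by exists C => //; rewrite setTI.
  by apply: sub_sigma_algebra; exists t => //; exists B => //; rewrite setTI.
- have m1 : measurable_fun [set: nat] (\1_([set t] : set nat) : nat -> R).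
    exact: measurable_indic.
  apply/measurable_EFinP; apply: measurable_funM.
    exact: (measurableT_comp m1 measurable_snd).
  exact: (measurableT_comp mh measurable_fst).
- by move=> z; rewrite lee_fin mulr_ge0.
Qed.

Lemma integral_random_index_le :
  \int[P]_w (h (x (tau w) w))%:E <=
  \sum_(t < T) (p t)%:E * \int[P]_w (h (x t w))%:E.
Proof.
have mhx t : measurable_fun setT (fun w => (h (x t w))%:E).
  apply/measurable_EFinP; have /measurable_fun_borelV m := mx t.
  exact: (measurableT_comp mh m).
have mind t : measurable_fun setT (fun w => (\1_(A t) w * h (x t w))%:E).
  apply/measurable_EFinP; apply: measurable_funM; first exact: measurable_indic.
  by apply/measurable_EFinP; exact: mhx.
have ind0 t w : 0 <= (\1_(A t) w * h (x t w))%:E by rewrite lee_fin mulr_ge0.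
(* On [N] the index leaves the range and nothing bounds the integrand; [+oo] times the indicator of
   this null event absorbs it at no cost. *)
apply: (@le_trans _ _ (\int[P]_w (\sum_(t < T) (\1_(A t) w * h (x t w))%:E
                                 + +oo * (\1_N w)%:E))).
  apply: ge0_le_integral_nonmeas => w; first by rewrite lee_fin.
  have [tT|Tt] := ltnP (tau w) T.
    rewrite (bigD1 (Ordinal tT))//= indicE mem_set// mul1r -addeA leeDl//.
    by rewrite adde_ge0 ?sume_ge0// mule_ge0// lee_fin.
  have -> : \1_N w = 1%R :> R.
    rewrite indicE mem_set// /N -bigcup_mkord => -[t /= tT Aw].
    by move: Tt; rewrite Aw leqNgt tT.
  have S0 : 0 <= \sum_(t < T) (\1_(A t) w * h (x t w))%:E by exact: sume_ge0.
  by rewrite mule1 addey ?leey// gt_eqF// (lt_le_trans _ S0).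
have m1N : measurable_fun setT (fun w => (\1_N w)%:E : \bar R).
  by apply/measurable_EFinP; exact: measurable_indic.
rewrite ge0_integralD//; first last.
- exact: measurable_funeM.
- exact: emeasurable_sum.
- by move=> w _; exact: sume_ge0.
rewrite ge0_integralZl//.
have iN : \int[P]_w (\1_N w)%:E = 0.
  by rewrite integral_indic// setIT; exact: PN.
rewrite iN mule0 adde0 ge0_integral_sum//.
by rewrite (eq_bigr _ (fun (t : 'I_T) _ => integral_index (ltn_ord t))).
Qed.

End random_index.

(** * The iterates *)

Lemma measurable_fun_le_sigma (dT : measure_display) (Omega : pointedType)
    (T : measurableType dT) (G G' : set (set Omega)) (Y : Omega -> T) :
  G `<=` <<s G' >> ->
  measurable_fun setT (Y : g_sigma_algebraType G -> T) ->
  measurable_fun setT (Y : g_sigma_algebraType G' -> T).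
Proof.
move=> GG mY _ B mB; have : <<s G >> ([set: Omega] `&` Y @^-1` B) by exact: mY.
by apply: smallest_sub => //; exact: smallest_sigma_algebra.
Qed.

Lemma measurable_fun_sigma_of (dT : measure_display) (Omega : pointedType)
    (T : measurableType dT) (G : set (set Omega)) (Y : Omega -> T) :
  preimage_set_system setT Y measurable `<=` <<s G >> ->
  measurable_fun setT (Y : g_sigma_algebraType G -> T).
Proof. by move=> sY _ B mB; apply: sY; exists B. Qed.

Section iterates.
Unset Implicit Arguments.
Context (R : realType) (d n : nat) (dO dX dZ : measure_display)
  (Omega : measurableType dO) (P : probability Omega R)
  (X : 'I_n -> measurableType dX) (D : forall i : 'I_n, probability (X i) R)
  (Z : nat -> 'I_n -> measurableType dZ)
  (f : 'I_n -> 'rV[R]_d -> R) (F : forall i : 'I_n, 'rV[R]_d -> X i -> R)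
  (C : forall (t : nat) (i : 'I_n), Z t i -> 'rV[R]_d -> 'rV[R]_d)
  (gamma eta : nat -> R)
  (x0 : 'rV[R]_d) (g0 v0 : 'I_n -> 'rV[R]_d)
  (q : nat -> {RV P >-> R})
  (xi : forall (t : nat) (i : 'I_n), {RV P >-> X i})
  (zeta : forall (t : nat) (i : 'I_n), {RV P >-> Z t i})
  (x : nat -> Omega -> 'rV[R]_d)
  (g v : nat -> 'I_n -> Omega -> 'rV[R]_d).
Hypothesis dF : forall i s, twice_differentiable (F i ^~ s).
Hypothesis mC : forall t i, compressor (C t i).
Hypothesis gmean :
  forall i y, has_mean (D i) (fun s => grad (F i ^~ s) y) (grad (f i) y).
Hypothesis algo : EF21_RHM gamma eta F C q xi zeta x0 g0 v0 x g v.
Set Implicit Arguments.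

(** The generators of [history t], kept apart because [g_sigma_algebraType] is parametrized by a
    generating family. *)
Definition drawn_before (t : nat) : set (set Omega) :=
  \bigcup_(s in `I_t)
        (sigma_of (q s) `|`
         \bigcup_(i in [set: 'I_n])
           (sigma_of (xi s i) `|` sigma_of (zeta s i))).

Definition mean_g (t : nat) (w : Omega) : 'rV[R]_d :=
  n%:R^-1 *: \sum_(i < n) g t i w.

Definition xhat (t : nat) (w : Omega) : 'rV[R]_d :=
  q t w *: x t.+1 w + (1 - q t w) *: x t w.

Lemma x_step t w : x t.+1 w = x t w - gamma t *: normalize (mean_g t w).
Proof. by have [_ _ _ /(_ t)[]] := algo w. Qed.

Lemma v_step t i w : v t.+1 i w =
  (1 - eta t) *: (v t i w
    + (x t.+1 w - x t w) *m hess (F i ^~ (xi t i w)) (xhat t w))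
  + eta t *: grad (F i ^~ (xi t i w)) (x t.+1 w).
Proof. by have [_ _ _ /(_ t)[]] := algo w. Qed.

Lemma g_step t i w :
  g t.+1 i w = g t i w + C t i (zeta t i w) (v t.+1 i w - g t i w).
Proof. by have [_ _ _ /(_ t)[]] := algo w. Qed.

Lemma x_stepB t w : enorm (x t.+1 w - x t w) <= `|gamma t|.
Proof.
rewrite x_step addrC addrA addNr add0r enormN enormZ ler_piMr//.
exact: enorm_normalize_le1.
Qed.

Lemma drawn_beforeS t : drawn_before t `<=` drawn_before t.+1.
Proof. by move=> A [s /= st As]; exists s => //=; exact: ltnW. Qed.

Lemma drawn_before_measurable t : <<s drawn_before t >> `<=` measurable.
Proof.
apply: smallest_sub; first exact: sigma_algebra_measurable.
move=> A [s _ [|[i _ []]]] As; apply: sigma_of_measurable As => //.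
Qed.

(** What is known when client [i] compresses: the past, [q t] and its own sample, but not the
    samples or seeds that the other clients draw in this iteration. *)
Definition drawn_sample t (i : 'I_n) : set (set Omega) :=
  history q xi zeta t `|` sigma_of (q t) `|` sigma_of (xi t i).

Lemma drawn_before_sample t i : drawn_before t `<=` <<s drawn_sample t i >>.
Proof.
by move=> A hA; apply: sub_sigma_algebra; left; left; exact: sub_sigma_algebra.
Qed.

Lemma drawn_sampleS t i : drawn_sample t i `<=` <<s drawn_before t.+1 >>.
Proof.
move=> A [[hA|qA]|xA].
- apply: smallest_sub hA; first exact: smallest_sigma_algebra.
  by move=> B /drawn_beforeS; exact: sub_sigma_algebra.
- by apply: sub_sigma_algebra; exists t => //=; left.
- by apply: sub_sigma_algebra; exists t => //=; right; exists i => //; left.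
Qed.

Definition adapted_to (G : set (set Omega)) (Y : Omega -> 'rV[R]_d) : Prop :=
  vmeasurable (Y : g_sigma_algebraType G -> 'rV[R]_d).

Lemma adapted_le G G' Y :
  G `<=` <<s G' >> -> adapted_to G Y -> adapted_to G' Y.
Proof. by move=> GG aY j; exact: measurable_fun_le_sigma GG (aY j). Qed.

Lemma adaptedS t Y :
  adapted_to (drawn_before t) Y -> adapted_to (drawn_before t.+1) Y.
Proof.
refine (@adapted_le _ _ Y _).
exact: subset_trans (@drawn_beforeS t) (@sub_sigma_algebra _ _ _).
Qed.

Section one_step.
Context (t : nat).
Hypothesis ax : adapted_to (drawn_before t) (x t).
Hypothesis ag : forall i, adapted_to (drawn_before t) (g t i).
Hypothesis av : forall i, adapted_to (drawn_before t) (v t i).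

(** Both ends of the segment are known before [q t] and the samples of this iteration are drawn; the
    centring of all noises rests on this. *)
Lemma xS_adapted : adapted_to (drawn_before t) (x t.+1).
Proof.
rewrite /adapted_to (_ : x t.+1 = fun w => x t w - gamma t *: normalize (mean_g t w)).
  apply: vmeasurableB => //; apply: vmeasurableZ => //.
  apply: vmeasurable_normalize; apply: vmeasurableZ => //.
  exact: vmeasurable_sum.
by apply/funext => w; rewrite x_step.
Qed.

Lemma xhat_adapted G : drawn_before t `<=` <<s G >> ->
  sigma_of (q t) `<=` <<s G >> -> adapted_to G (xhat t).
Proof.
move=> hG qG.
have mq : measurable_fun setT (q t : g_sigma_algebraType G -> R).
  exact: measurable_fun_sigma_of.
apply: vmeasurableD; apply: vmeasurableZ => //.
- exact: adapted_le xS_adapted.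
- exact: measurable_funB.
- exact: adapted_le ax.
Qed.

Let q_sample i : sigma_of (q t) `<=` <<s drawn_sample t i >>.
Proof. by move=> A qA; apply: sub_sigma_algebra; left; right. Qed.

Lemma vS_adapted i : adapted_to (drawn_sample t i) (v t.+1 i).
Proof.
pose G := drawn_sample t i.
have mxi : measurable_fun setT (xi t i : g_sigma_algebraType G -> X i).
  apply: measurable_fun_sigma_of => A xA; apply: sub_sigma_algebra.
  by right.
have le := @adapted_le _ G _ (@drawn_before_sample t i).
have axh : adapted_to G (xhat t).
  exact: xhat_adapted (@drawn_before_sample t i) (@q_sample i).
have aS : adapted_to G (x t.+1) by exact: le xS_adapted.
rewrite /adapted_to (_ : v t.+1 i = fun w =>
  (1 - eta t) *: (v t i w
    + (x t.+1 w - x t w) *m hess (F i ^~ (xi t i w)) (xhat t w))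
  + eta t *: grad (F i ^~ (xi t i w)) (x t.+1 w)); last first.
  by apply/funext => w; rewrite v_step.
apply: vmeasurableD; apply: vmeasurableZ => //.
  apply: vmeasurableD; first exact: le.
  refine (@vmeasurable_oracle_hess _ _ _ _ _ _ _ (dF i) (gmean i) _
    (g_sigma_algebraType G) (fun w => x t.+1 w - x t w) (xhat t) (xi t i) _ _ _) => //.
  by apply: vmeasurableB; [exact: aS|exact: le ax].
exact: (@vmeasurable_oracle_grad _ _ _ _ _ _ _ (dF i) (gmean i) _
    (g_sigma_algebraType G) (x t.+1) (xi t i)).
Qed.

Lemma gS_adapted i : adapted_to (drawn_before t.+1) (g t.+1 i).
Proof.
pose G := drawn_before t.+1.
have ag' : adapted_to G (g t i) by exact: adaptedS.
have mz : measurable_fun setT (zeta t i : g_sigma_algebraType G -> Z t i).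
  apply: measurable_fun_sigma_of => A zA; apply: sub_sigma_algebra.
  by exists t => //=; right; exists i => //; right.
have avS : adapted_to G (v t.+1 i).
  exact (adapted_le (@drawn_sampleS t i) (@vS_adapted i)).
rewrite /adapted_to (_ : g t.+1 i = fun w =>
  g t i w + C t i (zeta t i w) (v t.+1 i w - g t i w)); last first.
  by apply/funext => w; rewrite g_step.
apply: vmeasurableD => //; apply/measurable_fun_borelV.
have mu : measurable_fun setT
    ((fun w => v t.+1 i w - g t i w) : g_sigma_algebraType G -> borelV R d).
  by apply/measurable_fun_borelV; exact: vmeasurableB.
exact: (measurableT_comp (mC t i) (measurable_fun_pair mz mu)).
Qed.

End one_step.

Lemma iterates_adapted t :
  [/\ adapted_to (drawn_before t) (x t),
      forall i, adapted_to (drawn_before t) (g t i) &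
      forall i, adapted_to (drawn_before t) (v t i)].
Proof.
elim: t => [|t [ax ag av]].
  split=> [|i|i].
  - rewrite (_ : x 0%N = fun=> x0); first exact: vmeasurable_cst.
    by apply/funext => w; have [] := algo w.
  - rewrite (_ : g 0%N i = fun=> g0 i); first exact: vmeasurable_cst.
    by apply/funext => w; have [] := algo w.
  - rewrite (_ : v 0%N i = fun=> v0 i); first exact: vmeasurable_cst.
    by apply/funext => w; have [] := algo w.
split=> [|i|i].
- exact (adaptedS (xS_adapted ax ag)).
- exact (gS_adapted ax ag av i).
- exact (adapted_le (@drawn_sampleS t i) (vS_adapted ax ag av (i := i))).
Qed.

(** * Momentum errors *)

Unset Implicit Arguments.
Context (sigma_g sigma_h : R).
Hypothesis df : forall i, twice_differentiable (f i).
Hypothesis hmean :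
  forall i y, has_mean (D i) (fun s => hess (F i ^~ s) y) (hess (f i) y).
Hypothesis gvar : forall i y,
  ('E_(D i)[fun s => (enorm (grad (F i ^~ s) y - grad (f i) y) ^+ 2)%R] <=
   (sigma_g ^+ 2)%:E)%E.
Hypothesis hvar : forall i y,
  ('E_(D i)[fun s => (specnorm (hess (F i ^~ s) y - hess (f i) y) ^+ 2)%R] <=
   (sigma_h ^+ 2)%:E)%E.
Hypothesis law_q : forall t, has_law (q t) (uniform_prob (@ltr01 R)).
Hypothesis law_xi : forall t i, has_law (xi t i) (D i).
Hypothesis fresh : fresh_randomness q xi zeta.
Set Implicit Arguments.

Lemma iterates_measurable t :
  [/\ vmeasurable (x t), forall i, vmeasurable (g t i) &
      forall i, vmeasurable (v t i)].
Proof.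
have [ax ag av] := iterates_adapted t.
have sub := measurable_fun_sub (@drawn_before_measurable t).
split=> [j|i j|i j]; apply: sub.
- exact: ax.
- exact: (ag i).
- exact: (av i).
Qed.

(** Read [V] as v_i^t, [G1] and [G2] as the stochastic and the true gradient at x^{t+1}, [G3] as the
    true gradient at x^t, [H1] and [H2] as the stochastic and the true Hessian applied to the step.
    The true Hessian splits off the noise of [q t] from that of the sample. *)
Lemma momentum_split (k b : R) (V G1 G2 G3 H1 H2 : 'rV[R]_d) :
  k *: ((1 - b) *: (V + H1) + b *: G1 - G2) =
  (1 - b) *: (k *: (V - G3) + (k *: H2 - (k *: G2 - k *: G3))) +
  k *: ((1 - b) *: (H1 - H2) + b *: (G1 - G2)).
Proof. by apply/rowP => j; rewrite !mxE; ring. Qed.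

Section momentum.
Context (c : 'I_n -> R) (Lf : R) (t : nat).
Hypothesis lf : grad_lipschitz Lf (wsum c f).

Definition momentum_error (t : nat) (w : Omega) : 'rV[R]_d :=
  \sum_i c i *: (v t i w - grad (f i) (x t w)).

(** Formed for the weighted sum rather than client by client, so that for the mean its size is
    governed by the smoothness constant of f and not by the average of the L_i. *)
Definition qnoise (y : borelV R d * borelV R d) (s : R) : 'rV[R]_d :=
  ((y.2 : 'rV[R]_d) - y.1) *m hess (wsum c f) (s *: y.2 + (1 - s) *: y.1)
  - (grad (wsum c f) y.2 - grad (wsum c f) y.1).

Definition client_noise (i : 'I_n)
    (y : (borelV R d * borelV R d) * borelV R d) (s : X i) : 'rV[R]_d :=
  noise (f i) (F i) (c i) (1 - eta t) (eta t)
    ((y.1.2 : 'rV[R]_d) - y.1.1) y.2 y.1.2 s.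

Definition steps (w : Omega) : borelV R d * borelV R d := (x t w, x t.+1 w).

Lemma momentum_errorS w : momentum_error t.+1 w =
  (1 - eta t) *: (momentum_error t w + qnoise (steps w) (q t w)) +
  \sum_i client_noise (steps w, xhat t w) (xi t i w).
Proof.
rewrite /momentum_error /qnoise /= hess_wsum// !grad_wsumE//.
rewrite -!sumrB -big_split/= scaler_sumr -big_split/=.
apply: eq_bigr => i _; rewrite v_step /client_noise /noise /hnoise /gnoise /=.
rewrite mulmxBr /xhat; exact: momentum_split.
Qed.

Let A (o : option 'I_n) : set (set Omega) :=
  if o is Some i then sigma_of (xi t i)
  else <<s history q xi zeta t `|` sigma_of (q t) >>.

Let AI o : setI_closed (A o).
Proof.
case: o => [i|]; first exact: sigma_of_setI_closed.
exact: sigma_algebra_setI_closed.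
Qed.

Let AT o : A o setT.
Proof.
case: o => [i|]; first exact: sigma_of_setT.
exact: (@measurableT _ (g_sigma_algebraType
  (history q xi zeta t `|` sigma_of (q t)))).
Qed.

Let mA o : A o `<=` measurable.
Proof.
case: o => [i|]; first exact: sigma_of_measurable.
apply: smallest_sub; first exact: sigma_algebra_measurable.
move=> B [hB|]; last exact: sigma_of_measurable.
exact: drawn_before_measurable hB.
Qed.

(** A filtration inside one iteration: [None] carries the past together with [q t], and the clients
    in [r] are those whose samples have been revealed. *)
Definition drawn_clients (r : seq 'I_n) : set (set Omega) :=
  \bigcup_(o in [set` [set o : option 'I_n | if o is Some i then i \in r else true]%SET])
    A o.

Let drawn_clients_measurable r : <<s drawn_clients r >> `<=` measurable.
Proof.
apply: smallest_sub; first exact: sigma_algebra_measurable.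
by move=> B [k _]; exact: mA.
Qed.

Let drawn_clients_q r : sigma_of (q t) `<=` <<s drawn_clients r >>.
Proof.
move=> B qB; apply: sub_sigma_algebra; exists None; first by rewrite /= inE.
by apply: sub_sigma_algebra; right.
Qed.

Let drawn_clients_before r : drawn_before t `<=` <<s drawn_clients r >>.
Proof.
move=> B hB; apply: sub_sigma_algebra; exists None; first by rewrite /= inE.
by apply: sub_sigma_algebra; left; exact: sub_sigma_algebra.
Qed.

Let drawn_clients_xi r i : i \in r -> sigma_of (xi t i) `<=` <<s drawn_clients r >>.
Proof.
by move=> ir B xB; apply: sub_sigma_algebra; exists (Some i); rewrite //= inE.
Qed.

Let ind_client r i : i \notin r ->
  independent2 P <<s drawn_clients r >> (sigma_of (xi t i)).
Proof.
move=> ir; have [_ ind _] := fresh t.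
by apply: (@independent_join _ _ _ _ _ A _ (Some i)) => //; rewrite inE.
Qed.

Let measurable_client_noise i j :
  measurable_fun [set: ((borelV R d * borelV R d) * borelV R d) * X i]
    (fun p : ((borelV R d * borelV R d) * borelV R d) * X i =>
       client_noise p.1 p.2 0 j).
Proof.
pose T := (((borelV R d * borelV R d) * borelV R d) * X i)%type.
have m11 : vmeasurable (fun p : T => p.1.1.1 : 'rV[R]_d).
  apply/measurable_fun_borelV.
  exact: (measurableT_comp measurable_fst (measurableT_comp measurable_fst measurable_fst)).
have m12 : vmeasurable (fun p : T => p.1.1.2 : 'rV[R]_d).
  apply/measurable_fun_borelV.
  exact: (measurableT_comp measurable_snd (measurableT_comp measurable_fst measurable_fst)).
have m2 : vmeasurable (fun p : T => p.1.2 : 'rV[R]_d).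
  apply/measurable_fun_borelV.
  exact: (measurableT_comp measurable_snd measurable_fst).
have md : vmeasurable (fun p : T => (p.1.1.2 : 'rV[R]_d) - p.1.1.1).
  exact: vmeasurableB.
rewrite (_ : (fun p : T => _) = fun p : T => (c i *: ((1 - eta t) *:
    (((p.1.1.2 : 'rV[R]_d) - p.1.1.1) *m hess (F i ^~ p.2) p.1.2 -
     ((p.1.1.2 : 'rV[R]_d) - p.1.1.1) *m hess (f i) p.1.2) +
   eta t *: (grad (F i ^~ p.2) p.1.1.2 - grad (f i) p.1.1.2))) 0 j); last first.
  by apply/funext => p; rewrite /client_noise /noise /hnoise /gnoise mulmxBr.
move: j; apply: (@vmeasurableZ _ _ _ T (fun=> c i)) => //.
apply: (@vmeasurableD _ _ _ T); apply: (@vmeasurableZ _ _ _ T) => //;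
  apply: (@vmeasurableB _ _ _ T).
- exact: (@vmeasurable_oracle_hess _ _ _ _ _ _ _ (dF i) (gmean i) _ T).
- exact: (@vmeasurable_hess _ _ _ (df i) _ T).
- exact: (@vmeasurable_oracle_grad _ _ _ _ _ _ _ (dF i) (gmean i) _ T).
- exact: (@vmeasurable_grad _ _ _ (df i) _ T).
Qed.

Definition client_var (i : 'I_n) : R :=
  c i ^+ 2 * (2 * ((1 - eta t) * gamma t * sigma_h) ^+ 2
              + 2 * (eta t * sigma_g) ^+ 2).

Lemma enorm_step_sqr (a b : R) w :
  (a * enorm (x t.+1 w - x t w) * b) ^+ 2 <= (a * gamma t * b) ^+ 2.
Proof.
rewrite !exprMn ler_wpM2r ?sqr_ge0// ler_wpM2l ?sqr_ge0//.
rewrite -[leRHS]real_normK ?num_real// ler_sqr ?nnegrE ?enorm_ge0//.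
exact: x_stepB.
Qed.

(** Samples are revealed one client at a time. The noise of each is centred given the past, [q t]
    and the samples already seen, so the variances add up. *)
Lemma clients_step (W : Omega -> 'rV[R]_d) (r : seq 'I_n) :
  adapted_to (history q xi zeta t `|` sigma_of (q t)) W -> uniq r ->
  (\int[P]_w (enorm (W w + \sum_(i <- r)
      client_noise (steps w, xhat t w) (xi t i w))%R ^+ 2)%:E <=
   \int[P]_w (enorm (W w) ^+ 2)%:E + (\sum_(i <- r) client_var i)%:E)%E.
Proof.
move=> aW; elim: r => [_|i r ih /= /andP[ir ur]].
  by under eq_integral do rewrite big_nil addr0; rewrite big_nil adde0.
have [ax ag av] := iterates_adapted t.
pose G := drawn_clients r.
pose Y w : (borelV R d * borelV R d) * borelV R d := (steps w, xhat t w : borelV R d).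
have aW' : adapted_to G W.
  refine (adapted_le _ aW) => B hB; apply: sub_sigma_algebra.
  by exists None; [rewrite /= inE|exact: sub_sigma_algebra].
have axt : adapted_to G (x t) by exact (adapted_le (@drawn_clients_before r) ax).
have axS : adapted_to G (x t.+1).
  exact (adapted_le (@drawn_clients_before r) (xS_adapted ax ag)).
have axh : adapted_to G (xhat t).
  exact (xhat_adapted ax ag (@drawn_clients_before r) (@drawn_clients_q r)).
have aY : measurable_fun setT (Y : g_sigma_algebraType G -> _).
  apply: measurable_fun_pair; [apply: measurable_fun_pair|];
    by apply/measurable_fun_borelV.
have aS : adapted_to G (fun w => W w +
    \sum_(k <- r) client_noise (steps w, xhat t w) (xi t k w)).
  apply: vmeasurableD => // j.
  (* [measurable_sum] wants every summand measurable, but only the samples of clients in [r] are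
     known to be so for [G]; the others are replaced by 0. *)
  apply: (eq_measurable_fun (fun w : g_sigma_algebraType G => \sum_(k <- r)
     (if k \in r then client_noise (Y w) (xi t k w) 0 j else 0))) => [w _|].
    rewrite summxE big_seq [RHS]big_seq.
    by apply: eq_bigr => k kr; rewrite kr.
  apply: measurable_sum => k; case: (boolP (k \in r)) => kr //.
  have mk : measurable_fun setT (xi t k : g_sigma_algebraType G -> X k).
    exact: measurable_fun_sigma_of (@drawn_clients_xi r k kr).
  exact: (measurableT_comp (@measurable_client_noise k j) (measurable_fun_pair aY mk)).
rewrite [in leRHS]big_cons [in leRHS](addrC (client_var i)) EFinD addeA.
under eq_integral do rewrite big_cons addrCA addrC.
apply: (@le_trans _ _ (\int[P]_w (enorm (W w + \sum_(k <- r)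
      client_noise (steps w, xhat t w) (xi t k w))%R ^+ 2)%:E + (client_var i)%:E)%E).
  apply: (@noise_step _ _ _ _ _ _ _ P (D i) _ G (@drawn_clients_measurable r)
    _ Y (xi t i) (@client_noise i)) => //.
  - exact: law_xi.
  - exact: ind_client.
  - by move=> y j; exact: noise_mean0.
  - move=> w; have hv := noise_var (gmean i) (hmean i) (gvar i) (hvar i) (c i)
      (1 - eta t) (eta t) (x t.+1 w - x t w) (xhat t w) (x t.+1 w).
    apply: (le_trans hv).
    rewrite lee_fin ler_wpM2l ?sqr_ge0// lerD2r ler_wpM2l//.
    exact: enorm_step_sqr.
by apply: leeD => //; exact: ih.
Qed.

Lemma qnoise_mean0 (y : borelV R d * borelV R d) j :
  mean0 (uniform_prob (@ltr01 R)) (fun s => qnoise y s 0 j).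
Proof.
have [i1 i2] := uniform_mean_hess y.1 y.2 j (twice_differentiable_wsum c df) lf.
rewrite (_ : (fun s => _) = fun s =>
  (((y.2 : 'rV[R]_d) - y.1) *m hess (wsum c f) (s *: y.2 + (1 - s) *: y.1)) 0 j
  - (grad (wsum c f) y.2 - grad (wsum c f) y.1) 0 j).
  exact: mean0_sub.
by apply/funext => s; exact: coordB.
Qed.

Lemma qnoise_le w s : enorm (qnoise (steps w) s) ^+ 2 <= (2 * Lf * gamma t) ^+ 2.
Proof.
have [_ dg] := twice_differentiable_wsum c df.
have e1 := enorm_hess_le (x t.+1 w - x t w)
  (dg (s *: x t.+1 w + (1 - s) *: x t w)) lf.
have e2 := lf (x t.+1 w) (x t w).
have e3 := enormB ((x t.+1 w - x t w) *m hess (wsum c f)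
  (s *: x t.+1 w + (1 - s) *: x t w))
  (grad (wsum c f) (x t.+1 w) - grad (wsum c f) (x t w)).
have e4 : enorm (qnoise (steps w) s) <= 2 * Lf * enorm (x t.+1 w - x t w).
  by apply: (le_trans e3); rewrite -mulrA mulr_natl mulr2n lerD.
apply: le_trans (_ : (2 * Lf * enorm (x t.+1 w - x t w)) ^+ 2 <= _).
  by rewrite ler_sqr ?nnegrE ?enorm_ge0//; apply: le_trans e4; exact: enorm_ge0.
have := enorm_step_sqr (2 * Lf) 1 w.
by rewrite !mulr1.
Qed.

Lemma measurable_qnoise j :
  measurable_fun [set: (borelV R d * borelV R d) * R]
    (fun p : (borelV R d * borelV R d) * R => qnoise p.1 p.2 0 j).
Proof.
pose T := ((borelV R d * borelV R d) * R)%type.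
have m1 : vmeasurable (fun p : T => p.1.1 : 'rV[R]_d).
  apply/measurable_fun_borelV.
  exact: (measurableT_comp measurable_fst measurable_fst).
have m2 : vmeasurable (fun p : T => p.1.2 : 'rV[R]_d).
  apply/measurable_fun_borelV.
  exact: (measurableT_comp measurable_snd measurable_fst).
have ms : measurable_fun setT (fun p : T => p.2) by exact: measurable_snd.
have dw := twice_differentiable_wsum c df.
move: j; apply: (@vmeasurableB _ _ _ T).
  apply: (@vmeasurable_hess _ _ _ dw _ T); first exact: vmeasurableB.
  apply: (@vmeasurableD _ _ _ T); apply: (@vmeasurableZ _ _ _ T) => //.
  exact: measurable_funB.
by apply: (@vmeasurableB _ _ _ T); exact: (@vmeasurable_grad _ _ _ dw _ T).
Qed.

Lemma momentum_adapted : adapted_to (drawn_before t) (momentum_error t).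
Proof.
have [ax ag av] := iterates_adapted t.
apply: vmeasurable_sum => i.
apply: (@vmeasurableZ _ _ _ (g_sigma_algebraType (drawn_before t))) => //.
apply: (@vmeasurableB _ _ _ (g_sigma_algebraType (drawn_before t))); first exact: av.
exact: (@vmeasurable_grad _ _ _ (df i) _ (g_sigma_algebraType (drawn_before t))).
Qed.

(** The noise of [q t] lies inside the factor [1 - eta t]; it is removed after the samples, by a
    second application of [noise_step] over the past alone. *)
Lemma momentum_step :
  (\int[P]_w (enorm (momentum_error t.+1 w) ^+ 2)%:E <=
   ((1 - eta t) ^+ 2)%:E * (\int[P]_w (enorm (momentum_error t w) ^+ 2)%:E
     + ((2 * Lf * gamma t) ^+ 2)%:E) + (\sum_i client_var i)%:E)%E.
Proof.
have [ax ag av] := iterates_adapted t.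
pose G := drawn_before t.
have aY : measurable_fun setT (steps : g_sigma_algebraType G -> _).
  by apply: measurable_fun_pair; apply/measurable_fun_borelV => //; exact: xS_adapted.
pose H := history q xi zeta t `|` sigma_of (q t).
have GH : G `<=` <<s H >>.
  by move=> B hB; apply: sub_sigma_algebra; left; exact: sub_sigma_algebra.
have mqH : measurable_fun setT (q t : g_sigma_algebraType H -> R).
  by apply: measurable_fun_sigma_of => B qB; apply: sub_sigma_algebra; right.
have aq : adapted_to H (fun w => momentum_error t w + qnoise (steps w) (q t w)).
  apply: (@vmeasurableD _ _ _ (g_sigma_algebraType H)).
    exact (adapted_le GH momentum_adapted).
  move=> j; have aYH := measurable_fun_le_sigma GH aY.
  exact: (measurableT_comp (measurable_qnoise j) (measurable_fun_pair aYH mqH)).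
pose W w := (1 - eta t) *: (momentum_error t w + qnoise (steps w) (q t w)).
have aW : adapted_to H W.
  by refine (@vmeasurableZ _ _ _ (g_sigma_algebraType H) _ _ _ aq).
have hW := clients_step aW (index_enum_uniq _).
apply: (@le_trans _ _ (\int[P]_w (enorm (W w) ^+ 2)%:E + (\sum_i client_var i)%:E)%E).
  apply: le_trans hW; rewrite le_eqVlt; apply/orP; left; apply/eqP.
  by apply: eq_integral => w _; rewrite momentum_errorS.
apply: leeD => //.
have mW : measurable_fun setT (fun w =>
    (enorm (momentum_error t w + qnoise (steps w) (q t w)) ^+ 2)%:E).
  apply/measurable_EFinP; apply: measurable_funX; apply: measurable_enorm => j.
  apply: (@measurable_fun_sub _ _ H); last exact: (aq j).
  apply: smallest_sub; first exact: sigma_algebra_measurable.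
  move=> B [hB|]; last exact: sigma_of_measurable.
  exact: drawn_before_measurable hB.
under eq_integral do rewrite /W enormZ exprMn real_normK ?num_real// EFinM.
rewrite ge0_integralZl//; last 2 first.
- by move=> w _; rewrite lee_fin sqr_ge0.
- by rewrite lee_fin sqr_ge0.
apply: lee_wpmul2l; first by rewrite lee_fin sqr_ge0.
have [ind _ _] := fresh t.
apply: (@noise_step _ _ _ _ _ _ _ P (uniform_prob (@ltr01 R)) _ G
  (@drawn_before_measurable t) (momentum_error t) steps (q t) qnoise) => //.
- exact: momentum_adapted.
- exact (measurable_funPT (q t)).
- exact: law_q.
- exact: measurable_qnoise.
- exact: qnoise_mean0.
- move=> w; apply: (@le_trans _ _ (\int[uniform_prob (@ltr01 R)]_s
     (cst ((2 * Lf * gamma t) ^+ 2)%:E) s)%E).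
    apply: ge0_le_integral_nonmeas => s; rewrite lee_fin ?sqr_ge0//.
    exact: qnoise_le.
  by rewrite integral_cst//= probability_setT mule1.
Qed.

End momentum.

(** * Compression errors *)

Unset Implicit Arguments.
Context (Q : forall (t : nat) (i : 'I_n), probability (Z t i) R)
  (alpha : R) (Lc : 'I_n -> R).
Hypothesis alpha01 : 0 < alpha <= 1.
Hypothesis contract : forall t i, contractive (Q t i) alpha (C t i).
Hypothesis law_zeta : forall t i, has_law (zeta t i) (Q t i).
Hypothesis Lc0 : forall i, 0 <= Lc i.
Hypothesis lc : forall i, grad_lipschitz (Lc i) (f i).
Set Implicit Arguments.

Definition client_error (t : nat) (i : 'I_n) (w : Omega) : 'rV[R]_d :=
  v t i w - grad (f i) (x t w).

Definition compression_error (t : nat) (i : 'I_n) (w : Omega) : 'rV[R]_d :=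
  g t i w - v t i w.

Lemma vmeasurable_errors t i :
  vmeasurable (client_error t i) /\ vmeasurable (compression_error t i).
Proof.
have [mx mg mv] := iterates_measurable t.
split; last by apply: vmeasurableB; [exact: mg|exact: mv].
apply: vmeasurableB; first exact: mv.
exact: (@vmeasurable_grad _ _ _ (df i) _ Omega).
Qed.

Local Open Scope ereal_scope.

(** The root is taken under the inner integral, for a frozen compressor input. Thus first moments
    contract by sqrt(1 - alpha), and no second moment of the input appears. *)
Lemma integral_compression t i :
  \int[P]_w (enorm (compression_error t.+1 i w))%:E <=
  (Num.sqrt (1 - alpha))%:E *
  \int[P]_w (enorm (v t.+1 i w - g t i w)%R)%:E.
Proof.
pose G := drawn_sample t i.
have [ax ag av] := iterates_adapted t.
have [_ mg _] := iterates_measurable t.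
have [_ _ mv] := iterates_measurable t.+1.
have aY : adapted_to G (fun w => v t.+1 i w - g t i w)%R.
  apply: (@vmeasurableB _ _ _ (g_sigma_algebraType G)).
    exact: (vS_adapted ax ag av).
  exact (adapted_le (@drawn_before_sample t i) (ag i)).
have mY : measurable_fun setT
    ((fun w => v t.+1 i w - g t i w)%R : g_sigma_algebraType G -> borelV R d).
  by apply/measurable_fun_borelV.
have mG : <<s G >> `<=` measurable.
  apply: smallest_sub; first exact: sigma_algebra_measurable.
  move=> B [[hB|]|]; try exact: sigma_of_measurable.
  exact: drawn_before_measurable hB.
pose h (p : borelV R d * Z t i) :=
  (enorm (C t i p.2 p.1 - (p.1 : 'rV[R]_d))%R)%:E.
have mCp : vmeasurable (fun p : (borelV R d * Z t i)%type =>
    C t i p.2 p.1 - (p.1 : 'rV[R]_d))%R.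
  apply: vmeasurableB; last by apply/measurable_fun_borelV; exact: measurable_fst.
  apply/measurable_fun_borelV.
  have ms : measurable_fun setT (fun p : (borelV R d * Z t i)%type => (p.2, p.1)).
    exact: measurable_fun_pair measurable_snd measurable_fst.
  exact: (measurableT_comp (mC t i) ms).
have mh : measurable_fun [set: borelV R d * Z t i] h.
  by apply/measurable_EFinP; exact: measurable_enorm.
have [_ _ ind] := fresh t.
have -> : \int[P]_w (enorm (compression_error t.+1 i w))%:E =
    \int[P]_w h ((v t.+1 i w - g t i w)%R : borelV R d, zeta t i w).
  apply: eq_integral => w _; rewrite /h /compression_error g_step /=.
  by rewrite opprB addrA (addrC (g t i w)).
rewrite (@independent2_freeze _ _ _ _ _ P (Q t i) G mG _ _ _ (zeta t i) h mY
  (measurable_funPT (zeta t i)) (law_zeta t i) (ind i) mh); last first.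
  by move=> z; rewrite /h lee_fin enorm_ge0.
have mvg : measurable_fun setT (fun w => (enorm (v t.+1 i w - g t i w)%R)%:E).
  apply/measurable_EFinP; apply: measurable_enorm.
  by apply: vmeasurableB; [exact: mv|exact: mg].
rewrite -ge0_integralZl ?lee_fin ?sqrtr_ge0//; last first.
  by move=> w _; rewrite lee_fin enorm_ge0.
apply: ge0_le_integral_nonmeas => w.
  by apply: integral_ge0 => z _; rewrite /h lee_fin enorm_ge0.
rewrite -EFinM; apply: integral_le_sqr.
- apply: measurable_enorm => j.
  exact: (measurable_fun_pair2 _ (mCp j)).
- by move=> z; exact: enorm_ge0.
- by rewrite mulr_ge0 ?sqrtr_ge0 ?enorm_ge0.
- have s2 : (Num.sqrt (1 - alpha) ^+ 2 = 1 - alpha)%R.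
    by case/andP: alpha01 => _ a1; rewrite sqr_sqrtr ?subr_ge0.
  by have := contract t i (v t.+1 i w - g t i w)%R; rewrite unlock exprMn s2.
Qed.

Lemma integral_leD (y a b : Omega -> R) :
  (forall w, 0 <= y w)%R -> (forall w, 0 <= a w)%R -> (forall w, 0 <= b w)%R ->
  measurable_fun setT a -> measurable_fun setT b ->
  (forall w, y w <= a w + b w)%R ->
  \int[P]_w (y w)%:E <= \int[P]_w (a w)%:E + \int[P]_w (b w)%:E.
Proof.
move=> y0 a0 b0 ma mb yab; rewrite -ge0_integralD//.
- by apply: ge0_le_integral_nonmeas => w; rewrite -?EFinD lee_fin.
- by move=> w _; rewrite lee_fin.
- exact/measurable_EFinP.
- by move=> w _; rewrite lee_fin.
- exact/measurable_EFinP.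
Qed.

Lemma errors_split (G V V' A B : 'rV[R]_d) :
  (V' - G = - (G - V) + (V' - A) - (V - B) + (A - B))%R.
Proof. by apply/rowP => j; rewrite !mxE; ring. Qed.

Lemma compression_step t i :
  \int[P]_w (enorm (compression_error t.+1 i w))%:E <=
  (Num.sqrt (1 - alpha))%:E *
  (\int[P]_w (enorm (compression_error t i w))%:E +
   \int[P]_w (enorm (client_error t.+1 i w))%:E +
   \int[P]_w (enorm (client_error t i w))%:E + (Lc i * `|gamma t|)%:E).
Proof.
apply: (le_trans (integral_compression t i)).
apply: lee_wpmul2l; first by rewrite lee_fin sqrtr_ge0.
have [/measurable_enorm m1 /measurable_enorm m2] := vmeasurable_errors t i.
have [/measurable_enorm m3 _] := vmeasurable_errors t.+1 i.
have L0 : (0 <= Lc i * `|gamma t|)%R by rewrite mulr_ge0.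
have -> : (Lc i * `|gamma t|)%:E = \int[P]_w (cst (Lc i * `|gamma t|)%R w)%:E.
  have := integral_cst P measurableT (Lc i * `|gamma t|)%:E.
  by rewrite /= probability_setT mule1 => h; exact: esym h.
pose Y w := enorm (v t.+1 i w - g t i w)%R.
pose A w := enorm (compression_error t i w).
pose B w := enorm (client_error t.+1 i w).
pose B' w := enorm (client_error t i w).
have Y0 w : (0 <= Y w)%R by exact: enorm_ge0.
have A0 w : (0 <= A w)%R by exact: enorm_ge0.
have B0 w : (0 <= B w)%R by exact: enorm_ge0.
have B'0 w : (0 <= B' w)%R by exact: enorm_ge0.
have AB0 w : (0 <= A w + B w)%R by exact: addr_ge0.
have ABB0 w : (0 <= A w + B w + B' w)%R by exact: addr_ge0.
have mAB : measurable_fun setT (fun w => A w + B w)%R by exact: measurable_funD m2 m3.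
have mABB : measurable_fun setT (fun w => A w + B w + B' w)%R.
  exact: measurable_funD mAB m1.
have mL : measurable_fun setT (cst (Lc i * `|gamma t|)%R : Omega -> R) by [].
have YAB w : (Y w <= A w + B w + B' w + cst (Lc i * `|gamma t|) w)%R.
  have e1 : (enorm (grad (f i) (x t.+1 w) - grad (f i) (x t w)) <=
             Lc i * `|gamma t|)%R.
    by apply: le_trans (lc i (x t.+1 w) (x t w)) _; rewrite ler_wpM2l// x_stepB.
  rewrite /Y (errors_split (g t i w) (v t i w) (v t.+1 i w)
    (grad (f i) (x t.+1 w)) (grad (f i) (x t w))).
  apply: le_trans (enormD _ _) (lerD _ e1).
  apply: le_trans (enormB _ _) _; rewrite lerD2r.
  by apply: le_trans (enormD _ _) _; rewrite enormN.
have h1 := integral_leD Y0 ABB0 (fun=> L0) mABB mL YAB.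
have h2 := integral_leD ABB0 AB0 B'0 mAB m1 (fun w => lexx _).
have h3 := integral_leD AB0 A0 B0 m2 m3 (fun w => lexx _).
exact (le_trans h1 (leeD (le_trans h2 (leeD h3 (lexx _))) (lexx _))).
Qed.

(* Error bounds under the prescribed step sizes *)
Local Close Scope ereal_scope.
Unset Implicit Arguments.
Context (gamma0 : R) (r : nat -> R).
Hypothesis gamma00 : 0 < gamma0.
Hypothesis r0 : forall t, 0 < r t.
Hypothesis r3 : forall t, r t ^+ 3 = 2 / (t%:R + 2).
Hypothesis etaE : forall t, eta t = r t ^+ 2.
Hypothesis gammaE : forall t, gamma t = gamma0 * r t ^+ 2.
Hypothesis sigma_g0 : 0 <= sigma_g.
Hypothesis sigma_h0 : 0 <= sigma_h.
Set Implicit Arguments.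

Lemma eta01 t : 0 < eta t <= 1.
Proof.
by rewrite etaE exprn_gt0//= exprn_ile1 ?(ltW (r0 t)) ?(rate_le1 r0 r3).
Qed.

Lemma eta_gap t : eta t - eta t.+1 <= eta t ^+ 2 / 2.
Proof. by rewrite !etaE -exprM; exact: rate_gap. Qed.

Lemma gamma_ge0 t : 0 <= gamma t.
Proof. by rewrite gammaE mulr_ge0 ?sqr_ge0// ltW. Qed.

(** The fresh terms total at most 4 B e^2, and 8 B e (1 - e) + 4 B e^2 = 8 B (e - e^2 / 2), which
    the gap condition bounds by 8 B e'. This balance fixes the constant 8. *)
Lemma momentum_recursion (S K B e e' : R) :
  0 <= e <= 1 -> e - e' <= e ^+ 2 / 2 ->
  0 <= S -> (K * gamma0) ^+ 2 + S * ((gamma0 * sigma_h) ^+ 2 + sigma_g ^+ 2) <= B ->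
  (1 - e) * (8 * B * e) + (1 - e) ^+ 2 * (2 * K * (gamma0 * e)) ^+ 2 +
  S * (2 * ((1 - e) * (gamma0 * e) * sigma_h) ^+ 2 + 2 * (e * sigma_g) ^+ 2)
  <= 8 * B * e'.
Proof.
move=> /andP[e0 e1] gap S0 hB.
have k1 : (1 - e) ^+ 2 <= 1 by rewrite expr_le1//; lra.
have k0 : 0 <= (1 - e) ^+ 2 by exact: sqr_ge0.
pose a := (K * gamma0) ^+ 2; pose b := (gamma0 * sigma_h) ^+ 2.
pose c := sigma_g ^+ 2.
have [a0 b0 c0] : [/\ 0 <= a, 0 <= b & 0 <= c] by split; exact: sqr_ge0.
have q0 : 0 <= e ^+ 2 by exact: sqr_ge0.
have B0 : 0 <= B.
  by apply: le_trans hB; rewrite addr_ge0// mulr_ge0// addr_ge0.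
have -> : (1 - e) ^+ 2 * (2 * K * (gamma0 * e)) ^+ 2 =
  (1 - e) ^+ 2 * (4 * a * e ^+ 2) by rewrite /a; ring.
have -> : 2 * ((1 - e) * (gamma0 * e) * sigma_h) ^+ 2 + 2 * (e * sigma_g) ^+ 2 =
  (1 - e) ^+ 2 * (2 * b * e ^+ 2) + 2 * c * e ^+ 2 by rewrite /b /c; ring.
have h1 : (1 - e) ^+ 2 * (4 * a * e ^+ 2) <= 4 * a * e ^+ 2.
  by rewrite ler_piMl// mulr_ge0// mulr_ge0.
have h2 : S * ((1 - e) ^+ 2 * (2 * b * e ^+ 2) + 2 * c * e ^+ 2) <=
          4 * (S * (b + c)) * e ^+ 2.
  have -> : 4 * (S * (b + c)) * e ^+ 2 = S * (4 * b * e ^+ 2 + 4 * c * e ^+ 2).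
    by ring.
  have u : 0 <= b * e ^+ 2 by rewrite mulr_ge0.
  have u' : 0 <= c * e ^+ 2 by rewrite mulr_ge0.
  have h : (1 - e) ^+ 2 * (2 * b * e ^+ 2) <= 2 * b * e ^+ 2.
    by rewrite ler_piMl// -mulrA mulr_ge0.
  by rewrite ler_wpM2l//; lra.
have h3 : 4 * (a + S * (b + c)) * e ^+ 2 <= 4 * B * e ^+ 2.
  by rewrite ler_wpM2r// ler_wpM2l.
have h4 : 8 * B * (e - e') <= 8 * B * (e ^+ 2 / 2) by rewrite ler_wpM2l// mulr_ge0.
lra.
Qed.

Section momentum_bounds.
Context (c : 'I_n -> R) (Lf B : R).
Hypothesis lf : grad_lipschitz Lf (wsum c f).
Hypothesis hB : (Lf * gamma0) ^+ 2 +
  (\sum_i c i ^+ 2) * ((gamma0 * sigma_h) ^+ 2 + sigma_g ^+ 2) <= B.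

Local Open Scope ereal_scope.

(** The bound starts at time 1 and is free of [v0]: as [eta 0 = 1], the first step multiplies the
    initial error by 0. *)
Lemma momentum_L2 t :
  \int[P]_w (enorm (momentum_error c t.+1 w) ^+ 2)%:E <= (8 * B * eta t.+1)%:E.
Proof.
have key u : ((1 - eta u) ^+ 2)%:E *
    \int[P]_w (enorm (momentum_error c u w) ^+ 2)%:E <=
    ((1 - eta u) * (8 * B * eta u))%:E ->
    \int[P]_w (enorm (momentum_error c u.+1 w) ^+ 2)%:E <=
    (8 * B * eta u.+1)%:E.
  move=> hu; apply: (le_trans (momentum_step u lf)).
  rewrite ge0_muleDr ?lee_fin ?sqr_ge0//; last first.
    by apply: integral_ge0 => w _; rewrite lee_fin sqr_ge0.
  apply: (le_trans (leeD (leeD hu (lexx _)) (lexx _))).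
  rewrite -EFinM -!EFinD lee_fin /client_var -mulr_suml gammaE -etaE.
  apply: momentum_recursion => //.
  - by have /andP[/ltW -> ->] := eta01 u.
  - exact: eta_gap.
  - by rewrite sumr_ge0// => i _; exact: sqr_ge0.
elim: t => [|t ih]; apply: key.
  by rewrite etaE rate00// expr1n subrr expr0n mul0e mul0r.
rewrite expr2 EFinM -muleA EFinM; have /andP[_ e1] := eta01 t.+1.
apply: lee_wpmul2l; first by rewrite lee_fin subr_ge0.
apply: le_trans ih; rewrite -[leRHS]mul1e; apply: lee_wpmul2r.
  by apply: integral_ge0 => w _; rewrite lee_fin sqr_ge0.
by rewrite lee_fin lerBlDr lerDl; have /andP[/ltW] := eta01 t.+1.
Qed.

Lemma momentum_L1 (M : R) t : (0 <= M)%R -> (B <= M ^+ 2)%R ->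
  \int[P]_w (enorm (momentum_error c t.+1 w))%:E <= (3 * M * r t.+1)%:E.
Proof.
move=> M0 BM; apply: integral_le_sqr.
- apply: measurable_enorm => j.
  have sub := measurable_fun_sub (@drawn_before_measurable t.+1).
  by apply: sub; exact: momentum_adapted.
- by move=> w; exact: enorm_ge0.
- by rewrite !mulr_ge0// ltW.
- apply: (le_trans (momentum_L2 t)); rewrite lee_fin etaE.
  have q0 : (0 <= r t.+1 ^+ 2)%R by exact: sqr_ge0.
  (* The constant 3 comes from 8 <= 3^2. *)
  have -> : ((3 * M * r t.+1) ^+ 2 = 9 * M ^+ 2 * r t.+1 ^+ 2)%R by ring.
  rewrite ler_wpM2r//; have := sqr_ge0 M; lra.
Qed.

End momentum_bounds.

Definition client_bound (i : 'I_n) : R :=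
  Lc i * gamma0 + gamma0 * sigma_h + sigma_g.

Lemma client_bound_ge0 i : 0 <= client_bound i.
Proof. by rewrite !addr_ge0// mulr_ge0// ltW. Qed.

Lemma client_error_L1 t i :
  (\int[P]_w (enorm (client_error t.+1 i w))%:E <=
   (3 * client_bound i * r t.+1)%:E)%E.
Proof.
pose c (k : 'I_n) : R := (k == i)%:R.
have cE (W : lmodType R) (u : 'I_n -> W) : \sum_k c k *: u k = u i.
  rewrite (bigD1 i)//= /c eqxx scale1r big1 ?addr0// => k /negbTE ->.
  by rewrite scale0r.
have lf : grad_lipschitz (Lc i) (wsum c f).
  move=> y z; have -> : wsum c f = f i.
    by apply/funext => u; rewrite /wsum (cE R^o (fun k => f k u)).
  exact: lc.
have cc : \sum_k c k ^+ 2 = 1.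
  rewrite (bigD1 i)//= /c eqxx expr1n big1 ?addr0// => k /negbTE ->.
  by rewrite expr0n.
have -> : (fun w => (enorm (client_error t.+1 i w))%:E) =
    (fun w => (enorm (momentum_error c t.+1 w))%:E).
  by apply/funext => w; rewrite /momentum_error (cE _ (fun k => client_error t.+1 k w)).
apply: (momentum_L1 lf (lexx _) t (client_bound_ge0 i)).
rewrite cc mul1r /client_bound.
have := mulr_ge0 (Lc0 i) (ltW gamma00); have := mulr_ge0 (ltW gamma00) sigma_h0.
have h (a b e : R) : 0 <= a -> 0 <= b -> 0 <= e ->
    a ^+ 2 + (b ^+ 2 + e ^+ 2) <= (a + b + e) ^+ 2 by nra.
by move=> ? ?; exact: h.
Qed.

Let s : R := Num.sqrt (1 - alpha).

Definition client_error_bound (i : 'I_n) (t : nat) : R :=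
  if t is t'.+1 then 3 * client_bound i * r t
  else enorm (v0 i - grad (f i) x0).

(** [compression_step] solved with equality, after the expected client errors are replaced by their
    bounds. *)
Fixpoint compression_bound (i : 'I_n) (t : nat) : R :=
  if t is t'.+1 then
    s * (compression_bound i t' + client_error_bound i t + client_error_bound i t'
         + Lc i * (gamma0 * r t' ^+ 2))
  else enorm (g0 i - v0 i).

Lemma client_error_bound_ge0 i t : 0 <= client_error_bound i t.
Proof.
case: t => [|t]; first exact: enorm_ge0.
by rewrite /= !mulr_ge0 ?client_bound_ge0// ltW.
Qed.

Lemma compression_bound_ge0 i t : 0 <= compression_bound i t.
Proof.
elim: t => [|t ih]; first exact: enorm_ge0.
rewrite /= mulr_ge0 ?sqrtr_ge0// !addr_ge0 ?client_error_bound_ge0//.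
  by rewrite !mulr_ge0 ?client_bound_ge0// ltW.
by rewrite !mulr_ge0 ?sqr_ge0// ltW.
Qed.

Lemma client_error_le t i :
  (\int[P]_w (enorm (client_error t i w))%:E <= (client_error_bound i t)%:E)%E.
Proof.
case: t => [|t]; last exact: client_error_L1.
have -> : (fun w => (enorm (client_error 0 i w))%:E) =
    cst (enorm (v0 i - grad (f i) x0))%:E.
  by apply/funext => w; rewrite /client_error; have [-> _ -> _] := algo w.
by rewrite integral_cst//= probability_setT mule1.
Qed.

Lemma compression_error_le t i :
  (\int[P]_w (enorm (compression_error t i w))%:E <=
   (compression_bound i t)%:E)%E.
Proof.
elim: t => [|t ih].
  have -> : (fun w => (enorm (compression_error 0 i w))%:E) =
      cst (enorm (g0 i - v0 i))%:E.
    by apply/funext => w; rewrite /compression_error; have [_ -> -> _] := algo w.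
  by rewrite integral_cst//= probability_setT mule1.
apply: (le_trans (compression_step t i)).
rewrite (ger0_norm (gamma_ge0 t)) gammaE [compression_bound _ _]/=.
rewrite (EFinM s); apply: lee_wpmul2l; first by rewrite lee_fin sqrtr_ge0.
rewrite 3!EFinD.
exact: leeD (leeD (leeD ih (client_error_le t.+1 i)) (client_error_le t i)) (lexx _).
Qed.

Lemma compression_total i T :
  (1 - s) * (\sum_(t < T) gamma0 * r t ^+ 2 * compression_bound i t) <=
  gamma0 * enorm (g0 i - v0 i) + s * (gamma0 * enorm (v0 i - grad (f i) x0)
    + 7 * client_bound i * gamma0 * \sum_(t < T) r t ^+ 3).
Proof.
have s01 : 0 <= s < 1.
  rewrite sqrtr_ge0/= -sqrtr1 ltr_sqrt//; case/andP: alpha01; lra.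
apply: (@compression_sum R r r0 r3 (compression_bound i) (client_error_bound i)
  s gamma0 (Lc i) (client_bound i) s01 gamma00 (Lc0 i)) => //.
- by rewrite /client_bound -addrA lerDl addr_ge0// mulr_ge0// ltW.
- exact: compression_bound_ge0.
- exact: client_error_bound_ge0.
Qed.

(** * Descent *)

Unset Implicit Arguments.
Context (L : R).
Hypothesis n0 : (0 < n)%N.
Hypothesis L0 : 0 < L.
Hypothesis lip : grad_lipschitz L (average_fun f).
Hypothesis bounded_below : has_lbound (range (average_fun f)).
Set Implicit Arguments.

Let finf := inf (range (average_fun f)).

Let mean_c : 'I_n -> R := fun=> n%:R^-1.

Lemma average_differentiable : twice_differentiable (average_fun f).
Proof. by rewrite average_wsum; exact: twice_differentiable_wsum. Qed.

Definition gradient (t : nat) (w : Omega) : 'rV[R]_d :=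
  grad (average_fun f) (x t w).

Lemma finf_le y : finf <= average_fun f y.
Proof. by apply: ge_inf => //; exists y. Qed.

Lemma descent_step t w :
  average_fun f (x t.+1 w) <= average_fun f (x t w) - gamma t * enorm (gradient t w)
   + 2 * gamma t * enorm (gradient t w - mean_g t w) + L * gamma t ^+ 2.
Proof.
have df1 := average_differentiable.1.
have E : x t.+1 w = x t w + (- gamma t) *: normalize (mean_g t w).
  by rewrite scaleNr x_step.
have h1 := descent (x t w) ((- gamma t) *: normalize (mean_g t w)) df1 lip.
rewrite -E in h1; apply: (le_trans h1).
rewrite dotvZl enormZ normrN (ger0_norm (gamma_ge0 t)).
have h2 := dotv_normalize_ge (gradient t w) (mean_g t w).
have h3 := ler_wpM2l (gamma_ge0 t) h2.
have h4 : L * (gamma t * enorm (normalize (mean_g t w))) ^+ 2 <= L * gamma t ^+ 2.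
  rewrite exprMn ler_wpM2l ?(ltW L0)// ler_piMr ?sqr_ge0//.
  by rewrite expr_le1// ?enorm_ge0// enorm_normalize_le1.
rewrite -/(gradient t w).
move: h3 h4; set D1 := dotv _ _; set e1 := enorm (gradient t w).
set e2 := enorm (gradient t w - _); set e3 := L * (_ * _) ^+ 2 => h3 h4.
lra.
Qed.

(** The step used here follows the true gradient and is not one the algorithm takes; it ends no
    lower than the infimum, so no direction error is paid. *)
Lemma initial_gradient w :
  gamma0 * enorm (gradient 0 w) <= average_fun f x0 - finf + L * gamma0 ^+ 2.
Proof.
have df1 := average_differentiable.1.
have x0E : x 0 w = x0 by have [] := algo w.
have h1 := descent x0 ((- gamma0) *: normalize (grad (average_fun f) x0)) df1 lip.
have h2 := le_trans (finf_le _) h1.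
rewrite dotvZl dotv_normalize enormZ normrN (ger0_norm (ltW gamma00)) in h2.
rewrite /gradient x0E.
have h4 : L * (gamma0 * enorm (normalize (grad (average_fun f) x0))) ^+ 2 <=
          L * gamma0 ^+ 2.
  rewrite exprMn ler_wpM2l ?(ltW L0)// ler_piMr ?sqr_ge0//.
  by rewrite expr_le1// ?enorm_ge0// enorm_normalize_le1.
move: h2 h4; set e3 := L * (_ * _) ^+ 2; set e1 := enorm (grad _ _) => h2 h4.
lra.
Qed.

(** Compression errors enter as a mean of norms, since distinct clients may share compression
    randomness. Momentum errors enter as the norm of a mean, which preserves the gain from
    independent samples. *)
Definition direction_error (t : nat) (w : Omega) : R :=
  n%:R^-1 * (\sum_i enorm (compression_error t i w))
  + enorm (momentum_error mean_c t w).

Lemma direction_error_ge t w :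
  enorm (gradient t w - mean_g t w) <= direction_error t w.
Proof.
have E : gradient t w - mean_g t w =
    - (n%:R^-1 *: (\sum_i compression_error t i w) + momentum_error mean_c t w).
  rewrite /gradient average_wsum grad_wsumE// /mean_g /momentum_error.
  rewrite !scaler_sumr -big_split/= -sumrB -sumrN; apply: eq_bigr => i _.
  by rewrite /mean_c /compression_error -scalerBr -scalerDr -scalerN subrKA opprB.
rewrite E enormN; apply: (le_trans (enormD _ _)); apply: lerD => //.
rewrite enormZ ger0_norm ?invr_ge0// ler_wpM2l ?invr_ge0//.
exact: enorm_sum.
Qed.

Lemma descent_sum T w :
  \sum_(t < T) gamma t.+1 * enorm (gradient t.+1 w) + average_fun f (x T.+1 w) <=
  average_fun f (x 1 w)
  + \sum_(t < T) (2 * gamma t.+1 * direction_error t.+1 w + L * gamma t.+1 ^+ 2).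
Proof.
elim: T => [|T ih]; first by rewrite !big_ord0 add0r addr0.
rewrite !big_ord_recr/=.
have h1 := descent_step T.+1 w.
have g2 : 0 <= 2 * gamma T.+1 by rewrite mulr_ge0// gamma_ge0.
have h2 := ler_wpM2l g2 (direction_error_ge T.+1 w).
move: ih h1 h2; set a := \sum_(_ < _) _; set b := \sum_(_ < _) _.
lra.
Qed.

(** [initial_gradient] is used twice, for the term t = 0 of the sum and for the possible rise of f
    in the first step. Telescoping from f(x^1) adds a third copy of the same quantities. *)
Definition fixed_cost (T : nat) : R :=
  3 * (average_fun f x0 - finf) + 3 * (L * gamma0 ^+ 2)
  + L * \sum_(t < T) gamma t.+1 ^+ 2.

Lemma gamma_0 : gamma 0 = gamma0.
Proof. by rewrite gammaE rate00// expr1n mulr1. Qed.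

(** Cauchy-Schwarz, whatever the direction of the step. It is applied at t = 0 only. *)
Lemma ascent_step t w :
  average_fun f (x t.+1 w) <=
  average_fun f (x t w) + gamma t * enorm (gradient t w) + L * gamma t ^+ 2.
Proof.
have df1 := average_differentiable.1.
have h1 := descent (x t w) ((- gamma t) *: normalize (mean_g t w)) df1 lip.
have E : x t.+1 w = x t w + (- gamma t) *: normalize (mean_g t w).
  by rewrite scaleNr x_step.
rewrite -E in h1; apply: (le_trans h1).
have h2 : enorm ((- gamma t) *: normalize (mean_g t w)) <= gamma t.
  rewrite enormZ normrN (ger0_norm (gamma_ge0 t)) ler_piMr ?gamma_ge0//.
  exact: enorm_normalize_le1.
apply: lerD; first rewrite lerD2l.
  by apply: (le_trans (dotv_le _ _)); rewrite ler_wpM2r// enorm_ge0.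
by rewrite ler_wpM2l ?(ltW L0)// ler_sqr ?nnegrE ?enorm_ge0 ?gamma_ge0.
Qed.

Lemma gradient_sum T w :
  \sum_(t < T.+1) gamma t * enorm (gradient t w) <=
  fixed_cost T + \sum_(t < T) 2 * gamma t.+1 * direction_error t.+1 w.
Proof.
have h0 := initial_gradient w.
have h1 := ascent_step 0 w.
have h2 := descent_sum T w.
have h3 := finf_le (x T.+1 w).
have x0E : x 0 w = x0 by have [] := algo w.
rewrite big_split/= -mulr_sumr in h2.
rewrite gamma_0 x0E in h1.
rewrite big_ord_recl gamma_0 /fixed_cost.
move: h0 h1 h2 h3; rewrite /bump /=.
set a := enorm (gradient 0 w); set b := \sum_(_ < _) _; set e := \sum_(_ < _) _.
set k := \sum_(_ < _) _; set g2 := gamma0 ^+ 2.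
lra.
Qed.

Lemma fixed_cost_ge0 T : 0 <= fixed_cost T.
Proof.
rewrite /fixed_cost addr_ge0//.
  by rewrite addr_ge0// mulr_ge0// ?subr_ge0 ?finf_le// mulr_ge0 ?sqr_ge0 ?ltW.
by rewrite mulr_ge0 ?(ltW L0)// sumr_ge0// => t _; exact: sqr_ge0.
Qed.

Let Mbar : R := L * gamma0 + (gamma0 * sigma_h + sigma_g) / Num.sqrt n%:R.

Lemma mean_momentum_L1 t :
  (\int[P]_w (enorm (momentum_error mean_c t.+1 w))%:E <= (3 * Mbar * r t.+1)%:E)%E.
Proof.
have lf : grad_lipschitz L (wsum mean_c f) by rewrite -average_wsum.
have h0 : 0 <= gamma0 * sigma_h by rewrite mulr_ge0// ltW.
have nR : (0 : R) < n%:R by rewrite ltr0n.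
have sn : 0 < Num.sqrt n%:R :> R by rewrite sqrtr_gt0.
have M0 : 0 <= Mbar.
  by rewrite addr_ge0// ?mulr_ge0 ?(ltW L0) ?(ltW gamma00)// ?invr_ge0 ?addr_ge0// ltW.
apply: (momentum_L1 lf (lexx _) t M0).
rewrite /mean_c sumr_const card_ord -[_ *+ n]mulr_natl.
(* The sum of the squared weights is 1/n: this is the gain of averaging. *)
have -> : n%:R * n%:R^-1 ^+ 2 = (Num.sqrt n%:R)^-1 ^+ 2 :> R.
  rewrite -[in LHS](sqr_sqrtr (ltW nR)); field; exact: lt0r_neq0.
have i0 : 0 < (Num.sqrt n%:R)^-1 :> R by rewrite invr_gt0.
rewrite /Mbar; set y := (Num.sqrt n%:R)^-1 in i0 *.
have a0 : 0 <= L * gamma0 by rewrite mulr_ge0 ?ltW.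
have b0 : 0 <= gamma0 * sigma_h * y by rewrite mulr_ge0// ltW.
have c0 : 0 <= sigma_g * y by rewrite mulr_ge0// ltW.
have h (a b e : R) : 0 <= a -> 0 <= b -> 0 <= e ->
    a ^+ 2 + (b ^+ 2 + e ^+ 2) <= (a + (b + e)) ^+ 2 by nra.
have := h _ _ _ a0 b0 c0; rewrite -mulrDl.
by congr (_ <= _); congr (_ + _); ring.
Qed.

Lemma vmeasurable_momentum c t : vmeasurable (momentum_error c t).
Proof.
have sub := measurable_fun_sub (@drawn_before_measurable t).
by move=> j; apply: sub; exact: momentum_adapted.
Qed.

Lemma measurable_direction_error t : measurable_fun setT (direction_error t).
Proof.
apply: measurable_funD; last exact/measurable_enorm/vmeasurable_momentum.
apply: measurable_funM => //; apply: measurable_sum => i.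
by apply: measurable_enorm; have [] := vmeasurable_errors t i.
Qed.

Lemma direction_error_ge0 t w : 0 <= direction_error t w.
Proof.
by rewrite addr_ge0 ?enorm_ge0// mulr_ge0 ?invr_ge0// sumr_ge0// => i _; exact: enorm_ge0.
Qed.

Lemma direction_error_le t :
  (\int[P]_w (direction_error t.+1 w)%:E <=
   (n%:R^-1 * (\sum_i compression_bound i t.+1) + 3 * Mbar * r t.+1)%:E)%E.
Proof.
have mc i : measurable_fun setT (fun w => enorm (compression_error t.+1 i w)).
  by apply: measurable_enorm; have [] := vmeasurable_errors t.+1 i.
have mm : measurable_fun setT (fun w => enorm (momentum_error mean_c t.+1 w)).
  exact/measurable_enorm/vmeasurable_momentum.
have ms : measurable_fun setT
    (fun w => n%:R^-1 * (\sum_i enorm (compression_error t.+1 i w))).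
  by apply: measurable_funM => //; exact: measurable_sum.
have s0 w : 0 <= n%:R^-1 * (\sum_i enorm (compression_error t.+1 i w)).
  by rewrite mulr_ge0 ?invr_ge0// sumr_ge0// => i _; exact: enorm_ge0.
have m0 w : 0 <= enorm (momentum_error mean_c t.+1 w) by exact: enorm_ge0.
have h1 := integral_leD (direction_error_ge0 t.+1) s0 m0 ms mm (fun w => lexx _).
apply: (le_trans h1); rewrite EFinD.
refine (leeD _ (mean_momentum_L1 t)).
under eq_integral do rewrite EFinM -sumEFin.
have e0 i w : (0 <= (enorm (compression_error t.+1 i w))%:E)%E.
  by rewrite lee_fin enorm_ge0.
have me i : measurable_fun setT (fun w => (enorm (compression_error t.+1 i w))%:E).
  exact/measurable_EFinP.
rewrite ge0_integralZl; first last.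
- by rewrite lee_fin invr_ge0.
- by move=> w _; exact: sume_ge0.
- exact: emeasurable_sum.
- exact: measurableT.
rewrite ge0_integral_sum; [|exact: measurableT|exact: me|by move=> i w _; exact: e0].
rewrite EFinM; apply: lee_wpmul2l; first by rewrite lee_fin invr_ge0.
rewrite -sumEFin; apply: lee_sum => i _; exact: compression_error_le.
Qed.

Lemma measurable_gradient_norm t : measurable_fun setT (fun w => enorm (gradient t w)).
Proof.
apply: measurable_enorm; have [mx _ _] := iterates_measurable t.
exact: (@vmeasurable_grad _ _ _ average_differentiable _ Omega _ mx).
Qed.

Lemma expected_gradient_sum T :
  (\sum_(t < T.+1) (gamma t)%:E * \int[P]_w (enorm (gradient t w))%:E <=
   (fixed_cost T + \sum_(t < T) 2 * gamma t.+1 *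
     (n%:R^-1 * (\sum_i compression_bound i t.+1) + 3 * Mbar * r t.+1))%:E)%E.
Proof.
have gt0 t : 0 <= gamma t by exact: gamma_ge0.
have g20 t : 0 <= 2 * gamma t by rewrite mulr_ge0.
have mg t : measurable_fun setT (fun w => (enorm (gradient t w))%:E).
  by apply/measurable_EFinP; exact: measurable_gradient_norm.
have md t : measurable_fun setT (fun w => (direction_error t w)%:E).
  by apply/measurable_EFinP; exact: measurable_direction_error.
have -> : (\sum_(t < T.+1) (gamma t)%:E * \int[P]_w (enorm (gradient t w))%:E =
    \int[P]_w (\sum_(t < T.+1) (gamma t * enorm (gradient t w))%R%:E))%E.
  rewrite ge0_integral_sum; first last.
  - by move=> t w _; rewrite lee_fin mulr_ge0 ?enorm_ge0.
  - move=> t; apply/measurable_EFinP; apply: measurable_funM => //.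
    exact: measurable_gradient_norm.
  - exact: measurableT.
  apply: eq_bigr => t _; under [RHS]eq_integral do rewrite EFinM.
  rewrite ge0_integralZl//; first by move=> w _; rewrite lee_fin enorm_ge0.
  by rewrite lee_fin.
apply: (@le_trans _ _ (\int[P]_w ((fixed_cost T)%:E +
    \sum_(t < T) (2 * gamma t.+1)%:E * (direction_error t.+1 w)%:E))%E).
  apply: ge0_le_integral_nonmeas => w.
    by apply: sume_ge0 => t _; rewrite lee_fin mulr_ge0 ?enorm_ge0.
  rewrite sumEFin; under [X in (_ <= _ + X)%E]eq_bigr do rewrite -EFinM.
  by rewrite sumEFin -EFinD lee_fin; exact: gradient_sum.
have t0 t w : (0 <= (2 * gamma t)%:E * (direction_error t w)%:E)%E.
  by rewrite -EFinM lee_fin mulr_ge0 ?direction_error_ge0.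
have mt t : measurable_fun setT
    (fun w => ((2 * gamma t)%:E * (direction_error t w)%:E)%E).
  exact: measurable_funeM.
rewrite ge0_integralD; first last.
- by apply: emeasurable_sum => t; exact: mt.
- by move=> w _; apply: sume_ge0 => t _; exact: t0.
- exact: measurable_cst.
- by move=> w _; rewrite lee_fin fixed_cost_ge0.
- exact: measurableT.
rewrite integral_cst//= probability_setT mule1 (EFinD (fixed_cost T)).
refine (leeD (lexx _) _).
rewrite ge0_integral_sum; first last.
- by move=> t w _; exact: t0.
- by move=> t; exact: mt.
- exact: measurableT.
rewrite -sumEFin; apply: lee_sum => t _.
rewrite ge0_integralZl; first last.
- by rewrite lee_fin.
- by move=> w _; rewrite lee_fin direction_error_ge0.
- exact: md.
- exact: measurableT.
rewrite (EFinM (2 * gamma t.+1)); apply: lee_wpmul2l; first by rewrite lee_fin.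
exact: direction_error_le.
Qed.

(** * Collecting the costs into the stated bound *)

Lemma contraction_ratio : s / (1 - s) <= 2 * (alpha ^+ 2)^-1 /\ 0 < 1 - s.
Proof.
have [a0 a1] := andP alpha01.
have s0 : 0 <= s by exact: sqrtr_ge0.
have s2 : s ^+ 2 = 1 - alpha by rewrite sqr_sqrtr// subr_ge0.
(* Squaring gives 1 - alpha <= (1 - alpha / 2)^2. Hence the ratio is at most 2 / alpha, which is
   then weakened to the power of alpha in the statement. *)
have sa : s <= 1 - alpha / 2.
  rewrite -ler_sqr ?nnegrE//; last lra.
  by rewrite s2; have := sqr_ge0 alpha; lra.
have p : 0 < 1 - s by lra.
split=> //; rewrite ler_pdivrMr//.
have ai1 : 1 <= alpha^-1 by rewrite -invr1 lef_pV2 ?posrE.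
have h : 1 <= 2 * alpha^-1 * (1 - s).
  apply: (@le_trans _ _ (2 * alpha^-1 * (alpha / 2))).
    by rewrite le_eqVlt; apply/orP; left; apply/eqP; field; exact: lt0r_neq0.
  by rewrite ler_wpM2l; lra.
have -> : 2 * (alpha ^+ 2)^-1 * (1 - s) = alpha^-1 * (2 * alpha^-1 * (1 - s)).
  by field; exact: lt0r_neq0.
apply: (@le_trans _ _ 1); first lra.
by apply: (le_trans h); rewrite ler_peMl//; lra.
Qed.

Let ibar (u : 'I_n -> R) : R := n%:R^-1 * \sum_i u i.

Lemma mean_le (u u' : 'I_n -> R) : (forall i, u i <= u' i) -> ibar u <= ibar u'.
Proof. by move=> h; rewrite ler_wpM2l ?invr_ge0// ler_sum. Qed.

Lemma mean_ge0 (u : 'I_n -> R) : (forall i, 0 <= u i) -> 0 <= ibar u.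
Proof. by move=> h; rewrite mulr_ge0 ?invr_ge0// sumr_ge0. Qed.

Lemma compression_cost T :
  \sum_(t < T) gamma t.+1 * ibar (fun i => compression_bound i t.+1) <=
  gamma0 / (1 - s) * ibar (fun i => enorm (g0 i - v0 i)) +
  s / (1 - s) * (gamma0 * ibar (fun i => enorm (v0 i - grad (f i) x0)) +
    7 * gamma0 * (\sum_(t < T.+1) r t ^+ 3) *
    (ibar Lc * gamma0 + gamma0 * sigma_h + sigma_g)).
Proof.
have [_ p] := contraction_ratio.
set V := \sum_(t < T.+1) r t ^+ 3.
have -> : \sum_(t < T) gamma t.+1 * ibar (fun i => compression_bound i t.+1) =
    ibar (fun i => \sum_(t < T) gamma t.+1 * compression_bound i t.+1).
  rewrite /ibar [in RHS]exchange_big [in RHS]mulr_sumr; apply: eq_bigr => t _.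
  by rewrite -[in RHS]mulr_sumr mulrCA.
apply: (@le_trans _ _ (ibar (fun i => gamma0 / (1 - s) * enorm (g0 i - v0 i) +
    s / (1 - s) * (gamma0 * enorm (v0 i - grad (f i) x0)
    + 7 * gamma0 * V * client_bound i)))).
  apply: mean_le => i; have := compression_total i T.+1.
  rewrite big_ord_recl mulrDr -/V => h.
  have -> : \sum_(t < T) gamma t.+1 * compression_bound i t.+1 =
    \sum_(t < T) gamma0 * r (lift ord0 t) ^+ 2 * compression_bound i (lift ord0 t).
    by apply: eq_bigr => t _; rewrite gammaE.
  rewrite -(ler_pM2l p).
  (* [compression_total] starts at t = 0, the cost at t = 1; the extra term is nonnegative and is
     dropped. *)
  have h0 : 0 <= (1 - s) * (gamma0 * r (@ord0 T) ^+ 2 * compression_bound i (@ord0 T)).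
    by rewrite mulr_ge0 ?(ltW p)// mulr_ge0 ?compression_bound_ge0// mulr_ge0 ?sqr_ge0// ltW.
  have -> : (1 - s) * (gamma0 / (1 - s) * enorm (g0 i - v0 i) +
    s / (1 - s) * (gamma0 * enorm (v0 i - grad (f i) x0)
    + 7 * gamma0 * V * client_bound i)) =
    gamma0 * enorm (g0 i - v0 i) + s * (gamma0 * enorm (v0 i - grad (f i) x0)
    + 7 * client_bound i * gamma0 * V) by field; exact: lt0r_neq0.
  by apply: le_trans h; rewrite lerDr.
rewrite /ibar big_split/= -!mulr_sumr big_split/= -!mulr_sumr.
have -> : \sum_i client_bound i =
    (\sum_i Lc i) * gamma0 + n%:R * (gamma0 * sigma_h + sigma_g).
  rewrite mulr_suml; have -> : n%:R * (gamma0 * sigma_h + sigma_g) =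
      \sum_(i < n) (gamma0 * sigma_h + sigma_g).
    by rewrite sumr_const card_ord mulr_natl.
  by rewrite -big_split/=; apply: eq_bigr => i _; rewrite /client_bound addrA.
rewrite le_eqVlt; apply/orP; left; apply/eqP.
have nn : n%:R != 0 :> R by rewrite pnatr_eq0 -lt0n.
by field; rewrite nn lt0r_neq0.
Qed.

Definition target_bound : R :=
  V_zero f alpha gamma0 x0 g0 v0 / gamma0
      + (sigma_g + gamma0 * sigma_h) * ((Num.sqrt n%:R)^-1 + (alpha ^+ 2)^-1)
      + gamma0 * (L + n%:R^-1 * (\sum_(i < n) Lc i) / alpha ^+ 2).

Lemma cost_bound T :
  fixed_cost T + \sum_(t < T) 2 * gamma t.+1 *
     (n%:R^-1 * (\sum_i compression_bound i t.+1) + 3 * Mbar * r t.+1) <=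
  56 * (1 + ln (T.+1%:R + 1)) * (gamma0 * target_bound).
Proof.
have [k1 p] := contraction_ratio.
have hC := compression_cost T.
set V := \sum_(t < T.+1) r t ^+ 3 in hC.
set l := 1 + ln (T.+1%:R + 1).
have V2 : V <= 2 * l - 2.
  by have := sum_rate3 r3 T.+1; rewrite -/V /l; lra.
pose V' := \sum_(t < T) r t.+1 ^+ 3.
have V'V : V' <= V.
  by rewrite /V big_ord_recl lerDr exprn_ge0// ltW.
have V'0 : 0 <= V' by rewrite sumr_ge0// => t _; rewrite exprn_ge0// ltW.
have l1 : 1 <= l by lra.
have sq : \sum_(t < T) gamma t.+1 ^+ 2 <= gamma0 ^+ 2 * V'.
  rewrite mulr_sumr; apply: ler_sum => t _; rewrite gammaE exprMn.
  have -> : (r t.+1 ^+ 2) ^+ 2 = r t.+1 * r t.+1 ^+ 3 by ring.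
  rewrite ler_wpM2l ?sqr_ge0//; apply: ler_piMl; last exact: (rate_le1 r0 r3).
  by rewrite exprn_ge0// ltW.
have -> : \sum_(t < T) 2 * gamma t.+1 *
     (n%:R^-1 * (\sum_i compression_bound i t.+1) + 3 * Mbar * r t.+1) =
   2 * (\sum_(t < T) gamma t.+1 * ibar (fun i => compression_bound i t.+1))
   + 6 * Mbar * gamma0 * V'.
  rewrite !mulr_sumr -big_split/=; apply: eq_bigr => t _.
  by rewrite gammaE /ibar; ring.
rewrite /fixed_cost /target_bound /V_zero -/finf -/s.
set Delta := average_fun f x0 - finf.
have D0 : 0 <= Delta by rewrite subr_ge0 finf_le.
move: hC; rewrite -/(ibar (fun i => enorm (g0 i - v0 i)))
  -/(ibar (fun i => enorm (v0 i - grad (f i) x0))) -/(ibar Lc).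
set G := ibar (fun i => enorm (g0 i - v0 i)).
set E := ibar (fun i => enorm (v0 i - grad (f i) x0)).
set C0 := \sum_(t < T) gamma t.+1 * _; set Lb := ibar Lc => hC.
have G0 : 0 <= G by apply: mean_ge0 => i; exact: enorm_ge0.
have E0 : 0 <= E by apply: mean_ge0 => i; exact: enorm_ge0.
have Lb0 : 0 <= Lb by apply: mean_ge0.
set i2 := (alpha ^+ 2)^-1 in k1 *.
set k := s / (1 - s) in k1 hC.
have k0 : 0 <= k by rewrite divr_ge0 ?sqrtr_ge0 ?ltW.
set m := Lb * gamma0 + gamma0 * sigma_h + sigma_g in hC.
have gg := ltW gamma00; have Lg := ltW L0.
have m0 : 0 <= m by rewrite !addr_ge0 ?(mulr_ge0 Lb0 gg) ?(mulr_ge0 gg sigma_h0).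
have i20 : 0 <= i2 by rewrite invr_ge0 sqr_ge0.
set y := (Num.sqrt n%:R)^-1.
have y0 : 0 <= y by rewrite invr_ge0 sqrtr_ge0.
pose A := gamma0 / (1 - s) * G; pose B := k * (gamma0 * E).
have A0 : 0 <= A by rewrite mulr_ge0// divr_ge0// ltW.
have B0 : 0 <= B by rewrite mulr_ge0// mulr_ge0.
have gm : 0 <= gamma0 * m by rewrite mulr_ge0.
have V0 : 0 <= V by exact: le_trans V'V.
(* 28 = 7 * 2 * 2, from [compression_sum], [k <= 2 * i2] and [V <= 2 * l]. As [C0] is counted twice,
   this produces the final 56, larger than every other coefficient. *)
have c1 : C0 <= A + B + 28 * (gamma0 * (m * i2) * l).
  apply: (le_trans hC); rewrite mulrDr addrA lerD2l.
  have -> : k * (7 * gamma0 * V * m) = 7 * ((gamma0 * m) * (k * V)) by ring.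
  have -> : 28 * (gamma0 * (m * i2) * l) = 7 * ((gamma0 * m) * ((2 * i2) * (2 * l))).
    by ring.
  rewrite ler_wpM2l// ler_wpM2l//.
  by apply: ler_pM => //; lra.
have Lg0 : 0 <= L * gamma0 ^+ 2 by rewrite mulr_ge0 ?sqr_ge0.
have c2 : L * (\sum_(t < T) gamma t.+1 ^+ 2) <= L * gamma0 ^+ 2 * (2 * l).
  apply: (@le_trans _ _ (L * gamma0 ^+ 2 * V')).
    by rewrite -mulrA ler_wpM2l.
  by rewrite ler_wpM2l//; lra.
pose z := gamma0 * (gamma0 * sigma_h + sigma_g) * y.
have z0 : 0 <= z.
  by rewrite /z mulr_ge0// mulr_ge0// addr_ge0// mulr_ge0.
have c3 : 6 * Mbar * gamma0 * V' <= 12 * (L * gamma0 ^+ 2 + z) * l.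
  have -> : 6 * Mbar * gamma0 * V' = 6 * (L * gamma0 ^+ 2 + z) * V'.
    by rewrite /Mbar /z -/y; ring.
  have -> : 12 * (L * gamma0 ^+ 2 + z) * l = 6 * (L * gamma0 ^+ 2 + z) * (2 * l).
    by ring.
  by rewrite ler_wpM2l; [|rewrite mulr_ge0// addr_ge0|lra].
have -> : 56 * l * (gamma0 * ((Delta + 2 * gamma0 / (1 - s) * G +
    2 * gamma0 * s / (1 - s) * E) / gamma0
    + (sigma_g + gamma0 * sigma_h) * (y + i2)
    + gamma0 * (L + Lb * i2))) =
  56 * (l * (Delta + 2 * A + 2 * B + z + gamma0 * (m * i2) + L * gamma0 ^+ 2)).
  by rewrite /A /B /k /z /m; field; rewrite !lt0r_neq0.
have w0 : 0 <= gamma0 * (m * i2) by rewrite mulr_ge0 ?mulr_ge0.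
set w := gamma0 * (m * i2) in w0 c1 *.
set lg := L * gamma0 ^+ 2 in Lg0 c2 c3 *.
set ss := L * (\sum_(t < T) _) in c2 *.
set e := 6 * Mbar * gamma0 * V' in c3 *.
have l0 : 0 <= l by lra.
have le_l (u : R) : 0 <= u -> u <= l * u by move=> u0; rewrite ler_peMl.
have := le_l _ D0; have := le_l _ A0; have := le_l _ B0; have := le_l _ Lg0.
have := mulr_ge0 l0 z0; have := mulr_ge0 l0 w0; have := mulr_ge0 l0 Lg0.
have := mulr_ge0 l0 D0; have := mulr_ge0 l0 A0; have := mulr_ge0 l0 B0.
move: c1 c2 c3; clearbody A B z w lg e ss C0 Delta l.
lra.
Qed.

Lemma output_gradient T (tau : {RV P >-> nat}) :
  (forall t, (t < T.+1)%N ->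
     P (tau @^-1` [set t]) = (gamma t / \sum_(k < T.+1) gamma k)%:E) ->
  independent2 P
    <<s \bigcup_(k in `I_T.+1) sigma_of (x k : Omega -> borelV R d) >>
    (sigma_of tau) ->
  ('E_P[fun w => enorm (grad (average_fun f) (x (tau w) w))] <=
   (56 * (1 + ln (T.+1%:R + 1)) * (target_bound / T.+1%:R `^ 3^-1))%:E)%E.
Proof.
move=> ptau ind.
set Gm := \sum_(k < T.+1) gamma k in ptau.
set Th := T.+1%:R `^ 3^-1.
have Th0 : 0 < Th by rewrite powR_gt0.
have GmTh : gamma0 * Th <= Gm.
  have -> : Gm = gamma0 * \sum_(k < T.+1) r k ^+ 2.
    by rewrite mulr_sumr; apply: eq_bigr => k _; rewrite gammaE.
  by rewrite ler_pM2l//; exact: (sum_rate2_ge r0 r3).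
have Gm0 : 0 < Gm by apply: lt_le_trans GmTh; rewrite mulr_gt0.
have mh : measurable_fun [set: borelV R d]
    ((fun y => enorm (grad (average_fun f) y)) : borelV R d -> R).
  apply: measurable_enorm.
  apply: (@vmeasurable_grad _ _ _ average_differentiable _ (borelV R d) (fun y => y)).
  by apply/measurable_fun_borelV; exact: measurable_id.
have p1 : \sum_(t < T.+1) gamma t / Gm = 1.
  by rewrite -mulr_suml divff// lt0r_neq0.
have mx t : vmeasurable (x t) by have [] := iterates_measurable t.
rewrite unlock.
apply: (le_trans (integral_random_index_le mx mh (fun y => enorm_ge0 _) ptau p1 ind)).
have -> : (\sum_(t < T.+1) (gamma t / Gm)%:E *
    \int[P]_w (enorm (grad (average_fun f) (x t w)))%:E =
    Gm^-1%:E * \sum_(t < T.+1) (gamma t)%:E * \int[P]_w (enorm (gradient t w))%:E)%E.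
  rewrite ge0_sume_distrr; last first.
    move=> t _; apply: mule_ge0; first by rewrite lee_fin gamma_ge0.
    by apply: integral_ge0 => w _; rewrite lee_fin enorm_ge0.
  by apply: eq_bigr => t _; rewrite mulrC EFinM muleA.
have h0 : (0 <= \sum_(t < T.+1) (gamma t)%:E * \int[P]_w (enorm (gradient t w))%:E)%E.
  apply: sume_ge0 => t _; apply: mule_ge0; first by rewrite lee_fin gamma_ge0.
  by apply: integral_ge0 => w _; rewrite lee_fin enorm_ge0.
set u := 56 * (1 + ln (T.+1%:R + 1)).
have h : (\sum_(t < T.+1) (gamma t)%:E * \int[P]_w (enorm (gradient t w))%:E <=
    (u * (gamma0 * target_bound))%:E)%E.
  by apply: (le_trans (expected_gradient_sum T)); rewrite lee_fin cost_bound.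
(* The sign is read off from the quantity being bounded; it permits replacing [Gm] by the smaller
   [gamma0 * Th] in the denominator. *)
have u0 : 0 <= u * (gamma0 * target_bound) by rewrite -lee_fin (le_trans h0 h).
apply: (@le_trans _ _ (Gm^-1%:E * (u * (gamma0 * target_bound))%:E)%E).
  by apply: lee_wpmul2l => //; rewrite lee_fin invr_ge0 ltW.
rewrite -EFinM lee_fin.
have -> : u * (target_bound / Th) = (gamma0 * Th)^-1 * (u * (gamma0 * target_bound)).
  by field; rewrite !lt0r_neq0.
by rewrite ler_wpM2r// lef_pV2 ?posrE// mulr_gt0.
Qed.

End iterates.

Theorem theorem3 (R : realType) :
  exists K p : R, 0 < K /\ 0 <= p /\
  forall (d n : nat) (dO dX dZ : measure_display)
    (Omega : measurableType dO) (P : probability Omega R)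
    (X : 'I_n -> measurableType dX) (D : forall i : 'I_n, probability (X i) R)
    (Z : nat -> 'I_n -> measurableType dZ)
    (Q : forall (t : nat) (i : 'I_n), probability (Z t i) R)
    (f : 'I_n -> 'rV[R]_d -> R) (F : forall i : 'I_n, 'rV[R]_d -> X i -> R)
    (C : forall (t : nat) (i : 'I_n), Z t i -> 'rV[R]_d -> 'rV[R]_d)
    (alpha L sigma_g sigma_h gamma0 : R) (Lc : 'I_n -> R)
    (x0 : 'rV[R]_d) (g0 v0 : 'I_n -> 'rV[R]_d)
    (q : nat -> {RV P >-> R})
    (xi : forall (t : nat) (i : 'I_n), {RV P >-> X i})
    (zeta : forall (t : nat) (i : 'I_n), {RV P >-> Z t i})
    (x : nat -> Omega -> 'rV[R]_d)
    (g v : nat -> 'I_n -> Omega -> 'rV[R]_d),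
  let eta := fun t : nat => (2 / (t%:R + 2)) `^ (2 / 3) in
  let gamma := fun t : nat => gamma0 * (2 / (t%:R + 2)) `^ (2 / 3) in
  (0 < n)%N ->
  (forall i, twice_differentiable (f i)) ->
  (forall i s, twice_differentiable (F i ^~ s)) ->
  (forall i y, F i y \in Lfun (D i) 1 /\ ('E_(D i)[F i y] = (f i y)%:E)%E) ->
  (* (i) *)
  0 < alpha -> alpha <= 1 ->
  (forall t i, compressor (C t i) /\ contractive (Q t i) alpha (C t i)) ->
  (* (ii) *)
  has_lbound (range (average_fun f)) ->
  (* (iii) *)
  (forall i, 0 < Lc i /\ grad_lipschitz (Lc i) (f i)) ->
  (* (iv) *)
  0 < L -> grad_lipschitz L (average_fun f) ->
  (* (v) *)
  0 <= sigma_g -> 0 <= sigma_h ->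
  (forall i y, has_mean (D i) (fun s => grad (F i ^~ s) y) (grad (f i) y)) ->
  (forall i y, ('E_(D i)[fun s => (enorm (grad (F i ^~ s) y - grad (f i) y) ^+ 2)%R]
                <= (sigma_g ^+ 2)%:E)%E) ->
  (forall i y, has_mean (D i) (fun s => hess (F i ^~ s) y) (hess (f i) y)) ->
  (forall i y, ('E_(D i)[fun s => (specnorm (hess (F i ^~ s) y - hess (f i) y) ^+ 2)%R]
                <= (sigma_h ^+ 2)%:E)%E) ->
  (* the algorithm and its randomness *)
  0 < gamma0 ->
  (forall t, has_law (q t) (uniform_prob (@ltr01 R))) ->
  (forall t i, has_law (xi t i) (D i)) ->
  (forall t i, has_law (zeta t i) (Q t i)) ->
  fresh_randomness q xi zeta ->
  EF21_RHM gamma eta F C q xi zeta x0 g0 v0 x g v ->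
  (* the conclusion; tau is the random index of the output point *)
  forall (T : nat) (tau : {RV P >-> nat}),
  (1 <= T)%N ->
  (forall t : nat, (t < T)%N ->
     P (tau @^-1` [set t]) = (gamma t / \sum_(s < T) gamma s)%:E) ->
  independent2 P <<s \bigcup_(s in `I_T) sigma_of (x s : Omega -> borelV R d) >>
    (sigma_of tau) ->
  let xtilde := fun w : Omega => x (tau w) w in
  let Lbar := n%:R^-1 * \sum_(i < n) Lc i in
  ('E_P[fun w => enorm (grad (average_fun f) (xtilde w))] <=
   (K * (1 + ln (T%:R + 1)) `^ p *
    ((V_zero f alpha gamma0 x0 g0 v0 / gamma0
      + (sigma_g + gamma0 * sigma_h) * ((Num.sqrt n%:R)^-1 + (alpha ^+ 2)^-1)
      + gamma0 * (L + Lbar / alpha ^+ 2))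
     / T%:R `^ 3^-1))%:E)%E.
Proof.
(* A single logarithm occurs, from the sum of 2 / (t + 2), so the exponent is 1; 56 is the constant
   of [cost_bound]. *)
exists 56, 1; split; first by []; split; first exact: ler01.
move=> d n dO dX dZ Omega P X D Z Q f F C alpha L sigma_g sigma_h gamma0 Lc.
move=> x0 g0 v0 q xi zeta x g v eta gamma n0 df dF _ alpha0 alpha1 hC bounded_below.
move=> lc L0 lip sigma_g0 sigma_h0 gmean gvar hmean hvar gamma00 law_q law_xi.
move=> law_zeta fresh algo [|T] // tau _ ptau ind.
(* With the cube root [r], [eta] is [r ^+ 2], the root of [eta] is [r], and the products of step
   size and error are multiples of [r ^+ 3]; all rate estimates become polynomial. *)
pose r (t : nat) : R := (2 / (t%:R + 2)) `^ 3^-1.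
have b0 (t : nat) : 0 < 2 / (t%:R + 2) :> R by rewrite divr_gt0// ltr_wpDl.
have r0 t : 0 < r t by exact: powR_gt0.
have r3 t : r t ^+ 3 = 2 / (t%:R + 2).
  by rewrite -powR_mulrn ?powR_ge0// -powRrM mulVf// powRr1// ltW.
have etaE t : eta t = r t ^+ 2.
  by rewrite -powR_mulrn ?powR_ge0// -powRrM [3^-1 * _]mulrC.
have gammaE t : gamma t = gamma0 * r t ^+ 2 by rewrite -etaE.
have l0 : 0 <= 1 + ln (T.+1%:R + 1) :> R.
  by rewrite addr_ge0// ln_ge0// lerDr.
rewrite powRr1//.
exact: (output_gradient dF (fun t i => (hC t i).1) gmean algo df hmean gvar hvar
  law_q law_xi fresh (introT andP (conj alpha0 alpha1))
  (fun t i => (hC t i).2) law_zeta (fun i => ltW (lc i).1) (fun i => (lc i).2)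
  gamma00 r0 r3 etaE gammaE sigma_g0 sigma_h0 n0 L0 lip bounded_below ptau ind).
Qed.
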